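(* Let $\tau\in\mathbb C$ with $\mathrm{Im}(\tau)>0$ and $E=E_\tau=\mathbb C/(\mathbb Z+\tau\mathbb Z)$. The universal family of stable vector bundles of rank two and degree one on $E_\tau$ gives (the associated geometric associative $r$-matrix being taken up to gauge equivalence) the following solution of the associative Yang--Baxter equation: $$r^{(2,1)}_{\mathrm{ell}}(x;y)=\frac12\,\frac{\theta_1'(0|\tau)}{\theta_1(y|\tau)}\left(\frac{\theta_1(y+\frac x2|\tau)}{\theta_1(\frac x2|\tau)}\,\mathbb 1\otimes\mathbb 1+\frac{\theta_2(y+\frac x2|\tau)}{\theta_2(\frac x2|\tau)}\,h\otimes h+\frac{\theta_3(y+\frac x2|\tau)}{\theta_3(\frac x2|\tau)}\,\sigma\otimes\sigma+\frac{\theta_4(y+\frac x2|\tau)}{\theta_4(\frac x2|\tau)}\,\gamma\otimes\gamma\right),$$ where $x=x_2-x_1$ and $y=y_2-y_1$ are the differences of the vector bundle parameters and of the points.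
   Context: Matrices: $\mathbb 1=\begin{pmatrix}1&0\\0&1\end{pmatrix}$, $h=\begin{pmatrix}1&0\\0&-1\end{pmatrix}$, $\sigma=\begin{pmatrix}0&-i\\i&0\end{pmatrix}$, $\gamma=\begin{pmatrix}0&1\\1&0\end{pmatrix}$. Theta functions, with $q=\exp(\pi i\tau)$: $\theta_1(z|\tau)=2q^{1/4}\sum_{n\ge0}(-1)^nq^{n(n+1)}\sin((2n+1)\pi z)$, $\theta_2(z|\tau)=2q^{1/4}\sum_{n\ge0}q^{n(n+1)}\cos((2n+1)\pi z)$, $\theta_3(z|\tau)=1+2\sum_{n\ge1}q^{n^2}\cos(2\pi nz)$, $\theta_4(z|\tau)=1+2\sum_{n\ge1}(-1)^nq^{n^2}\cos(2\pi nz)$. Universal family: for $x\in\mathbb C$ let $\mathcal P^x$ be the vector bundle of rank two on $E_\tau$ given by the quotient of $\mathbb C\times\mathbb C^2$ by the relations $(z,w)\sim(z+1,w)\sim(z+\tau,\Phi_x(z)w)$ with automorphy factor $\Phi_x(z)=e^{-\pi ix}\begin{pmatrix}0&1\\ e^{-2\pi i(z+\tau)}&0\end{pmatrix}$. These are the stable bundles of rank $2$ and degree $1$. The presentation as a quotient gives trivializations of $\mathcal P^x$ over small open sets of $E_\tau$ (lifted to $\mathbb C$). Geometric $r$-matrix: let $\omega=dz$. For non-isomorphic $\mathcal P^{x_1},\mathcal P^{x_2}$ and distinct points $y_1,y_2\in E$, define $\mathrm{res}_{y_1}:\mathrm{Hom}_E(\mathcal P^{x_1},\mathcal P^{x_2}(y_1))\to\mathrm{Hom}_{\mathbb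 C}(\mathcal P^{x_1}|_{y_1},\mathcal P^{x_2}|_{y_1})$ by taking the residue at $y_1$ of $F\omega$, and $\mathrm{ev}_{y_2}:\mathrm{Hom}_E(\mathcal P^{x_1},\mathcal P^{x_2}(y_1))\to\mathrm{Hom}_{\mathbb C}(\mathcal P^{x_1}|_{y_2},\mathcal P^{x_2}|_{y_2})$ by evaluation at $y_2$. The map $\mathrm{res}_{y_1}$ is an isomorphism; the linear map $\tilde r=\mathrm{ev}_{y_2}\circ\mathrm{res}_{y_1}^{-1}$ becomes via the trivializations a linear map $\mathrm{Mat}_{2\times2}(\mathbb C)\to\mathrm{Mat}_{2\times2}(\mathbb C)$, and the corresponding tensor $r(x_1,x_2;y_1,y_2)=\sum_\nu a_\nu\otimes b_\nu$ is the one with $\tilde r(A)=\sum_\nu\mathrm{tr}(a_\nu A)b_\nu$. Gauge equivalence: $r\mapsto(\phi(x_1;y_1)\otimes\phi(x_2;y_2))\,r(x_1,x_2;y_1,y_2)\,(\phi(x_2;y_1)^{-1}\otimes\phi(x_1;y_2)^{-1})$ for a holomorphic $\mathrm{GL}_2(\mathbb C)$-valued germ $\phi$ (this amounts to a change of trivialization of the universal family). Associative Yang--Baxter equation for functions of differences: $r(u;x)^{12}r(u+v;y)^{23}=r(u+v;x+y)^{13}r(-v;x)^{12}+r(v;y)^{23}r(u;x+y)^{13}$, where upper indices indicate the tensor factors of $\mathrm{Mat}_{2\times 2}(\mathbb C)^{\otimes3}$. *)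

(* Defs.v *)
From HB Require Import structures.
From mathcomp Require Import all_boot all_order all_algebra.
From mathcomp Require Import complex mxtens.
From mathcomp Require Import all_classical all_reals all_analysis.

Set Implicit Arguments.
Unset Strict Implicit.
Unset Printing Implicit Defensive.

Import Order.TTheory GRing.Theory Num.Theory.
Import numFieldNormedType.Exports.

Local Open Scope classical_set_scope.
Local Open Scope ring_scope.
Local Open Scope complex_scope.

(* R[i] as a normed algebra over itself; the library only provides these
   structures on the regular module R[i]^o. *)
HB.instance Definition _ (R : realType) := GRing.ComAlgebra.copy R[i] R[i]^o.
HB.instance Definition _ (R : realType) := Vector.copy R[i] R[i]^o.
HB.instance Definition _ (R : realType) := NormedModule.copy R[i] R[i]^o.

Section Functions.
Variable R : realType.
Local Notation C := R[i].

Definition cpi : C := (pi : R)%:C.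

Definition cexp (z : C) : C :=
  (expR (complex.Re z))%:C * (cos (complex.Im z) +i* sin (complex.Im z)).

Definition csin (z : C) : C := (cexp ('i * z) - cexp (- ('i * z))) / (2 * 'i).
Definition ccos (z : C) : C := (cexp ('i * z) + cexp (- ('i * z))) / 2.

(* q ^ (1/4) is the branch exp (pi i tau / 4). *)
Definition nome (tau : C) : C := cexp (cpi * 'i * tau).
Definition nome4 (tau : C) : C := cexp (cpi * 'i * tau / 4).

Definition csum (u : nat -> C) : C := limn (series u).

Definition theta1 (tau z : C) : C :=
  2 * nome4 tau * csum (fun n =>
    (-1) ^+ n * nome tau ^+ (n * n.+1) * csin ((2 * n + 1)%:R * cpi * z)).

Definition theta2 (tau z : C) : C :=
  2 * nome4 tau * csum (fun n =>
    nome tau ^+ (n * n.+1) * ccos ((2 * n + 1)%:R * cpi * z)).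

Definition theta3 (tau z : C) : C :=
  1 + 2 * csum (fun k => let n := k.+1 in
    nome tau ^+ (n ^ 2) * ccos (2 * cpi * n%:R * z)).

Definition theta4 (tau z : C) : C :=
  1 + 2 * csum (fun k => let n := k.+1 in
    (-1) ^+ n * nome tau ^+ (n ^ 2) * ccos (2 * cpi * n%:R * z)).

Definition lattice (tau : C) : set C :=
  [set z | exists m n : int, z = m%:~R + n%:~R * tau].

Definition holomorphic_on (V W : normedModType C) (D : set V) (f : V -> W) :=
  forall z, D z -> differentiable f z.

End Functions.

Section Matrices.
Variable R : realType.
Local Notation C := R[i].
Local Notation M2 := 'M[C]_2.

Definition mx2 (a b c d : C) : M2 :=
  \matrix_(i < 2, j < 2)
    if i == 0 then (if j == 0 then a else b) else (if j == 0 then c else d).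

Definition mxh : M2 := mx2 1 0 0 (-1).
Definition mxsigma : M2 := mx2 0 (- 'i) 'i 0.
Definition mxgamma : M2 := mx2 0 1 1 0.

(* Mat_2 (x) Mat_2 is identified with Mat_4 by the Kronecker product *t. *)
Definition tensor2 := 'M[C]_(2 * 2).
Definition tensor3 := 'M[C]_(2 * 2 * 2).

(* Coefficient of r on delta_mx i j *t delta_mx k l. *)
Definition tcoef (r : tensor2) (i j k l : 'I_2) : C :=
  r (mxtens_index (i, k)) (mxtens_index (j, l)).

Definition leg12 (r : tensor2) : tensor3 :=
  \sum_(i < 2) \sum_(j < 2) \sum_(k < 2) \sum_(l < 2)
    tcoef r i j k l *: (delta_mx i j *t delta_mx k l *t (1%:M : M2)).
Definition leg13 (r : tensor2) : tensor3 :=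
  \sum_(i < 2) \sum_(j < 2) \sum_(k < 2) \sum_(l < 2)
    tcoef r i j k l *: (delta_mx i j *t (1%:M : M2) *t delta_mx k l).
Definition leg23 (r : tensor2) : tensor3 :=
  \sum_(i < 2) \sum_(j < 2) \sum_(k < 2) \sum_(l < 2)
    tcoef r i j k l *: ((1%:M : M2) *t delta_mx i j *t delta_mx k l).

(* The linear map A |-> sum_nu tr (a_nu A) b_nu of r = sum_nu a_nu (x) b_nu. *)
Definition tcontract (r : tensor2) (A : M2) : M2 :=
  \sum_(i < 2) \sum_(j < 2) \sum_(k < 2) \sum_(l < 2)
    (tcoef r i j k l * \tr ((delta_mx i j : M2) *m A)) *: delta_mx k l.

Definition tensor_of_map (f : M2 -> M2) : tensor2 :=
  get [set r | forall A, tcontract r A = f A].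

(* The associative Yang-Baxter equation for functions of differences with
   poles along D, at all arguments where its six terms are defined. *)
Definition AYBE (D : set C) (r : C -> C -> tensor2) : Prop :=
  forall u v x y : C,
    ~ D u -> ~ D v -> ~ D (u + v) -> ~ D x -> ~ D y -> ~ D (x + y) ->
    leg12 (r u x) *m leg23 (r (u + v) y) =
    leg13 (r (u + v) (x + y)) *m leg12 (r (- v) x) +
    leg23 (r v y) *m leg13 (r u (x + y)).

Definition r_ell (tau x y : C) : tensor2 :=
  (2^-1 * (derive1 (theta1 tau) 0 / theta1 tau y)) *:
    ((theta1 tau (y + x / 2) / theta1 tau (x / 2)) *: ((1%:M : M2) *t (1%:M : M2))
   + (theta2 tau (y + x / 2) / theta2 tau (x / 2)) *: (mxh *t mxh)
   + (theta3 tau (y + x / 2) / theta3 tau (x / 2)) *: (mxsigma *t mxsigma)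
   + (theta4 tau (y + x / 2) / theta4 tau (x / 2)) *: (mxgamma *t mxgamma)).

End Matrices.

Section Geometry.
Variables (R : realType) (tau : R[i]).
Local Notation C := R[i].
Local Notation M2 := 'M[C]_2.

(* P^x is the quotient of C x C^2 by (z, w) ~ (z + 1, w) ~ (z + tau, Phi x z w).
   Its local sections are the C^2-valued functions s with s (z + 1) = s z and
   s (z + tau) = Phi x z s z; identifying the fibre over the class of z with C^2
   by means of z : C is the trivialization coming from this presentation. *)
Definition Phi (x z : C) : M2 :=
  cexp (- (cpi R * 'i * x)) *:
    mx2 0 1 (cexp (- (2 * cpi R * 'i * (z + tau)))) 0.

(* F, pulled back to the universal cover, maps P^x1 to P^x2. *)
Definition intertwines (x1 x2 : C) (F : C -> M2) : Prop :=
  (forall z, F (z + 1) = F z) /\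
  (forall z, F (z + tau) *m Phi x1 z = Phi x2 z *m F z).

Definition bundle_iso (x1 x2 : C) : Prop :=
  exists F : C -> M2,
    [/\ holomorphic_on setT F, forall z, F z \in unitmx & intertwines x1 x2 F].

Definition same_point (y1 y2 : C) : Prop := lattice tau (y2 - y1).

Definition at_most_simple_pole (F : C -> M2) (p : C) : Prop :=
  exists G : C -> M2,
    (\forall z \near p, differentiable G z) /\
    (\forall z \near p^', F z = (z - p)^-1 *: G z).

(* Hom_E (P^x1, P^x2 (y1)).  F is a total function, so its values over y1, which
   carry no information, are set to 0. *)
Definition Hom_pole (x1 x2 y1 : C) : set (C -> M2) :=
  [set F | [/\ intertwines x1 x2 F,
               holomorphic_on [set z | ~ same_point y1 z] F &
               forall p, same_point y1 p -> F p = 0 /\ at_most_simple_pole F p]].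

(* Residue of F dz. *)
Definition residue (y : C) (F : C -> M2) : M2 :=
  lim ((fun z => (z - y) *: F z) @ y^').

Definition eval_at (y : C) (F : C -> M2) : M2 := F y.

Definition r_tilde (x1 x2 y1 y2 : C) (A : M2) : M2 :=
  eval_at y2 (pinv (Hom_pole x1 x2 y1) (residue y1) A).

Definition r_geom (x1 x2 y1 y2 : C) : tensor2 R :=
  tensor_of_map (r_tilde x1 x2 y1 y2).

Definition gauge_act (phi : C * C -> M2) (r : C -> C -> C -> C -> tensor2 R)
    (x1 x2 y1 y2 : C) : tensor2 R :=
  (phi (x1, y1) *t phi (x2, y2)) *m r x1 x2 y1 y2 *m
  (invmx (phi (x2, y1)) *t invmx (phi (x1, y2))).

(* r and r' are related by a change of trivialization phi over the bundle
   parameters in U and the points in V; germs at (x0, y0) are obtained for small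
   neighbourhoods U of x0 and V of y0. *)
Definition gauge_equivalent (U V : set C)
    (r r' : C -> C -> C -> C -> tensor2 R) : Prop :=
  exists phi : C * C -> M2,
    [/\ holomorphic_on (U `*` V) phi,
        forall p, (U `*` V) p -> phi p \in unitmx &
        forall x1 x2 y1 y2, U x1 -> U x2 -> V y1 -> V y2 ->
          ~ bundle_iso x1 x2 -> ~ same_point y1 y2 ->
          gauge_act phi r x1 x2 y1 y2 = r' x1 x2 y1 y2].

End Geometry.

(* Main.v *)
Require Import Defs.
From mathcomp Require Import all_boot all_order all_algebra complex mxtens.
From mathcomp Require Import all_classical all_reals all_analysis.
From mathcomp Require Import ring lra zify.
Set Implicit Arguments.
Unset Strict Implicit.
Unset Printing Implicit Defensive.
Import Order.TTheory GRing.Theory Num.Theory.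
Import numFieldNormedType.Exports.
Local Open Scope classical_set_scope.
Local Open Scope ring_scope.
Local Open Scope complex_scope.

(** Conjugation by the gauge diag(1, exp(pi i (z + tau/2))) turns a homomorphism
    F : P^x1 -> P^x2(y1) into a meromorphic matrix function with constant
    multipliers, F(z + 1) = h F(z) h and F(z + tau) = e^{-pi i x} gamma F(z) gamma
    for x = x2 - x1.  The matrices 1, h, sigma, gamma are the common eigenvectors
    of conjugation by h and by gamma, one for each pair of signs, so F decouples
    into four scalar functions with multipliers +-1 and +-e^{-pi i x} and simple
    poles on y1 + Lambda.  When x is not a period, each of these functions is a
    multiple of a Kronecker function
      theta1'(0) theta_c(y + x/2) / (theta1(y) theta_c(x/2)),
    where c is the theta characteristic of the sign pair; it has residue 1 at 0.
    Inverting the residue map and evaluating is thus diagonal in the basis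
    1, h, sigma, gamma, and the tensor of this diagonal map is r_ell
    (hom_pole, hom_residue, hom_pole_unique, r_geomE).  When x is a period,
    an exponential times one of the four matrices is an isomorphism
    P^x1 -> P^x2 (lattice_bundle_iso).

    The Yang-Baxter equation holds because products of the four matrices follow
    the group law of the characteristics.  Comparing coefficients leaves sixteen
    scalar identities between Kronecker functions (pauli_AYBE, fay): each says
    that a combination of products, viewed as a function of x, vanishes.  That
    combination has the multipliers of a single Kronecker function, and its
    poles cancel.

    Both halves rest on one uniqueness principle (liouville): a pole-free
    function g with multipliers +-1 and +-e^{-pi i u}, u not a period, is zero.
    Given w, an auxiliary theta quotient turns g into a function H without
    poles which has period 1 and increases by 2 pi i g(w) under tau.  Its
    integral around a period parallelogram is -2 pi i g(w) by the increments and
    0 by Cauchy's theorem for parallelograms (goursat), which is proved by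
    bisection and allows isolated points where only continuity is known.

    The quotients make sense because the theta functions vanish only at the
    expected half-periods and theta1 has simple zeros.  This comes from the
    finite Jacobi triple product: prod_{j < N} (1 + q^(2j+1) s)(1 + q^(2j+1)/s)
    is a Gauss binomial sum whose coefficients, suitably normalised, tend to
    q^(n^2).  So the theta series is bounded below, up to a constant, by a
    finite product whose zeros are visible (theta_lower). *)

(** * The modulus of a complex number and the exponential *)

Section ComplexBasics.
Variable R : realType.
Local Notation C := R[i].
Implicit Types z w : C.

(** The norm of C takes values in C itself; estimates are done with its real
    part. *)
Definition cabs (z : C) : R := complex.Re `|z|.

Lemma cabsE z : `|z| = (cabs z)%:C.
Proof. by rewrite /cabs RRe_real // ger0_real. Qed.

Lemma cabs_ge0 z : 0 <= cabs z.
Proof. by have := normr_ge0 z; rewrite cabsE ler0c. Qed.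

Lemma cabsM z w : cabs (z * w) = cabs z * cabs w.
Proof. by apply: complexI; rewrite rmorphM /= -!cabsE normrM. Qed.

Lemma cabsV z : cabs z^-1 = (cabs z)^-1.
Proof. by apply: complexI; rewrite fmorphV /= -!cabsE normfV. Qed.

Lemma cabsX z n : cabs (z ^+ n) = cabs z ^+ n.
Proof. by apply: complexI; rewrite rmorphXn /= -!cabsE normrX. Qed.

Lemma cabsN z : cabs (- z) = cabs z.
Proof. by apply: complexI; rewrite -!cabsE normrN. Qed.

Lemma cabsBC z w : cabs (z - w) = cabs (w - z).
Proof. by rewrite -cabsN opprB. Qed.

Lemma cabsD z w : cabs (z + w) <= cabs z + cabs w.
Proof. by rewrite -lecR rmorphD /= -!cabsE ler_normD. Qed.

Lemma cabsB z w : cabs z - cabs w <= cabs (z - w).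
Proof. by rewrite lerBlDr (le_trans _ (cabsD _ _)) // subrK. Qed.

Lemma cabs0 : cabs 0 = 0.
Proof. by apply: complexI; rewrite -cabsE normr0. Qed.

Lemma cabs1 : cabs 1 = 1.
Proof. by apply: complexI; rewrite -cabsE normr1. Qed.

Lemma cabs_eq0 z : (cabs z == 0) = (z == 0).
Proof. by rewrite -(inj_eq (@complexI R)) -cabsE normr_eq0. Qed.

Lemma cabs_gt0 z : (0 < cabs z) = (z != 0).
Proof. by rewrite lt_def cabs_eq0 cabs_ge0 andbT. Qed.

Lemma cabs_real (x : R) : cabs x%:C = `|x|.
Proof.
by apply: complexI; rewrite -cabsE normc_def /= expr0n /= addr0 sqrtr_sqr.
Qed.

Lemma cabs_nat n : cabs n%:R = n%:R.
Proof. by apply: complexI; rewrite -cabsE normr_nat rmorph_nat. Qed.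

Lemma cabs_Re z : `|complex.Re z| <= cabs z.
Proof. by rewrite -lecR -cabsE normc_ge_Re. Qed.

Lemma cabsi : cabs ('i : C) = 1.
Proof.
by apply: complexI; rewrite -cabsE normc_def /= expr0n expr1n add0r sqrtr1.
Qed.

Lemma cabs_Im z : `|complex.Im z| <= cabs z.
Proof.
have := cabs_Re (z * 'i%C); rewrite ReiNIm normrN cabsM.
by rewrite cabsi mulr1.
Qed.

Lemma cabs_le z : cabs z <= `|complex.Re z| + `|complex.Im z|.
Proof.
rewrite {1}(complexE z) (le_trans (cabsD _ _)) // cabsM cabsi mul1r.
by rewrite !cabs_real.
Qed.

Lemma cabs_sum (I : Type) (s : seq I) (P : pred I) (F : I -> C) :
  cabs (\sum_(i <- s | P i) F i) <= \sum_(i <- s | P i) cabs (F i).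
Proof.
elim/big_ind2: _ => [|x1 x2 y1 y2 h1 h2|//]; first by rewrite cabs0.
by rewrite (le_trans (cabsD _ _)) // lerD.
Qed.

Lemma cvgC {T : Type} (F : set_system T) {FF : Filter F} (f : T -> C) (l : C) :
  f @ F --> l <-> (forall e : R, 0 < e -> \forall x \near F, cabs (f x - l) < e).
Proof.
split.
  move=> /cvgrPdist_lt h e e0; have /h : 0 < e%:C by rewrite ltcR.
  by apply: filterS => x; rewrite cabsE ltcR cabsBC.
move=> h; apply/cvgrPdist_lt => e e0.
have eE : e = (complex.Re e)%:C by rewrite RRe_real // gtr0_real.
have /h : 0 < complex.Re e by rewrite -ltcR -eE.
by apply: filterS => x; rewrite eE cabsE ltcR cabsBC.
Qed.

Lemma nearC z (P : C -> Prop) :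
  (\forall w \near z, P w) <->
  (exists2 e : R, 0 < e & forall w, cabs (w - z) < e -> P w).
Proof.
split.
  move=> /nbhs_normP[/= e e0 h].
  have eE : e = (complex.Re e)%:C by rewrite RRe_real // gtr0_real.
  exists (complex.Re e); first by rewrite -ltcR -eE.
  by move=> w wz; apply: h; rewrite /= eE cabsE ltcR cabsBC.
move=> [e e0 h]; apply/nbhs_normP; exists e%:C; first by rewrite /= ltcR.
by move=> w /=; rewrite cabsE ltcR cabsBC; exact: h.
Qed.

Lemma dnearC z (P : C -> Prop) :
  (\forall w \near z^', P w) <->
  (exists2 e : R, 0 < e & forall w, w != z -> cabs (w - z) < e -> P w).
Proof.
split.
  by move=> /nearC[e e0 h]; exists e => // w wz /h; apply.
by move=> [e e0 h]; apply/nearC; exists e => // w wz /= wzE; apply: h.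
Qed.

Lemma scaleCE (a b : C) : a *: b = a * b. Proof. by []. Qed.

Lemma diffC_cvg (f : C -> C) z : differentiable f z ->
  exists d : C, (f w - f z) / (w - z) @[w --> z^'] --> d.
Proof.
move=> /derivable1_diffP /cvg_ex [d hd]; exists d.
move/cvgC : hd => hd; apply/cvgC => e /hd /dnearC [r r0 h].
apply/dnearC; exists r => // w wz wzr; have := h (w - z).
rewrite subr_eq0 wz subr0 wzr => /(_ isT isT).
by rewrite /= !scaleCE mulr1 subrK mulrC.
Qed.

Lemma cvg_diffC (f : C -> C) z (d : C) :
  (f w - f z) / (w - z) @[w --> z^'] --> d ->
  differentiable f z /\ derive1 f z = d.
Proof.
move=> /cvgC hd.
have h : h^-1 *: ((f \o shift z) (h *: 1) - f z) @[h --> 0^'] --> (d : C).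
  apply/cvgC => e /hd /dnearC [r r0 h].
  apply/dnearC; exists r => // w w0 wr; have := h (w + z).
  rewrite addrK -subr_eq0 addrK w0 -[w]subr0 wr subr0 => /(_ isT isT).
  by rewrite /= !scaleCE mulr1 mulrC.
split; first by apply/derivable1_diffP; apply/cvg_ex; exists d.
by rewrite derive1E; apply: cvg_lim.
Qed.


Lemma cexpE (x y : R) : cexp (x +i* y) = (expR x * cos y) +i* (expR x * sin y).
Proof. by rewrite /cexp /=; apply/eqP; rewrite eq_complex /= !mul0r subr0 addr0 !eqxx. Qed.

Lemma cexpD z w : cexp (z + w) = cexp z * cexp w.
Proof.
case: z w => [a b] [c d]; rewrite [LHS]cexpE !cexpE expRD cosD sinD.
by apply/eqP; rewrite eq_complex /=; apply/andP; split; apply/eqP; ring.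
Qed.

Lemma cexp0 : cexp (0 : C) = 1.
Proof. by rewrite cexpE expR0 cos0 sin0 mulr0 mulr1. Qed.

Lemma cexpNM z : cexp (- z) * cexp z = 1.
Proof. by rewrite -cexpD addNr cexp0. Qed.

Lemma cexp_neq0 z : cexp z != 0.
Proof.
by apply/eqP => h; have /eqP := cexpNM z; rewrite h mulr0 eq_sym oner_eq0.
Qed.

Lemma cexpN z : cexp (- z) = (cexp z)^-1.
Proof. by apply: (mulIf (cexp_neq0 z)); rewrite cexpNM mulVf ?cexp_neq0. Qed.

Lemma cexp_natl n z : cexp (n%:R * z) = cexp z ^+ n.
Proof.
elim: n => [|n ih]; first by rewrite mul0r cexp0.
by rewrite -natr1 mulrDl mul1r cexpD ih exprSr.
Qed.

Lemma cexp_intl (n : int) z : cexp (n%:~R * z) = cexp z ^ n.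
Proof.
case: n => n; first by rewrite -pmulrn cexp_natl.
by rewrite NegzE mulrNz mulNr cexpN -pmulrn cexp_natl exprnN.
Qed.

Lemma cabs_cexp z : cabs (cexp z) = expR (complex.Re z).
Proof.
rewrite /cexp cabsM cabs_real ger0_norm ?expR_ge0 // -[RHS]mulr1; congr (_ * _).
by apply: complexI; rewrite -cabsE normc_def /= cos2Dsin2 sqrtr1.
Qed.

Lemma cexp_2pii : cexp (2 * cpi R * 'i) = 1.
Proof.
have -> : 2 * cpi R * 'i = 0 +i* (pi *+ 2) :> C.
  by apply/eqP; rewrite eq_complex /=; apply/andP; split; apply/eqP; ring.
by rewrite cexpE expR0 cos2pi sin2pi !mulr1 mulr0.
Qed.

Lemma cexp_pii : cexp (cpi R * 'i) = -1.
Proof.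
have -> : cpi R * 'i = 0 +i* pi :> C.
  by apply/eqP; rewrite eq_complex /=; apply/andP; split; apply/eqP; ring.
rewrite cexpE expR0 cospi sinpi mulr0 mul1r.
by apply/eqP; rewrite eq_complex /= !oppr0 !eqxx.
Qed.

Lemma cpi_neq0 : cpi R != 0.
Proof. by rewrite -cabs_gt0 cabs_real normr_gt0 gt_eqF ?pi_gt0. Qed.

Lemma i_neq0 : ('i : C) != 0.
Proof. by rewrite -cabs_gt0 cabsi. Qed.

(** The modulus forces Re z = 0; what is left of Im z after removing a
    multiple of 2 pi lies in [0, 2 pi[ and has cosine 1, hence is 0 because
    cos is injective on [0, pi]. *)
Lemma cexp_eq1 z : cexp z = 1 -> exists n : int, z = n%:~R * (2 * cpi R * 'i).
Proof.
move=> hz.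
have re0 : complex.Re z = 0.
  by apply: expR_inj; rewrite expR0 -cabs_cexp hz cabs1.
have p2 : 0 < (pi *+ 2 : R) by rewrite mulrn_wgt0 // pi_gt0.
set n := Num.floor (complex.Im z / (pi *+ 2)); exists n.
have nE : n%:~R = (n%:~R : R)%:C :> C by rewrite rmorph_int.
set y := complex.Im z - n%:~R * (pi *+ 2).
have h : cexp (0 +i* y) = 1.
  suff -> : 0 +i* y = z - n%:~R * (2 * cpi R * 'i).
    by rewrite cexpD cexpN hz cexp_intl cexp_2pii exp1rz invr1 mulr1.
  rewrite [z in RHS]complexE re0 nE /y; apply/eqP; rewrite eq_complex /=.
  by apply/andP; split; apply/eqP; ring.
suff y0 : y = 0.
  rewrite [LHS]complexE re0 nE.
  rewrite (_ : complex.Im z = n%:~R * (pi *+ 2)); last first.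
    by apply/eqP; rewrite -subr_eq0 -/y y0.
  by apply/eqP; rewrite eq_complex /=; apply/andP; split; apply/eqP; ring.
have cy : cos y = 1.
  by move: h; rewrite cexpE expR0 mul1r => -[].
have y_ge0 : 0 <= y.
  by rewrite subr_ge0 -ler_pdivlMr // floor_le.
have y_lt : y < pi *+ 2.
  by rewrite ltrBlDr -[X in X + _]mul1r -mulrDl addrC -intrD1 -ltr_pdivrMr // floorD1_gt.
have pi0 := pi_ge0 R.
have [ypi|ypi] := leP y pi.
  by apply: cos_inj; rewrite ?in_itv /= ?y_ge0 ?lexx ?pi0 ?ypi // cos0.
have : pi *+ 2 - y = 0.
  apply: cos_inj; rewrite ?in_itv /= ?lexx ?pi0 //; last first.
    by rewrite cos0 -cosN opprB -cy -(cosD2pi (y - _)) subrK.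
  by rewrite subr_ge0 (ltW y_lt) lerBlDr mulr2n lerD2l ltW.
by move/eqP; rewrite subr_eq0 gt_eqF.
Qed.

Lemma real_derive_bound (f : R -> R) (x d : R) : is_derive x 1 f d ->
  forall e : R, 0 < e -> exists2 r : R, 0 < r &
    forall y, `|y - x| < r -> `|f y - f x - d * (y - x)| <= e * `|y - x|.
Proof.
move=> [fd fdE] e e0; move: fd; rewrite /derivable => /cvg_ex[l hl].
have lE : l = d.
  by rewrite -fdE; apply/esym; apply: cvg_lim.
rewrite {}lE in hl; move/cvgrPdist_lt : hl => /(_ _ e0).
move=> /nbhs_normP[r /= r0 h]; exists r => // y yr.
have [->|yx] := eqVneq y x; first by rewrite !subrr !(mulr0,normr0,subrr).
have := h (y - x); rewrite /= sub0r normrN => /(_ yr); rewrite subr_eq0 => /(_ yx).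
rewrite [(y - x) *: 1]/GRing.scale /= mulr1 subrK distrC => /ltW h1.
have yx' : y - x != 0 by rewrite subr_eq0.
have -> : f y - f x - d * (y - x) = ((y - x)^-1 *: (f y - f x) - d) * (y - x).
  by rewrite mulrBl /GRing.scale /= mulrAC mulVf // mul1r.
by rewrite normrM ler_wpM2r.
Qed.

(** Splitting cexp into expR, cos and sin reduces the first-order expansion at
    0 to the derivatives of these three real functions at 0; the addition
    theorem then gives the derivative everywhere. *)
Lemma cexp_bound0 (e : R) : 0 < e -> exists2 r : R, 0 < r &
  forall w : C, cabs w < r -> cabs (cexp w - 1 - w) <= e * cabs w.
Proof.
move=> e0; pose k := Num.min (e / 8) 1.
have k0 : 0 < k by rewrite lt_min ltr01 divr_gt0.
have k1 : k <= 1 by rewrite /k ge_min lexx orbT.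
have ke : k <= e / 8 by rewrite /k ge_min lexx.
have [r1 r10 h1] := real_derive_bound (is_derive_expR 0) k0.
have [r2 r20 h2] := real_derive_bound (is_derive_cos 0) k0.
have [r3 r30 h3] := real_derive_bound (is_derive_sin 0) k0.
exists (Num.min (Num.min r1 r2) (Num.min r3 (k / 2))).
  by rewrite !lt_min r10 r20 r30 divr_gt0.
case=> x y; set w := x +i* y; rewrite !lt_min => /andP[/andP[w1 w2] /andP[w3 w4]].
have xw : `|x| <= cabs w by exact: (cabs_Re w).
have yw : `|y| <= cabs w by exact: (cabs_Im w).
have := h1 x; rewrite subr0 expR0 mul1r => /(_ (le_lt_trans xw w1)) {h1}.
have := h2 y; rewrite !subr0 cos0 sin0 oppr0 mul0r subr0 => /(_ (le_lt_trans yw w2)) {h2}.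
have := h3 y; rewrite !subr0 cos0 sin0 mul1r subr0 => /(_ (le_lt_trans yw w3)) {h3}.
move=> hs hc he.
(* the error terms add up to at most 6 k cabs w, and k <= e / 8 *)
have w0 := cabs_ge0 w.
have kw : k * cabs w <= e / 8 * cabs w by rewrite ler_wpM2r.
have hx : k * `|x| <= k * cabs w by rewrite ler_wpM2l // ltW.
have hy : k * `|y| <= k * cabs w by rewrite ler_wpM2l // ltW.
have kwk : k * cabs w <= cabs w by rewrite ler_piMl.
have ex1 : `|expR x - 1| <= k.
  have -> : expR x - 1 = (expR x - 1 - x) + x by ring.
  by rewrite (le_trans (ler_normD _ _)) //; lra.
have ex2 : `|expR x| <= 2.
  have -> : expR x = (expR x - 1) + 1 by ring.
  rewrite (le_trans (ler_normD _ _)) // normr1; lra.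
have m1 : `|expR x * (cos y - 1)| <= 2 * (k * cabs w).
  by rewrite normrM ler_pM // (le_trans hc).
have m2 : `|expR x * (sin y - y)| <= 2 * (k * cabs w).
  by rewrite normrM ler_pM // (le_trans hs).
have m3 : `|(expR x - 1) * y| <= k * cabs w.
  by rewrite normrM ler_pM.
rewrite cexpE; apply: (le_trans (cabs_le _)) => /=.
have -> : expR x * cos y - 1 - x = (expR x - 1 - x) + expR x * (cos y - 1) by ring.
have -> : expR x * sin y - 0 - y = expR x * (sin y - y) + (expR x - 1) * y by ring.
have a1 := ler_normD (expR x - 1 - x) (expR x * (cos y - 1)).
have a2 := ler_normD (expR x * (sin y - y)) ((expR x - 1) * y).
have a3 := mulr_ge0 (ltW e0) w0.
lra.
Qed.

Lemma cexp_deriv z : differentiable (@cexp R) z /\ derive1 (@cexp R) z = cexp z.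
Proof.
apply: cvg_diffC; apply/cvgC => e e0.
have c0 : 0 < cabs (cexp z) by rewrite cabs_gt0 cexp_neq0.
have e1 : 0 < e / 2 / cabs (cexp z) by rewrite !divr_gt0.
have [r r0 h] := cexp_bound0 e1; apply/dnearC; exists r => // w wz wr.
have wz0 : w - z != 0 by rewrite subr_eq0.
have -> : (cexp w - cexp z) / (w - z) - cexp z =
          cexp z * (cexp (w - z) - 1 - (w - z)) / (w - z).
  have -> : cexp w = cexp z * cexp (w - z) by rewrite -cexpD addrC subrK.
  by field.
rewrite cabsM (cabsM (cexp z)) cabsV ltr_pdivrMr ?cabs_gt0 //.
have := ler_wpM2l (ltW c0) (h _ wr).
rewrite [X in _ <= X]mulrA [cabs (cexp z) * (_ / _)]mulrCA mulfV ?gt_eqF // mulr1.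
have : 0 < e * cabs (w - z) by rewrite mulr_gt0 // cabs_gt0.
lra.
Qed.

End ComplexBasics.

(** * Entire power series *)

Section PowerSeries.
Variable R : realType.
Local Notation C := R[i].
Implicit Types (u v : nat -> C) (z w : C).

Definition abs_bounded u (M : R) := forall N, \sum_(k < N) cabs (u k) <= M.

Lemma cvg_complex {T : Type} (F : set_system T) {FF : Filter F} (f g : T -> R) (a b : R) :
  f @ F --> a -> g @ F --> b -> ((fun t => f t +i* g t) @ F --> (a +i* b : C)).
Proof.
move=> /cvgrPdist_lt hf /cvgrPdist_lt hg; apply/cvgC => e e0.
have e2 : 0 < e / 2 by rewrite divr_gt0.
have := hf _ e2; have := hg _ e2; apply: filterS2 => t h1 h2.
apply: (le_lt_trans (cabs_le _)) => /=; rewrite -/(_ - _) -(distrC a) -(distrC b).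
lra.
Qed.

Lemma seriesE u N : series u N = \sum_(k < N) u k.
Proof. by rewrite /series /= big_mkord. Qed.

Lemma csum_unique u (l : C) : series u @ \oo --> l -> csum u = l.
Proof. by move=> h; apply: cvg_lim. Qed.

Lemma csum_cvg u M : abs_bounded u M -> series u @ \oo --> csum u.
Proof.
move=> uM.
have key (p : C -> R) : (forall z, `|p z| <= cabs z) -> cvgn (series (p \o u)).
  move=> pz; apply: normed_cvg; apply: nondecreasing_is_cvgn.
    by apply: nondecreasing_series => n _ _; exact: normr_ge0.
  exists M => _ [N _ <-] /=; rewrite /series /= big_mkord.
  by apply: le_trans (uM N); apply: ler_sum => k _; exact: pz.
have h1 := key _ (@cabs_Re R); have h2 := key _ (@cabs_Im R).
have := @cvg_complex _ \oo _ _ _ _ _ h1 h2.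
set l := _ +i* _; rewrite (_ : (fun t => _) = series u) => [h|].
  by rewrite (csum_unique (h _)); exact: h.
apply/funext => N; rewrite /series /= !big_mkord.
elim: N => [|N ih]; first by rewrite !big_ord0.
by rewrite !big_ord_recr /= -ih; case: (u N).
Qed.

Lemma csum_bound u M : abs_bounded u M -> cabs (csum u) <= M.
Proof.
move=> uM; have h := csum_cvg uM; apply/ler_addgt0Pr => e e0.
move/cvgC : h => /(_ _ e0) [N _ /(_ N (leqnn N)) /= hN].
have -> : csum u = series u N - (series u N - csum u) by ring.
apply: (le_trans (cabsD _ _)); rewrite cabsN lerD ?(ltW hN) //.
rewrite seriesE; apply: le_trans (uM N); exact: cabs_sum.
Qed.

Lemma csumD u v M M' : abs_bounded u M -> abs_bounded v M' ->
  csum (fun n => u n + v n) = csum u + csum v.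
Proof.
move=> /csum_cvg hu /csum_cvg hv; apply: csum_unique.
have -> : series (fun n => u n + v n) = (fun N => series u N + series v N).
  by apply/funext => N; rewrite /series /= big_split.
exact: (cvgD hu hv).
Qed.

Lemma csumZ (c : C) u M : abs_bounded u M -> csum (fun n => c * u n) = c * csum u.
Proof.
move=> /csum_cvg hu; apply: csum_unique.
have -> : series (fun n => c * u n) = (fun N => c * series u N).
  by apply/funext => N; rewrite /series /= mulr_sumr.
exact: (cvgM (cvg_cst _) hu).
Qed.

Lemma abs_boundedZ (c : C) u M : abs_bounded u M ->
  abs_bounded (fun n => c * u n) (cabs c * M).
Proof.
move=> h N; under eq_bigr do rewrite cabsM.
by rewrite -mulr_sumr ler_wpM2l ?cabs_ge0.
Qed.

Lemma abs_boundedD u v M M' : abs_bounded u M -> abs_bounded v M' ->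
  abs_bounded (fun n => u n + v n) (M + M').
Proof.
move=> h h' N; apply: le_trans (lerD (h N) (h' N)).
by rewrite -big_split; apply: ler_sum => i _; exact: cabsD.
Qed.

Lemma abs_bounded_le u v M : (forall n, cabs (u n) <= cabs (v n)) ->
  abs_bounded v M -> abs_bounded u M.
Proof. by move=> h hv N; apply: le_trans (hv N); apply: ler_sum => i _. Qed.

Lemma abs_bounded_ge0 u M : abs_bounded u M -> 0 <= M.
Proof. by move=> /(_ 0%N); rewrite big_ord0. Qed.

Lemma abs_bounded_shift u M : abs_bounded u M -> abs_bounded (fun n => u n.+1) M.
Proof.
move=> h N; apply: le_trans (h N.+1); rewrite big_ord_recl lerDr; exact: cabs_ge0.
Qed.

Lemma csum_recl u M : abs_bounded u M -> csum u = u 0%N + csum (fun n => u n.+1).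
Proof.
move=> h; have h1 := csum_cvg (abs_bounded_shift h).
apply: csum_unique; rewrite -(cvg_shiftS (series u)).
rewrite (_ : (fun n => series u n.+1) = fun N => u 0%N + series (fun n => u n.+1) N).
  exact: (cvgD (cvg_cst _) h1).
by apply/funext => N; rewrite /series /= !big_mkord big_ord_recl.
Qed.

(** Absolute summability on every circle, which is what gives a power series
    convergent everywhere. *)
Definition entire_coef u :=
  forall r : R, 0 <= r -> exists M, abs_bounded (fun n => u n * r%:C ^+ n) M.

(** A bound on the terms at radius 2 (r + 1) makes the terms at radius r
    decrease geometrically. *)
Lemma entire_coefP u :
  (forall r : R, 1 <= r -> exists M, forall n, cabs (u n) * r ^+ n <= M) -> entire_coef u.
Proof.
move=> h r r0; have [|M hM] := h (2 * (r + 1)); first by lra.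
have M0 : 0 <= M by apply: le_trans (hM 0%N); rewrite mulr1 cabs_ge0.
exists (2 * M) => N.
have key : \sum_(k < N) (M * (2 ^- k)) <= 2 * M - M * 2 * 2 ^- N.
  elim: N => [|N ih]; first by rewrite big_ord0 expr0; lra.
  rewrite big_ord_recr /=; apply: le_trans (lerD ih (lexx _)) _.
  rewrite exprS invfM; lra.
apply: le_trans (le_trans key _); last first.
  have : 0 <= M * 2 * 2 ^- N by rewrite !mulr_ge0 // invr_ge0 exprn_ge0.
  lra.
apply: ler_sum => k _; rewrite cabsM cabsX cabs_real ger0_norm //.
rewrite -ler_pdivrMr ?invr_gt0 ?exprn_gt0 // invrK -mulrA -exprMn.
apply: le_trans (hM k); rewrite ler_wpM2l ?cabs_ge0 // lerXn2r ?nnegrE //; lra.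
Qed.

Definition psum u z : C := csum (fun n => u n * z ^+ n).

Lemma entire_abs u z : entire_coef u -> exists M, abs_bounded (fun n => u n * z ^+ n) M.
Proof.
move=> /(_ _ (cabs_ge0 z))[M hM]; exists M; apply: abs_bounded_le hM => n.
by rewrite !cabsM !cabsX cabs_real ger0_norm // cabs_ge0.
Qed.

Definition dcoef u : nat -> C := fun n => n.+1%:R * u n.+1.

Lemma dcoef_entire u : entire_coef u -> entire_coef (dcoef u).
Proof.
move=> h; apply: entire_coefP => r r1; have [|M hM] := h (2 * r); first by lra.
exists M => n; apply: le_trans (hM n.+2).
rewrite big_ord_recr /= -[leLHS]add0r lerD ?sumr_ge0 // => [i _|]; first exact: cabs_ge0.
rewrite /dcoef !cabsM cabs_nat cabsX cabs_real ger0_norm; last by lra.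
rewrite mulrAC mulrC ler_wpM2l ?cabs_ge0 // exprMn.
have n2 : (n.+1%:R : R) <= 2 ^+ n.+1 by rewrite -natrX ler_nat ltnW // ltn_expl.
rewrite ler_pM ?exprn_ge0 //; first by lra.
by rewrite exprS ler_peMl // exprn_ge0 //; lra.
Qed.

Lemma pow_bound1 z w n : cabs w <= 1 ->
  cabs ((z + w) ^+ n - z ^+ n) <= cabs w * ((cabs z + 1) ^+ n - cabs z ^+ n).
Proof.
move=> w1; elim: n => [|n ih]; first by rewrite !expr0 !subrr cabs0 mulr0.
have -> : (z + w) ^+ n.+1 - z ^+ n.+1 =
  (z + w) * ((z + w) ^+ n - z ^+ n) + w * z ^+ n by rewrite !exprS; ring.
apply: (le_trans (cabsD _ _)); rewrite !cabsM cabsX.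
have h : cabs (z + w) <= cabs z + 1 by apply: (le_trans (cabsD _ _)); rewrite lerD.
apply: (le_trans (lerD (ler_pM (cabs_ge0 _) (cabs_ge0 _) h ih) (lexx _))).
by rewrite le_eqVlt; apply/orP; left; apply/eqP; rewrite !exprS; ring.
Qed.

(** With 1 as the bound on the increment, the remainder is quadratic in the
    increment with a factor that is summable against the coefficients of an
    entire series; this is what allows termwise differentiation. *)
Lemma pow_bound2 z w n : cabs w <= 1 ->
  cabs ((z + w) ^+ n - z ^+ n - n%:R * z ^+ n.-1 * w) <= cabs w ^+ 2 * (cabs z + 1) ^+ n.
Proof.
move=> w1; elim: n => [|n ih].
  by rewrite mul0r mul0r !expr0 subrr subr0 cabs0 mulr1 exprn_ge0 ?cabs_ge0.
have -> : (z + w) ^+ n.+1 - z ^+ n.+1 - n.+1%:R * z ^+ n.+1.-1 * w =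
  z * ((z + w) ^+ n - z ^+ n - n%:R * z ^+ n.-1 * w) + w * ((z + w) ^+ n - z ^+ n).
  by case: n {ih} => [|n] /=; rewrite ?expr0 ?expr1 ?mul0r -?natr1 ?exprS; ring.
apply: (le_trans (cabsD _ _)); rewrite !cabsM.
have h1 := ler_wpM2l (cabs_ge0 z) ih.
have h2 := ler_wpM2l (cabs_ge0 w) (pow_bound1 z n w1).
apply: (le_trans (lerD h1 h2)).
have : 0 <= cabs w ^+ 2 * cabs z ^+ n by rewrite mulr_ge0 ?exprn_ge0 ?cabs_ge0.
move=> h3; rewrite -subr_ge0 (le_trans h3) // le_eqVlt; apply/orP; left; apply/eqP.
by rewrite [(cabs z + 1) ^+ n.+1]exprS; ring.
Qed.

Lemma psum_deriv u z : entire_coef u ->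
  differentiable (psum u) z /\ derive1 (psum u) z = psum (dcoef u) z.
Proof.
move=> uE; have [|M hM] := uE (cabs z + 1); first by rewrite addr_ge0 ?cabs_ge0.
have M0 := abs_bounded_ge0 hM.
have key w : cabs w <= 1 ->
    cabs (psum u (z + w) - psum u z - psum (dcoef u) z * w) <= cabs w ^+ 2 * M.
  move=> w1.
  have [M1 h1] := entire_abs (z + w) uE.
  have [M2 h2] := entire_abs z uE.
  have [M3 h3] := entire_abs z (dcoef_entire uE).
  have h4 : abs_bounded (fun n => u n * (n%:R * z ^+ n.-1)) M3.
    case=> [|N]; first by rewrite big_ord0 (abs_bounded_ge0 h3).
    rewrite big_ord_recl /= mul0r mulr0 cabs0 add0r; apply: le_trans (h3 N).
    by apply: ler_sum => i _; rewrite /dcoef !cabsM mulrCA mulrA.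
  have e4 : csum (fun n => u n * (n%:R * z ^+ n.-1)) = psum (dcoef u) z.
    rewrite (csum_recl h4) /= mul0r mulr0 add0r /psum; congr csum; apply/funext => n.
    by rewrite /dcoef mulrCA mulrA.
  have -> : psum u (z + w) - psum u z - psum (dcoef u) z * w =
    csum (fun n => u n * ((z + w) ^+ n - z ^+ n - n%:R * z ^+ n.-1 * w)).
    rewrite -e4 (_ : (fun n => u n * (_ - _)) = (fun n => (u n * (z + w) ^+ n +
      (-1) * (u n * z ^+ n)) + (- w) * (u n * (n%:R * z ^+ n.-1)))); last first.
      by apply/funext => n; ring.
    rewrite (csumD (abs_boundedD h1 (abs_boundedZ (-1) h2)) (abs_boundedZ (- w) h4)).
    rewrite (csumD h1 (abs_boundedZ (-1) h2)) (csumZ _ h2) (csumZ _ h4).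
    by rewrite mulN1r mulNr mulrC.
  apply: csum_bound => N.
  have := abs_boundedZ ((cabs w)%:C ^+ 2) hM N.
  rewrite cabsX cabs_real ger0_norm ?cabs_ge0 //; apply: le_trans.
  apply: ler_sum => n _; rewrite !cabsM !cabsX !cabs_real !ger0_norm ?addr_ge0 ?cabs_ge0 //.
  by rewrite mulrCA ler_wpM2l ?cabs_ge0 // pow_bound2.
apply: cvg_diffC; apply/cvgC => e e0; apply/dnearC.
exists (Num.min 1 (e / (M + 1))); first by rewrite lt_min ltr01 divr_gt0 //; lra.
move=> w wz; rewrite lt_min => /andP[w1 w2].
have wz0 : w - z != 0 by rewrite subr_eq0.
have cz0 : 0 < cabs (w - z) by rewrite cabs_gt0.
have := key (w - z) (ltW w1); rewrite (addrC z) subrK => h.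
have -> : (psum u w - psum u z) / (w - z) - psum (dcoef u) z =
  (psum u w - psum u z - psum (dcoef u) z * (w - z)) / (w - z).
  by rewrite [RHS]mulrBl mulfK.
rewrite cabsM cabsV ltr_pdivrMr //; apply: le_lt_trans h _.
rewrite expr2 mulrAC ltr_pM2r //.
move: w2; rewrite ltr_pdivlMr; nra.
Qed.

End PowerSeries.

(** * The theta series and the finite Jacobi triple product *)

Section Products.
Variable R : realType.
Local Notation C := R[i].

Lemma csum_fin (u : nat -> C) N : (forall n, (N <= n)%N -> u n = 0) ->
  csum u = \sum_(k < N) u k.
Proof.
move=> h; apply: csum_unique; apply/cvgC => e e0; exists N => // n /= Nn.
rewrite seriesE -(subnKC Nn) big_split_ord /= [X in _ + X - _]big1 ?addr0 ?subrr ?cabs0 //.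
by move=> i _; apply: h; rewrite leq_addr.
Qed.

Lemma geo_small (r K e : R) : 0 <= r < 1 -> 0 < e -> exists J, K * r ^+ J <= e.
Proof.
move=> /andP[r0 r1] e0.
have h : (fun n => K * r ^+ n) @ \oo --> (0 : R).
  by rewrite -[X in _ --> X](mulr0 K); apply: (cvgM (cvg_cst _)); apply: cvg_expr; rewrite ger0_norm.
move/cvgrPdist_le : h => /(_ _ e0)[J _ /(_ J (leqnn J))] /=.
by rewrite sub0r normrN => /(le_trans (ler_norm _)) h; exists J.
Qed.

Lemma geo_sum (r K : R) n m : 0 <= r < 1 -> 0 <= K ->
  \sum_(i < n) K * r ^+ (m + i) <= K * r ^+ m / (1 - r).
Proof.
move=> /andP[r0 r1] K0.
have r1' : 0 < 1 - r by rewrite subr_gt0.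
have -> : \sum_(i < n) K * r ^+ (m + i) = K * r ^+ m * (1 - r ^+ n) / (1 - r).
  elim: n => [|n ih]; first by rewrite big_ord0 expr0 subrr mulr0 mul0r.
  rewrite big_ord_recr /= ih exprS exprD; field; exact: lt0r_neq0.
rewrite ler_pM2r ?invr_gt0 // ler_piMr ?mulr_ge0 ?exprn_ge0 ?cabs_ge0 // gerBl exprn_ge0 //.
Qed.

Lemma prod_bounds n (a : 'I_n -> C) : \sum_(i < n) cabs (a i) <= 2^-1 ->
  1 - \sum_(i < n) cabs (a i) <= cabs (\prod_(i < n) (1 + a i)) <=
  1 + 2 * \sum_(i < n) cabs (a i).
Proof.
elim: n a => [|n ih] a; first by rewrite !big_ord0 mulr0 subr0 addr0 cabs1 lexx.
rewrite !big_ord_recr /= cabsM; set s := \sum_(i < n) _; set x := cabs (a _) => h.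
have s0 : 0 <= s by apply: sumr_ge0 => i _; exact: cabs_ge0.
have x0 : 0 <= x by exact: cabs_ge0.
have /andP[h1 h2] := ih (fun i => a (widen_ord (leqnSn n) i)) (le_trans (ler_wpDr x0 (lexx s)) h).
rewrite -/s in h1 h2; set P := cabs (\prod_(i < n) _) in h1 h2 *.
have h3 : 1 - x <= cabs (1 + a ord_max).
  by have := cabsB 1 (- a ord_max); rewrite opprK cabsN cabs1.
have h4 : cabs (1 + a ord_max) <= 1 + x.
  by apply: le_trans (cabsD _ _) _; rewrite cabs1.
apply/andP; split.
  apply: le_trans (ler_pM _ _ h1 h3); nra.
apply: le_trans (ler_pM (cabs_ge0 _) (cabs_ge0 _) h2 h4) _; nra.
Qed.

(** Tails of such products are uniformly bounded away from 0 and infinity, so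
    that only finitely many factors can make an infinite product vanish. *)
Lemma prod_tail (r K : R) : 0 <= r < 1 -> 0 <= K -> exists J, forall a : nat -> C,
  (forall j, cabs (a j) <= K * r ^+ j) ->
  forall N, 2^-1 <= cabs (\prod_(i < N) (1 + a (J + i)%N)) <= 2.
Proof.
move=> r01 K0; have /andP[r0 r1] := r01.
have [|J hJ] := @geo_small r (K / (1 - r)) 2^-1 r01; first by rewrite invr_gt0.
exists J => a ha N.
have h : \sum_(i < N) cabs (a (J + i)%N) <= 2^-1.
  apply: le_trans hJ; rewrite mulrAC; apply: le_trans (geo_sum N J r01 K0).
  by apply: ler_sum => i _; exact: ha.
by have /andP[h1 h2] := prod_bounds h; apply/andP; split; lra.
Qed.

End Products.

Section GaussBinomials.
Variables (F : fieldType) (p : F).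

(** Gauss binomial coefficients, by their Pascal rule. *)
Fixpoint gbin (M m : nat) : F :=
  match M, m with
  | _, 0 => 1
  | 0, _.+1 => 0
  | M'.+1, m'.+1 => gbin M' m'.+1 + p ^+ (M' - m') * gbin M' m'
  end.

(** The q-Pochhammer symbol (p; p)_n. *)
Definition qfac n : F := \prod_(j < n) (1 - p ^+ j.+1).

Lemma gbin0 M : gbin M 0 = 1. Proof. by case: M. Qed.

Lemma gbin_small M m : (M < m)%N -> gbin M m = 0.
Proof.
elim: M m => [|M ih] [|m] //= h; rewrite ih ?ih ?mulr0 ?addr0 //.
exact: ltnW.
Qed.

Lemma qfacS n : qfac n.+1 = qfac n * (1 - p ^+ n.+1).
Proof. by rewrite /qfac big_ord_recr. Qed.

Lemma gbin_qfac m k : gbin (m + k) m * (qfac m * qfac k) = qfac (m + k).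
Proof.
elim: m k => [|m ihm] k; first by rewrite gbin0 mul1r /qfac big_ord0 mul1r.
elim: k => [|k ihk].
  have -> : (m.+1 + 0 = m.+1)%N by rewrite addn0.
  have := ihm 0%N; rewrite !addn0 /= subnn expr0 mul1r (@gbin_small m m.+1) // add0r.
  by rewrite !qfacS => {2}<-; ring.
rewrite addSn /= (_ : m + k.+1 - m = k.+1)%N; last by rewrite addKn.
rewrite [in RHS]qfacS mulrDl.
have h1 : gbin (m + k.+1) m.+1 * (qfac m.+1 * qfac k.+1) = qfac (m + k.+1) * (1 - p ^+ k.+1).
  by rewrite (qfacS k) -addSnnS -ihk; ring.
have h2 : gbin (m + k.+1) m * (qfac m.+1 * qfac k.+1) = qfac (m + k.+1) * (1 - p ^+ m.+1).
  by rewrite (qfacS m) -ihm; ring.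
have -> : p ^+ (m + k.+1).+1 = p ^+ k.+1 * p ^+ m.+1.
  by rewrite -exprD; congr (_ ^+ _); lia.
by rewrite h1 -mulrA h2; ring.
Qed.

Lemma gauss_binomial (q x : F) M : p = q ^+ 2 ->
  \prod_(i < M) (1 + p ^+ i * x) =
  \sum_(m < M.+1) q ^+ (m * m.-1) * gbin M m * x ^+ m.
Proof.
move=> pq; elim: M => [|M ih]; first by rewrite big_ord0 big_ord_recl big_ord0 /= !mulr1 addr0.
rewrite big_ord_recr /= ih mulrDr mulr1 [X in X + _ = _]big_ord_recl /= gbin0 mul0n !expr0 !mulr1.
rewrite [RHS]big_ord_recl /= !mulr1.
rewrite -addrA; congr (_ + _).
under [RHS]eq_bigr => i _ do rewrite mulrDr mulrDl.
rewrite big_split /=; congr (_ + _).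
  by rewrite [RHS]big_ord_recr /= gbin_small // mulr0 mul0r addr0.
rewrite mulr_suml; apply: eq_bigr => i _; rewrite !add0n.
have -> : q ^+ (bump 0 i * i) * (p ^+ (M - i) * gbin M i) * x ^+ bump 0 i =
  q ^+ (bump 0 i * i) * p ^+ (M - i) * gbin M i * x ^+ bump 0 i by ring.
have -> : q ^+ (bump 0 i * i) * p ^+ (M - i) = q ^+ (i * i.-1) * p ^+ M.
  rewrite pq -!exprM -!exprD; congr (_ ^+ _); rewrite /bump /=.
  have := ltn_ord i; case: (nat_of_ord i) => [|k] /=; nia.
by rewrite /bump /= add1n exprS; ring.
Qed.

End GaussBinomials.

Section ThetaSeries.
Variables (R : realType) (q : R[i]).
Local Notation C := R[i].
Hypotheses (q1 : cabs q < 1) (q0 : q != 0).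
Definition rho := cabs q ^+ 2.

Lemma rho01 : 0 <= rho < 1.
Proof.
by rewrite /rho exprn_ge0 ?cabs_ge0 //= expr_lt1 ?cabs_ge0.
Qed.

Lemma rho_gt0 : 0 < rho.
Proof. by rewrite exprn_gt0 // cabs_gt0. Qed.

Lemma rho_pow m n : (m <= n)%N -> rho ^+ n <= rho ^+ m.
Proof. by move=> mn; have /andP[r0 r1] := rho01; rewrite ler_wiXn2l // ltW. Qed.

Definition gauss_coef n : C := q ^+ (n * n).

Lemma gauss_entire : entire_coef gauss_coef.
Proof.
apply: entire_coefP => r r1.
have [|m hm] := @geo_small R (cabs q) r 1 _ ltr01; first by rewrite cabs_ge0.
have r0 : 0 <= r by lra.
exists (r ^+ m) => n; rewrite /gauss_coef cabsX exprM -exprMn.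
have [nm|mn] := ltnP n m.
  apply: (@le_trans _ _ (r ^+ n)); last by rewrite ler_weXn2l // ltnW.
  rewrite lerXn2r ?nnegrE ?mulr_ge0 ?exprn_ge0 ?cabs_ge0 //.
  by rewrite ler_piMl // exprn_ile1 ?cabs_ge0 // ltW.
apply: (@le_trans _ _ 1); last by rewrite exprn_ege1.
rewrite exprn_ile1 ?mulr_ge0 ?exprn_ge0 ?cabs_ge0 //.
rewrite mulrC; apply: le_trans hm; rewrite ler_wpM2l //.
by rewrite ler_wiXn2l ?cabs_ge0 // ltW.
Qed.

Definition thA (s : C) : C := psum gauss_coef s.
(** The bilateral series sum_n q^(n^2) s^n over all integers n; the term n = 0
    occurs in both halves. *)
Definition Thb (s : C) : C := thA s + thA s^-1 - 1.

Lemma thA_rec (s : C) : thA s = 1 + q * s * thA (q ^+ 2 * s).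
Proof.
have [M hM] := entire_abs s gauss_entire.
have [M' hM'] := entire_abs (q ^+ 2 * s) gauss_entire.
rewrite /thA /psum (csum_recl hM) /gauss_coef mul0n !expr0 mulr1; congr (1 + _).
rewrite -(csumZ _ hM'); congr csum; apply/funext => n.
rewrite /gauss_coef exprMn -exprM !mulrA.
have -> : (n.+1 * n.+1 = 1 + n * n + 2 * n)%N by lia.
by rewrite !exprD expr1 exprS; ring.
Qed.

Lemma ThbV (s : C) : Thb s^-1 = Thb s.
Proof. by rewrite /Thb invrK; move: (thA s) (thA s^-1) => a b; rewrite (addrC b). Qed.

(** Shifting the summation index: (n + 1)^2 = n^2 + 2 n + 1. *)
Lemma Thb_q2 (s : C) : s != 0 -> Thb (q ^+ 2 * s) = Thb s / (q * s).
Proof.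
move=> s0; have qs0 : q * s != 0 by rewrite mulf_neq0.
have h1 : thA (q ^+ 2 * s) = (thA s - 1) / (q * s).
  by rewrite [thA s]thA_rec [1 + _]addrC addrK [RHS]mulrC mulKf.
have h2 : thA (q ^+ 2 * s)^-1 = 1 + thA s^-1 / (q * s).
  rewrite thA_rec; congr (1 + _).
  rewrite (_ : q ^+ 2 * (q ^+ 2 * s)^-1 = s^-1); last by field; rewrite q0 s0.
  by rewrite mulrC; congr (_ * _); field; rewrite q0 s0.
by rewrite /Thb h1 h2; move: (thA s) (thA s^-1) => a b; field; rewrite q0 s0.
Qed.

Definition jprod N (s : C) : C :=
  \prod_(j < N) ((1 + q ^+ (2 * j + 1) * s) * (1 + q ^+ (2 * j + 1) * s^-1)).

(** The q-binomial theorem for 2N factors, with the variable shifted so that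
    the product becomes symmetric under s <-> 1/s, and the summation index
    recentred at N. *)
Lemma jacobi_finite N (s : C) : s != 0 ->
  jprod N s = \sum_(n < N.+1) q ^+ (n * n) * gbin (q ^+ 2) (N + N) (N + n) * s ^+ n +
    \sum_(j < N) q ^+ (j.+1 * j.+1) * gbin (q ^+ 2) (N + N) (N - j.+1) * s^-1 ^+ j.+1.
Proof.
move=> s0.
(* in the q-binomial theorem for 2N factors, the factor of index N + j
   becomes 1 + q ^+ (2j + 1) s *)
set Q := q ^+ (N + N); pose x := q * s / Q.
have Q0 : Q != 0 by rewrite expf_neq0.
have sN0 : s ^+ N != 0 by rewrite expf_neq0.
have qN0 : q ^+ (N * N) != 0 by rewrite expf_neq0.
have := @gauss_binomial _ (q ^+ 2) q x (N + N) erefl.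
rewrite big_split_ord /= -addnS [RHS]big_split_ord /=.
have -> : \prod_(i < N) (1 + (q ^+ 2) ^+ (N + i) * x) =
          \prod_(j < N) (1 + q ^+ (2 * j + 1) * s).
  apply: eq_bigr => j _; congr (1 + _); rewrite /x /Q -exprM mulnDr mul2n -addnn.
  rewrite [q ^+ (N + N + _)]exprD [q ^+ (2 * j + 1)]exprD expr1 -/Q.
  by field.
have -> : \prod_(i < N) (1 + (q ^+ 2) ^+ i * x) =
     s ^+ N / q ^+ (N * N) * \prod_(j < N) (1 + q ^+ (2 * j + 1) * s^-1).
  rewrite (reindex_inj rev_ord_inj) /=.
  have -> : s ^+ N / q ^+ (N * N) = \prod_(j < N) (s / q ^+ (2 * j + 1)).
    elim: (N) => [|n ih]; first by rewrite big_ord0 divr1.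
    rewrite big_ord_recr /= -ih (_ : n.+1 * n.+1 = n * n + (2 * n + 1))%N; last by lia.
    by rewrite exprSr exprD invfM; ring.
  rewrite -big_split /=; apply: eq_bigr => j _; rewrite mulrDr mulr1 addrC.
  have qj0 : q ^+ (2 * j + 1) != 0 by rewrite expf_neq0.
  congr (_ + _); last by field; rewrite s0.
  rewrite /x /Q (_ : N + N = 2 * (N - j.+1) + 1 + (2 * j + 1))%N; last first.
    by have := ltn_ord j; lia.
  rewrite -exprM (exprD _ (_ + 1)) [q ^+ (2 * (N - j.+1) + 1)]exprD expr1.
  have : q ^+ (2 * (N - j.+1)) != 0 by rewrite expf_neq0.
  move: qj0; move: (q ^+ (2 * (N - j.+1))) (q ^+ (2 * j + 1)) => a b b0 a0.
  by field; rewrite q0 a0 b0.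
move=> h; have -> : jprod N s = q ^+ (N * N) / s ^+ N *
   (s ^+ N / q ^+ (N * N) * \prod_(j < N) (1 + q ^+ (2 * j + 1) / s) *
    \prod_(j < N) (1 + q ^+ (2 * j + 1) * s)).
  by rewrite /jprod big_split /=; field; rewrite qN0 sN0.
have mm m : (m * m.-1 + m = m * m)%N by case: m => [|k] /=; lia.
rewrite h mulrDr addrC; congr (_ + _).
  rewrite mulr_sumr; apply: eq_bigr => n _; set g := gbin _ _ _.
  rewrite /x expr_div_n exprMn (exprD s) -exprM.
  have Qm0 : q ^+ ((N + N) * (N + n)) != 0 by rewrite expf_neq0.
  have -> : q ^+ ((N + n) * (N + n).-1) = q ^+ (n * n) * q ^+ ((N + N) * (N + n)) /
    (q ^+ (N * N) * q ^+ (N + n)).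
    apply: (mulIf (_ : q ^+ (N * N) * q ^+ (N + n) != 0)); first by rewrite mulf_neq0 // expf_neq0.
    rewrite mulfVK ?mulf_neq0 ?expf_neq0 // -!exprD; congr (_ ^+ _).
    by have := mm (N + n)%N; lia.
  have qNn : q ^+ (N + n) != 0 by rewrite expf_neq0.
  by field; rewrite Qm0 sN0 qN0 qNn.
rewrite (reindex_inj rev_ord_inj) /= mulr_sumr; apply: eq_bigr => j _; set g := gbin _ _ _.
have jN := ltn_ord j; set m := (N - j.+1)%N.
have Nm : N = (m + j.+1)%N by rewrite /m; lia.
rewrite /x expr_div_n exprMn -exprM.
have Qm0 : q ^+ ((N + N) * m) != 0 by rewrite expf_neq0.
have qm0 : q ^+ m != 0 by rewrite expf_neq0.
have -> : q ^+ (m * m.-1) = q ^+ (j.+1 * j.+1) * q ^+ ((N + N) * m) / (q ^+ (N * N) * q ^+ m).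
  apply: (mulIf (_ : q ^+ (N * N) * q ^+ m != 0)); first by rewrite mulf_neq0.
  rewrite mulfVK ?mulf_neq0 // -!exprD; congr (_ ^+ _).
  have := mm m.
  have -> : (N * N = (m + j.+1) * (m + j.+1))%N by rewrite -Nm.
  by have -> : (N + N = (m + j.+1) + (m + j.+1))%N; [rewrite -Nm | lia].
have -> : s ^+ N = s ^+ m * s ^+ j.+1 by rewrite -exprD -Nm.
have sm0 : s ^+ m != 0 by rewrite expf_neq0.
have sj0 : s ^+ j.+1 != 0 by rewrite expf_neq0.
rewrite exprVn; move: (q ^+ (j.+1 * j.+1)) (s ^+ j.+1) sj0 => qq sj sj0.
by field; rewrite Qm0 sm0 qN0 qm0 sj0.
Qed.

Definition q2 : C := q ^+ 2.

Lemma cabs_q2 : cabs q2 = rho. Proof. exact: cabsX. Qed.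

(** The first J factors are bounded one by one, the remaining ones by
    prod_tail. *)
Lemma qfac_bounds : exists d K : R, [/\ 0 < d, 0 < K &
  forall n, d <= cabs (qfac q2 n) <= K].
Proof.
have r01 := rho01; have /andP[r0 r1] := r01.
have [J hJ] := @prod_tail R rho 1 r01 ler01.
have tailb n : 2^-1 <= cabs (\prod_(i < n) (1 + - q2 ^+ (J + i).+1)) <= 2.
  apply: (hJ (fun j => - q2 ^+ j.+1)) => j; rewrite cabsN cabsX cabs_q2 mul1r.
  by rewrite exprS ler_piMl ?exprn_ge0 ?cabs_ge0 // ?ltW.
have fb j : 1 - rho <= cabs (1 - q2 ^+ j.+1) <= 2.
  have h : cabs (q2 ^+ j.+1) <= rho.
    by rewrite cabsX cabs_q2 exprS ler_piMr // exprn_ile1 // ?ltW.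
  apply/andP; split; first by have := cabsB 1 (q2 ^+ j.+1); rewrite cabs1; lra.
  apply: le_trans (cabsD _ _) _; rewrite cabs1 cabsN; lra.
have d0 : 0 < 1 - rho by lra.
have sm n : (1 - rho) ^+ n <= cabs (qfac q2 n) <= 2 ^+ n.
  elim: n => [|n /andP[ih1 ih2]]; first by rewrite /qfac big_ord0 cabs1 !expr0 lexx.
  have /andP[f1 f2] := fb n; rewrite qfacS cabsM (exprSr (1 - rho)) (exprSr 2).
  by rewrite !ler_pM ?exprn_ge0 ?cabs_ge0 ?(ltW d0).
exists ((1 - rho) ^+ J / 2), (2 ^+ J * 2); split => [||n].
- by rewrite divr_gt0 // exprn_gt0.
- by rewrite mulr_gt0 // exprn_gt0.
have dJ : 0 < (1 - rho) ^+ J by rewrite exprn_gt0.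
have kJ : 0 < (2 ^+ J : R) by rewrite exprn_gt0.
have [nJ|Jn] := leqP n J.
  have /andP[h1 h2] := sm n.
  have h3 : (1 - rho) ^+ J <= (1 - rho) ^+ n by rewrite ler_wiXn2l //; lra.
  have h4 : 2 ^+ n <= (2 ^+ J : R) by rewrite ler_weXn2l // ler1n.
  by apply/andP; split; lra.
have -> : qfac q2 n = qfac q2 J * \prod_(i < n - J) (1 + - q2 ^+ (J + i).+1).
  by rewrite -{1}(subnKC (ltnW Jn)) /qfac big_split_ord.
have /andP[h1 h2] := sm J; have /andP[h3 h4] := tailb (n - J)%N.
rewrite cabsM; apply/andP; split; first by rewrite ler_pM // ?invr_ge0 // ?ltW.
by rewrite ler_pM // cabs_ge0.
Qed.

Lemma qfac_neq0 n : qfac q2 n != 0.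
Proof.
have [d [K [d0 _ h]]] := qfac_bounds; have /andP[h1 _] := h n.
by rewrite -cabs_gt0 (lt_le_trans d0).
Qed.

Lemma qfac_cauchy : exists2 K : R, 0 < K &
  forall m k, cabs (qfac q2 (m + k) - qfac q2 m) <= K * rho ^+ m.
Proof.
have r01 := rho01; have /andP[r0 r1] := r01.
have [d [K [d0 K0 h]]] := qfac_bounds.
have r1' : 0 < 1 - rho by lra.
exists (K / (1 - rho)); first by rewrite divr_gt0.
move=> m k; rewrite mulrAC; apply: le_trans (geo_sum k m r01 (ltW K0)).
elim: k => [|k ih]; first by rewrite addn0 subrr cabs0 big_ord0.
have -> : qfac q2 (m + k.+1) - qfac q2 m =
    (qfac q2 (m + k) - qfac q2 m) + - (qfac q2 (m + k) * q2 ^+ (m + k).+1).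
  by rewrite addnS qfacS; ring.
apply: le_trans (cabsD _ _) _; rewrite big_ord_recr /= lerD //.
rewrite cabsN cabsM cabsX cabs_q2; have /andP[_ hK] := h (m + k)%N.
rewrite ler_pM ?exprn_ge0 ?cabs_ge0 //.
by rewrite exprS ler_piMl ?exprn_ge0 ?cabs_ge0 // ?ltW.
Qed.

(** Normalised coefficients of the finite triple product; for fixed n they
    tend to 1 as N grows. *)
Definition ecoef N n : C :=
  if (n <= N)%N then qfac q2 N ^+ 2 / (qfac q2 (N + n) * qfac q2 (N - n)) else 0.

Lemma kap_gbin N a b : (a + b = N + N)%N ->
  qfac q2 N ^+ 2 / qfac q2 (N + N) * gbin q2 (N + N) a =
  qfac q2 N ^+ 2 / (qfac q2 a * qfac q2 b).
Proof.
move=> <-; have := gbin_qfac q2 a b.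
move: (qfac_neq0 (a + b)) (qfac_neq0 a) (qfac_neq0 b).
move: (gbin _ _ _) (qfac q2 (a + b)) (qfac q2 a) (qfac q2 b) (qfac q2 N) => g D A B X D0 A0 B0 h.
move: D0; rewrite -h => D0; have g0 : g != 0 by apply: contraNneq D0 => ->; rewrite mul0r.
by field; rewrite A0 B0 g0.
Qed.

Lemma ecoef_gbinD N n : (n <= N)%N ->
  qfac q2 N ^+ 2 / qfac q2 (N + N) * gbin q2 (N + N) (N + n) = ecoef N n.
Proof.
move=> nN; rewrite /ecoef nN; apply: kap_gbin.
by rewrite -addnA subnKC.
Qed.

Lemma ecoef_gbinB N n : (n <= N)%N ->
  qfac q2 N ^+ 2 / qfac q2 (N + N) * gbin q2 (N + N) (N - n) = ecoef N n.
Proof.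
move=> nN; rewrite /ecoef nN (mulrC (qfac q2 (N + n))); apply: kap_gbin.
by rewrite addnCA subnK.
Qed.

Lemma ecoef0 N : ecoef N 0 = 1.
Proof. by rewrite /ecoef addn0 subn0 -expr2 divff // expf_neq0 // qfac_neq0. Qed.

(** The speed of convergence of ecoef N n to 1: the factor rho ^+ n
    compensates for the loss when n comes close to N, and is absorbed by
    taking the power series at a larger radius. *)
Lemma ecoef_bound : exists2 K : R, 0 <= K &
  forall N n, cabs (1 - ecoef N n) * rho ^+ n <= K * rho ^+ N.
Proof.
have r01 := rho01; have /andP[r0 r1] := r01.
have [d [K [d0 K0 h]]] := qfac_bounds.
have [L L0 hL] := qfac_cauchy.
have KL0 : 0 <= 2 * K * L / d ^+ 2 by rewrite !mulr_ge0 // ?invr_ge0 ?exprn_ge0 ?cabs_ge0 // ?ltW.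
exists (2 * K * L / d ^+ 2 + 1) => [|N n]; first by lra.
rewrite /ecoef; case: leqP => [nN|Nn]; last first.
  rewrite subr0 cabs1 mul1r mulrDl mul1r -[leLHS]add0r lerD //.
    by rewrite mulr_ge0 // exprn_ge0.
  by rewrite rho_pow // ltnW.
have a0 := qfac_neq0 (N + n); have b0 := qfac_neq0 (N - n).
have -> : 1 - qfac q2 N ^+ 2 / (qfac q2 (N + n) * qfac q2 (N - n)) =
  (qfac q2 N * (qfac q2 (N + n) - qfac q2 N) +
   qfac q2 (N + n) * - (qfac q2 (N - n + n) - qfac q2 (N - n))) /
  (qfac q2 (N + n) * qfac q2 (N - n)).
  rewrite subnK //; move: (qfac q2 N) (qfac q2 (N + n)) (qfac q2 (N - n)) a0 b0 => x y z y0 z0.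
  by field; rewrite y0 z0.
rewrite cabsM cabsV (cabsM (qfac q2 (N + n))).
have /andP[n1 n2] := h N; have /andP[m1 m2] := h (N + n)%N; have /andP[l1 l2] := h (N - n)%N.
have rN : 0 <= rho ^+ N by rewrite exprn_ge0.
have num : cabs (qfac q2 N * (qfac q2 (N + n) - qfac q2 N) +
   qfac q2 (N + n) * - (qfac q2 (N - n + n) - qfac q2 (N - n))) <= 2 * K * L * rho ^+ (N - n).
  apply: le_trans (cabsD _ _) _; rewrite !cabsM cabsN.
  have h1 := ler_pM (cabs_ge0 _) (cabs_ge0 _) n2 (hL N n).
  have h2 := ler_pM (cabs_ge0 _) (cabs_ge0 _) m2 (hL (N - n)%N n).
  have h3 : K * (L * rho ^+ N) <= K * (L * rho ^+ (N - n)).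
    by rewrite !ler_pM2l // rho_pow // leq_subr.
  lra.
have den : (cabs (qfac q2 (N + n)) * cabs (qfac q2 (N - n)))^-1 <= (d ^+ 2)^-1.
  rewrite lef_pV2 ?posrE ?exprn_gt0 ?mulr_gt0 ?(lt_le_trans d0) //.
  by rewrite expr2 ler_pM // ?ltW.
have := ler_pM (cabs_ge0 _) _ num den; rewrite invr_ge0 mulr_ge0 ?cabs_ge0 // => /(_ isT) hh.
have rn : 0 <= rho ^+ n by rewrite exprn_ge0.
apply: le_trans (ler_wpM2r rn hh) _.
have -> : 2 * K * L * rho ^+ (N - n) / d ^+ 2 * rho ^+ n = 2 * K * L / d ^+ 2 * rho ^+ N.
  rewrite -[in RHS](subnK nN) exprD; ring.
by rewrite [leRHS]mulrDl mul1r lerDl.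
Qed.

Definition thA_trunc N (s : C) : C := \sum_(n < N.+1) gauss_coef n * ecoef N n * s ^+ n.

Lemma thA_trunc_cvg (r : R) : 0 <= r -> exists2 K : R, 0 <= K &
  forall N s, cabs s <= r -> cabs (thA s - thA_trunc N s) <= K * rho ^+ N.
Proof.
move=> r0; have [K K0 hK] := ecoef_bound; have rh := rho_gt0.
have [|M hM] := gauss_entire (_ : 0 <= r / rho); first by rewrite divr_ge0 // ?ltW.
exists (K * M); first by rewrite mulr_ge0 // (abs_bounded_ge0 hM).
move=> N s sr.
have bd : abs_bounded (fun n => gauss_coef n * (1 - ecoef N n) * s ^+ n) (K * M * rho ^+ N).
  move=> n; have := abs_boundedZ ((K * rho ^+ N)%:C) hM n.
  have KN : 0 <= K * rho ^+ N by rewrite mulr_ge0 // exprn_ge0 // ?ltW.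
  rewrite cabs_real ger0_norm // [K * _ * M]mulrAC; apply: le_trans; apply: ler_sum => k _.
  set g := gauss_coef k.
  have -> : cabs ((K * rho ^+ N)%:C * (g * (r / rho)%:C ^+ k)) =
      cabs g * (K * rho ^+ N * (r / rho) ^+ k).
    rewrite cabsM cabs_real (ger0_norm KN) cabsM cabsX cabs_real ger0_norm ?divr_ge0 ?(ltW rh) //.
    by rewrite mulrCA.
  have -> : cabs (g * (1 - ecoef N k) * s ^+ k) = cabs g * (cabs (1 - ecoef N k) * cabs s ^+ k).
    by rewrite cabsM (cabsM g) (cabsX s) mulrA.
  rewrite ler_wpM2l ?cabs_ge0 //.
  have rk : 0 < rho ^+ k by exact: exprn_gt0.
  have := hK N k; rewrite -ler_pdivlMr // => h.
  rewrite expr_div_n [leRHS](_ : _ = (K * rho ^+ N / rho ^+ k) * r ^+ k); last by ring.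
  by apply: ler_pM => //; rewrite ?exprn_ge0 ?cabs_ge0 // lerXn2r ?nnegrE ?cabs_ge0.
have [M1 h1] := entire_abs s gauss_entire.
have -> : thA_trunc N s =
    csum (fun n => gauss_coef n * s ^+ n + (-1) * (gauss_coef n * (1 - ecoef N n) * s ^+ n)).
  rewrite (@csum_fin _ _ N.+1) => [|n Nn].
    by apply: eq_bigr => n _; ring.
  by rewrite /ecoef leqNgt Nn /=; ring.
rewrite (csumD h1 (abs_boundedZ (-1) bd)) (csumZ _ bd) -/(psum _ _) -/(thA s).
rewrite mulN1r opprD opprK addrA subrr add0r; exact: csum_bound.
Qed.

(** The normalised finite triple products converge to Thb uniformly on annuli,
    while all their factors beyond a fixed J stay within constants of 1.
    Hence the zeros of Thb in an annulus are among those of a finite product,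
    with at most the same multiplicities. *)
Lemma theta_lower (r : R) : 1 <= r -> exists J, exists2 c : R, 0 < c &
  forall s : C, s != 0 -> cabs s <= r -> cabs s^-1 <= r ->
  c * cabs (jprod J s) <= cabs (Thb s).
Proof.
move=> r1; have r0 : 0 <= r by lra.
have r01 := rho01; have /andP[rh0 rh1] := r01.
have [J hJ] := @prod_tail R rho r r01 r0.
have [d [K [d0 K0 hq]]] := qfac_bounds.
have [L L0 hL] := thA_trunc_cvg r0.
(* d ^+ 2 / K is a lower bound for kap, and each of the two tails of the
   product contributes a factor 1 / 2 *)
exists J, (d ^+ 2 / K / 4); first by rewrite !divr_gt0 ?exprn_gt0.
move=> s s0 sr sVr; apply/ler_addgt0Pr => e e0.
have [N0 hN0] := geo_small (2 * L) r01 e0.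
pose N := (J + N0)%N; pose kap := qfac q2 N ^+ 2 / qfac q2 (N + N).
have id1 : kap * jprod N s = thA_trunc N s + thA_trunc N s^-1 - 1.
  have E n : (n <= N)%N -> kap * gbin q2 (N + N) (N + n) = ecoef N n.
    exact: ecoef_gbinD.
  have E' n : (n <= N)%N -> kap * gbin q2 (N + N) (N - n) = ecoef N n.
    exact: ecoef_gbinB.
  rewrite jacobi_finite // -/q2 mulrDr -addrA; congr (_ + _).
    rewrite mulr_sumr; apply: eq_bigr => n _; rewrite -E; last by rewrite -ltnS.
    by rewrite /gauss_coef; ring.
  rewrite /thA_trunc big_ord_recl /= ecoef0 /gauss_coef mul0n !expr0 !mulr1 addrAC subrr add0r.
  rewrite mulr_sumr; apply: eq_bigr => n _; rewrite /bump /= add1n -E' //.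
  ring.
have err : cabs (Thb s - kap * jprod N s) <= e.
  have -> : Thb s - kap * jprod N s =
      (thA s - thA_trunc N s) + (thA s^-1 - thA_trunc N s^-1).
    rewrite id1 /Thb; move: (thA s) (thA s^-1) (thA_trunc N s) (thA_trunc N s^-1) => a b c f.
    ring.
  apply: le_trans (cabsD _ _) _.
  have h1 := hL N s sr; have h2 := hL N s^-1 sVr.
  have h3 : L * rho ^+ N <= L * rho ^+ N0.
    by rewrite ler_wpM2l // rho_pow // leq_addl.
  lra.
have low : d ^+ 2 / K / 4 * cabs (jprod J s) <= cabs (kap * jprod N s).
  have jN : jprod N s = jprod J s * (\prod_(i < N0) (1 + q ^+ (2 * (J + i) + 1) * s) *
      \prod_(i < N0) (1 + q ^+ (2 * (J + i) + 1) * s^-1)).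
    by rewrite /jprod big_split_ord /= -big_split.
  have qb (t : C) : cabs t <= r -> forall j, cabs (q ^+ (2 * j + 1) * t) <= r * rho ^+ j.
    move=> tr j; rewrite cabsM cabsX exprD exprM expr1 -/rho mulrC.
    rewrite ler_pM ?cabs_ge0 ?mulr_ge0 ?exprn_ge0 ?cabs_ge0 //.
    by rewrite ler_piMr ?exprn_ge0 ?cabs_ge0 // ?ltW.
  have /andP[t1 _] := hJ _ (qb _ sr) N0.
  have /andP[t2 _] := hJ _ (qb _ sVr) N0.
  have kE : cabs kap = cabs (qfac q2 N) ^+ 2 / cabs (qfac q2 (N + N)).
    by rewrite /kap cabsM cabsV cabsX.
  rewrite jN cabsM (cabsM (jprod J s)) cabsM.
  move: t1 t2; set P1 := cabs (\prod_(i < N0) _); set P2 := cabs (\prod_(i < N0) _) => t1 t2.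
  rewrite [leRHS]mulrCA mulrC kE.
  have /andP[k1 _] := hq N; have /andP[_ k2] := hq (N + N)%N.
  have kk : d ^+ 2 / K <= cabs (qfac q2 N) ^+ 2 / cabs (qfac q2 (N + N)).
    rewrite ler_pM ?exprn_ge0 ?invr_ge0 ?(ltW d0) ?(ltW K0) //.
      by rewrite lerXn2r ?nnegrE ?cabs_ge0 // ?ltW.
    by rewrite lef_pV2 ?posrE // cabs_gt0 qfac_neq0.
  have i2 : 0 <= (2^-1 : R) by rewrite invr_ge0.
  have tt := ler_pM i2 i2 t1 t2.
  rewrite ler_wpM2l ?cabs_ge0 //.
  have -> : d ^+ 2 / K / 4 = d ^+ 2 / K * (2^-1 / 2) by field; rewrite gt_eqF.
  by rewrite ler_pM // ?mulr_ge0 ?invr_ge0 ?exprn_ge0 ?cabs_ge0 // ?ltW.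
apply: le_trans low _.
rewrite addrC -lerBlDr; apply: le_trans err.
rewrite (cabsBC (Thb s)); exact: (cabsB (kap * jprod N s) (Thb s)).
Qed.

End ThetaSeries.

(** * A calculus of complex limits and derivatives *)

Section HasD.
Variable R : realType.
Local Notation C := R[i].
Implicit Types (f g phi : C -> C) (z d e c l m : C).

(** Wrapped in an inductive type so that unification does not unfold the
    filter. *)
Variant clim f z l : Prop := Clim of f w @[w --> z^'] --> l.
Definition ccont f z := clim f z (f z).

Lemma climP f z l : clim f z l <-> (forall e : R, 0 < e ->
  exists2 r : R, 0 < r & forall w, w != z -> cabs (w - z) < r -> cabs (f w - l) < e).
Proof.
split=> [[/cvgC h] e /h /dnearC//|h].
by apply/Clim/cvgC => e /h H; apply/dnearC.
Qed.

Lemma ccontP f z : ccont f z <-> (forall e : R, 0 < e ->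
  exists2 r : R, 0 < r & forall w, cabs (w - z) < r -> cabs (f w - f z) < e).
Proof.
split=> [/climP h e e0|h].
  have [r r0 hr] := h _ e0; exists r => // w wr.
  by have [->|wz] := eqVneq w z; [rewrite subrr cabs0|exact: hr].
by apply/climP => e /h [r r0 hr]; exists r => // w _; exact: hr.
Qed.

Lemma clim_eq f g z l : (\forall w \near z^', f w = g w) -> clim f z l -> clim g z l.
Proof.
move=> /dnearC[s s0 hs] /climP h; apply/climP => e /h[r r0 hr].
exists (Num.min r s); first by rewrite lt_min r0.
by move=> w wz; rewrite lt_min => /andP[wr ws]; rewrite -hs // hr.
Qed.

Lemma climD f g z l m : clim f z l -> clim g z m -> clim (fun w => f w + g w) z (l + m).
Proof. by move=> [h] [k]; apply: Clim; exact: (cvgD h k). Qed.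

Lemma climM f g z l m : clim f z l -> clim g z m -> clim (fun w => f w * g w) z (l * m).
Proof. by move=> [h] [k]; apply: Clim; exact: (cvgM h k). Qed.

Lemma climN f z l : clim f z l -> clim (fun w => - f w) z (- l).
Proof. by move=> [h]; apply: Clim; exact: (cvgN h). Qed.

Lemma climV f z l : l != 0 -> clim f z l -> clim (fun w => (f w)^-1) z l^-1.
Proof. by move=> l0 [h]; apply: Clim; exact: (cvgV l0 h). Qed.

Lemma clim_cst c z : clim (fun=> c) z c.
Proof. by apply: Clim; exact: cvg_cst. Qed.

Lemma clim_unique f z l m : clim f z l -> clim f z m -> l = m.
Proof. by move=> [h] [k]; apply: cvg_unique h k. Qed.

Lemma clim_comp f g z l : clim f z l -> ccont g l -> clim (fun w => g (f w)) z (g l).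
Proof.
move=> /climP h /ccontP k; apply/climP => e /k [r r0 hr].
by have [s s0 hs] := h _ r0; exists s => // w wz /hs h1; apply: hr; exact: h1.
Qed.

Lemma clim_neq0 f z l : clim f z l -> l != 0 -> \forall w \near z^', f w != 0.
Proof.
move=> /climP h l0; have [|r r0 hr] := h (cabs l); first by rewrite cabs_gt0.
apply/dnearC; exists r => // w wz /(hr _ wz); apply: contraTneq => ->.
by rewrite sub0r cabsN ltxx.
Qed.

(** Differentiability together with the value of the derivative, so that the
    rules below chain by composition of terms. *)
Definition hasd f z d := differentiable f z /\ derive1 f z = d.

Lemma hasd_eq f z d e : hasd f z d -> d = e -> hasd f z e.
Proof. by move=> h <-. Qed.

Lemma hasd_ex f z : differentiable f z -> hasd f z (derive1 f z).
Proof. by []. Qed.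

Lemma hasdE f z d : hasd f z d <-> clim (fun w => (f w - f z) / (w - z)) z d.
Proof.
split=> [[h <-]|[]]; last exact: cvg_diffC.
have [l hl] := diffC_cvg h; apply: Clim.
by have [_ ->] := cvg_diffC hl.
Qed.

(** Caratheodory's form of the derivative. *)
Lemma hasd_slope f z d : hasd f z d -> exists phi : C -> C,
  [/\ ccont phi z, phi z = d & forall w, f w - f z = phi w * (w - z)].
Proof.
move=> /hasdE h; exists (fun w => if w == z then d else (f w - f z) / (w - z)).
split => [||w]; [|by rewrite eqxx|].
  rewrite /ccont eqxx; apply: clim_eq h; apply/dnearC; exists 1 => // w /negbTE ->.
  by [].
case: eqVneq => [->|wz]; first by rewrite !subrr mulr0.
by rewrite mulfVK // subr_eq0.
Qed.

Lemma slope_hasd f z d phi : clim phi z d ->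
  (\forall w \near z^', f w - f z = phi w * (w - z)) -> hasd f z d.
Proof.
move=> h k; apply/hasdE; apply: clim_eq h; move/dnearC: k => [r r0 hr].
by apply/dnearC; exists r => // w wz wr; rewrite hr // mulfK // subr_eq0.
Qed.

Lemma hasd_cont f z d : hasd f z d -> ccont f z.
Proof.
move=> /hasd_slope [phi [hphi _ h]].
have hid : clim (fun w => w - z) z 0.
  by apply/climP => e e0; exists e => // w _; rewrite subr0.
have := climD (climM hphi hid) (clim_cst (f z) z); rewrite mulr0 add0r.
by apply: clim_eq; apply: nearW => w; rewrite -h subrK.
Qed.

Lemma hasd_cst c z : hasd (fun=> c) z 0.
Proof.
apply/hasdE; apply: clim_eq (clim_cst 0 z).
by apply: nearW => w; rewrite subrr mul0r.
Qed.

Lemma hasd_id z : hasd (fun w => w) z 1.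
Proof. by apply: slope_hasd (clim_cst 1 z) _; apply: nearW => w; rewrite mul1r. Qed.

Lemma hasdD f g z d e : hasd f z d -> hasd g z e -> hasd (fun w => f w + g w) z (d + e).
Proof.
move=> /hasdE h /hasdE k; apply/hasdE; apply: clim_eq (climD h k).
by apply: nearW => w; ring.
Qed.

Lemma hasdM f g z d e : hasd f z d -> hasd g z e ->
  hasd (fun w => f w * g w) z (f z * e + g z * d).
Proof.
move=> hf /hasdE hg; have fc := hasd_cont hf; move/hasdE: hf => hf.
apply/hasdE; apply: clim_eq (climD (climM fc hg) (climM (clim_cst (g z) z) hf)).
by apply: nearW => w; ring.
Qed.

Lemma hasdN f z d : hasd f z d -> hasd (fun w => - f w) z (- d).
Proof.
by move=> /hasdE h; apply/hasdE; apply: clim_eq (climN h); apply: nearW => w; ring.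
Qed.

Lemma hasdZ f z c d : hasd f z d -> hasd (fun w => c * f w) z (c * d).
Proof.
move=> h; apply: (hasd_eq (hasdM (hasd_cst c z) h)); by rewrite mulr0 addr0.
Qed.

Lemma hasd_comp f g z d e : hasd f z d -> hasd g (f z) e -> hasd (fun w => g (f w)) z (e * d).
Proof.
move=> hf hg; have fc := hasd_cont hf.
have [phi [phic phid hphi]] := hasd_slope hf; have [psi [psic psie hpsi]] := hasd_slope hg.
rewrite -phid -psie; apply: slope_hasd (climM (clim_comp fc psic) phic) _.
by apply: nearW => w; rewrite hpsi hphi mulrA.
Qed.

Lemma hasdV f z d : hasd f z d -> f z != 0 -> hasd (fun w => (f w)^-1) z (- d / f z ^+ 2).
Proof.
move=> hf fz; have fc := hasd_cont hf.
have /dnearC [r r0 hr] := clim_neq0 fc fz; move/hasdE : hf => hf.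
apply/hasdE; have := climM (climN hf) (climM (climV fz fc) (clim_cst (f z)^-1 z)).
rewrite -invfM -expr2; apply: clim_eq; apply/dnearC; exists r => // w wz wr.
move: (hr w wz wr) fz (wz); rewrite -(subr_eq0 w z).
by move: (f w) (f z) => a b a0 b0 c0; field; rewrite a0 b0 c0.
Qed.

Lemma hasd_cexp z : hasd (@cexp R) z (cexp z).
Proof. exact: cexp_deriv. Qed.

Lemma hasd_psum u z : entire_coef u -> hasd (psum u) z (psum (dcoef u) z).
Proof. exact: psum_deriv. Qed.

Lemma hasd_lin c m z : hasd (fun w => c * w + m) z c.
Proof.
apply: (hasd_eq (hasdD (hasdZ c (hasd_id z)) (hasd_cst m z))); by rewrite mulr1 addr0.
Qed.

Lemma hasd_unique f z d e : hasd f z d -> hasd f z e -> d = e.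
Proof. by move=> [_ <-] [_ <-]. Qed.

Lemma hasd_ext f g z d : f =1 g -> hasd f z d -> hasd g z d.
Proof. by move=> /funext ->. Qed.

Lemma hasd_near f g z d : (\forall w \near z, f w = g w) -> hasd f z d -> hasd g z d.
Proof.
move=> /nearC[r r0 h] /hasdE H; apply/hasdE; apply: clim_eq H; apply/dnearC.
by exists r => // w wz wr; rewrite !h // subrr cabs0.
Qed.

End HasD.

(** * The four theta functions: quasi-periods and zeros *)

Section Theta.
Variables (R : realType) (tau : R[i]).
Local Notation C := R[i].
Hypothesis htau : 0 < complex.Im tau.
Implicit Types (z w s e : C) (a b : bool).

(** Locked, as are Th and E below: these are products and exponentials that
    algebraic rewriting must treat as atoms. *)
Definition qq : C := locked (nome tau).

Lemma qqE : nome tau = qq. Proof. exact: lock. Qed.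

Lemma cabs_qq : cabs qq = expR (- (pi * complex.Im tau)).
Proof.
rewrite -qqE /nome cabs_cexp; congr expR; case: tau => x y.
by rewrite /=; ring.
Qed.

Lemma qq_lt1 : cabs qq < 1.
Proof. by rewrite cabs_qq expR_lt1 oppr_lt0 mulr_gt0 // pi_gt0. Qed.

Lemma qq_neq0 : qq != 0. Proof. by rewrite -qqE; exact: cexp_neq0. Qed.

Definition Th : C -> C := locked (Thb qq).

Lemma ThE s : Th s = Thb qq s. Proof. by rewrite /Th -lock. Qed.

Lemma ThV s : Th s^-1 = Th s. Proof. by rewrite !ThE ThbV. Qed.

Lemma Th_q2 s : s != 0 -> Th (qq ^+ 2 * s) = Th s / (qq * s).
Proof. by move=> s0; rewrite !ThE Thb_q2 ?qq_lt1 ?qq_neq0. Qed.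

Local Notation g := (gauss_coef qq).

Lemma Th_series (c s : C) :
  csum (fun k => c * (g k.+1 * (s ^+ k.+1 + s^-1 ^+ k.+1))) = c * (Th s - 1).
Proof.
have [M hM] := entire_abs s (gauss_entire qq_lt1).
have [M' hM'] := entire_abs s^-1 (gauss_entire qq_lt1).
rewrite !ThE /Thb /thA /psum (csum_recl hM) (csum_recl hM').
have h1 := abs_bounded_shift hM; have h2 := abs_bounded_shift hM'.
rewrite (_ : (fun k => _) = fun k => c * (g k.+1 * s ^+ k.+1 + g k.+1 * s^-1 ^+ k.+1)); last first.
  by apply/funext => k; rewrite mulrDr.
rewrite (csumZ c (abs_boundedD h1 h2)) (csumD h1 h2) /gauss_coef !mul0n !expr0 !mulr1.
by move: (csum _) (csum _) => x y; ring.
Qed.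

(** Pairing n with - n - 1 in the bilateral series turns the frequencies 2n +
    1 of theta1 and theta2 into powers of e ^+ 2. *)
Lemma Th_odd_series (c eps e : C) : eps ^+ 2 = 1 -> e != 0 ->
  csum (fun n => c * (eps ^+ n * qq ^+ (n * n.+1) *
     (e ^+ (2 * n + 1) + eps * e^-1 ^+ (2 * n + 1)))) =
  c * (e * Th (eps * qq * e ^+ 2)).
Proof.
move=> eps2 e0; set s := eps * qq * e ^+ 2.
have eps0 : eps != 0 by apply: contra_eq_neq eps2 => ->; rewrite expr0n eq_sym oner_eq0.
have epsV : eps^-1 = eps by apply: (mulfI eps0); rewrite mulfV // -expr2.
have [M hM] := entire_abs s (gauss_entire qq_lt1).
have [M' hM'] := entire_abs s^-1 (gauss_entire qq_lt1).
have hM1 := abs_bounded_shift hM'.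
rewrite !ThE /Thb /thA /psum (csum_recl hM') {2}/gauss_coef mul0n !expr0 mulr1.
have -> (x y : C) : x + (1 + y) - 1 = x + y by ring.
rewrite mulrA mulrDr -(csumZ _ hM) -(csumZ _ hM1) -(csumD (abs_boundedZ _ hM) (abs_boundedZ _ hM1)).
congr csum; apply/funext => n; rewrite mulrA mulrDr /gauss_coef; congr (_ + _).
  rewrite /s 2!exprMn -!exprM (_ : n * n.+1 = n * n + n)%N; last by lia.
  by rewrite !exprD expr1; ring.
rewrite /s 2!invfM epsV 2!exprMn !exprVn -!exprM (_ : n.+1 * n.+1 = n * n.+1 + n.+1)%N; last by lia.
rewrite (_ : 2 * n.+1 = 2 * n + 1 + 1)%N; last by lia.
rewrite !(exprD _ _ 1) (exprD _ _ n.+1) !expr1 (exprS eps).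
have : qq ^+ n.+1 != 0 by rewrite expf_neq0 // qq_neq0.
have : e ^+ (2 * n) != 0 by rewrite expf_neq0.
move: (qq ^+ n.+1) (e ^+ (2 * n)) (qq ^+ (n * n.+1)) => x y t y0 x0.
by field; rewrite e0 x0 y0.
Qed.

(** The square root of the usual Fourier variable, since theta1 and theta2
    have half-integral frequencies. *)
Definition E z : C := locked (@cexp R) (cpi R * 'i * z).

Lemma EE z : E z = cexp (cpi R * 'i * z). Proof. by rewrite /E -lock. Qed.

Lemma E_neq0 z : E z != 0. Proof. by rewrite EE; exact: cexp_neq0. Qed.

Lemma ED z w : E (z + w) = E z * E w.
Proof. by rewrite !EE mulrDr cexpD. Qed.

Lemma EN z : E (- z) = (E z)^-1.
Proof. by rewrite !EE mulrN cexpN. Qed.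

Lemma E1 : E 1 = -1. Proof. by rewrite EE mulr1 cexp_pii. Qed.

Lemma Etau : E tau = qq. Proof. by rewrite EE -qqE. Qed.

Lemma En n z : E z ^+ n = cexp (n%:R * (cpi R * 'i * z)).
Proof. by rewrite EE cexp_natl. Qed.

Definition eta a b : C := (-1) ^+ b * qq ^+ a.

Lemma eta_neq0 a b : eta a b != 0.
Proof. by rewrite mulf_neq0 ?expf_neq0 ?qq_neq0 // oppr_eq0 oner_eq0. Qed.

(** All four theta functions at once, up to a constant factor: the first index
    tells half-integral from integral frequencies, the second one the
    alternating series from the others. *)
Definition tht a b z : C := E z ^+ a * Th (eta a b * E z ^+ 2).

Definition tcst a b : C := if a then (if b then - 'i * nome4 tau else nome4 tau) else 1.

Lemma tcst_neq0 a b : tcst a b != 0.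
Proof.
have n0 : nome4 tau != 0 by exact: cexp_neq0.
by case: a; case: b; rewrite /= ?oner_neq0 // mulf_neq0 // oppr_eq0 i_neq0.
Qed.

Lemma theta1E z : theta1 tau z = tcst true true * tht true true z.
Proof.
rewrite /tht /eta /= !expr1 /theta1.
have iV : ('i : C)^-1 = - 'i.
  by apply: (mulIf (i_neq0 R)); rewrite mulVf ?i_neq0 // mulNr -expr2 sqr_i opprK.
have -> : (fun n => (-1) ^+ n * nome tau ^+ (n * n.+1) * csin ((2 * n + 1)%:R * cpi R * z)) =
  fun n => (- 'i / 2) * ((-1) ^+ n * qq ^+ (n * n.+1) *
     (E z ^+ (2 * n + 1) + (-1) * (E z)^-1 ^+ (2 * n + 1))).
  apply/funext => n; rewrite /csin qqE exprVn En -cexpN.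
  rewrite (_ : 'i * ((2 * n + 1)%:R * cpi R * z) = (2 * n + 1)%:R * (cpi R * 'i * z)); last by ring.
  rewrite invfM iV; move: (cexp _) (cexp _) ((-1) ^+ n) (qq ^+ _) => x y t u.
  by field.
rewrite Th_odd_series ?E_neq0 ?sqrrN ?expr1n //.
by move: (Th _) => T; field.
Qed.

Lemma theta2E z : theta2 tau z = tcst true false * tht true false z.
Proof.
rewrite /tht /eta /= !expr1 expr0 mul1r /theta2.
have -> : (fun n => nome tau ^+ (n * n.+1) * ccos ((2 * n + 1)%:R * cpi R * z)) =
  fun n => 2^-1 * (1 ^+ n * qq ^+ (n * n.+1) *
     (E z ^+ (2 * n + 1) + 1 * (E z)^-1 ^+ (2 * n + 1))).
  apply/funext => n; rewrite /ccos qqE exprVn En -cexpN expr1n.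
  rewrite (_ : 'i * ((2 * n + 1)%:R * cpi R * z) = (2 * n + 1)%:R * (cpi R * 'i * z)); last by ring.
  by move: (cexp _) (cexp _) (qq ^+ _) => x y u; field.
rewrite Th_odd_series ?E_neq0 ?expr1n // mul1r.
by move: (Th _) => T; field.
Qed.

Lemma theta34_series (s : C) b z : s = (-1) ^+ b * E z ^+ 2 ->
  1 + 2 * csum (fun k => ((-1) ^+ b) ^+ k.+1 * nome tau ^+ (k.+1 ^ 2) *
     ccos (2 * cpi R * k.+1%:R * z)) = Th s.
Proof.
move=> sE.
have e2 : ((-1) ^+ b)^-1 = (-1) ^+ b :> C by case: b {sE}; rewrite ?expr1 ?invrN1 ?expr0 ?invr1.
rewrite (_ : (fun k => _) = fun k => 2^-1 * (g k.+1 * (s ^+ k.+1 + s^-1 ^+ k.+1))).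
  by rewrite Th_series; move: (Th s) => T; field.
apply/funext => k; rewrite qqE -mulnn /gauss_coef sE invfM e2 (exprMn _ _ (E z ^+ 2)) (exprMn _ _ (E z ^- 2)).
rewrite exprVn -(exprM (E z)) En -cexpN /ccos.
rewrite (_ : 'i * (2 * cpi R * k.+1%:R * z) = (2 * k.+1)%:R * (cpi R * 'i * z)); last first.
  by rewrite natrM; ring.
by move: (cexp _) (cexp _) (qq ^+ _) ((-1) ^+ b) => x y u t; field.
Qed.

Lemma theta3E z : theta3 tau z = tcst false false * tht false false z.
Proof.
rewrite /tht /eta /= !expr0 !mul1r -(@theta34_series _ false z) ?expr0 ?mul1r //.
by under [in RHS]eq_fun do rewrite expr1n mul1r.
Qed.

Lemma theta4E z : theta4 tau z = tcst false true * tht false true z.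
Proof.
by rewrite /tht /eta /= !expr0 !mul1r mulr1 -(@theta34_series _ true z) ?expr1.
Qed.

Lemma tht_add1 a b z : tht a b (z + 1) = (-1) ^+ a * tht a b z.
Proof. by rewrite /tht ED E1 mulrN1 sqrrN (exprNn (E z)) [RHS]mulrA. Qed.

(** The common automorphy factor of the four theta functions. *)
Definition tfac z : C := (qq * E z ^+ 2)^-1.

Lemma tfac_neq0 z : tfac z != 0.
Proof. by rewrite invr_neq0 // mulf_neq0 ?expf_neq0 ?qq_neq0 ?E_neq0. Qed.

Lemma eps_sq b : ((-1) ^+ b : C) ^+ 2 = 1.
Proof. by rewrite -exprM muln2 -mul2n exprM sqrrN expr1n expr1n. Qed.

Lemma tht_addtau a b z : tht a b (z + tau) = (-1) ^+ b * tfac z * tht a b z.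
Proof.
rewrite /tht ED Etau (_ : eta a b * (E z * qq) ^+ 2 = qq ^+ 2 * (eta a b * E z ^+ 2)); last by ring.
rewrite (exprMn a (E z)) Th_q2 ?mulf_neq0 ?eta_neq0 ?expf_neq0 ?E_neq0 ?qq_neq0 //.
move: (Th _) => T; rewrite /tfac /eta.
  have := qq_neq0; have := E_neq0 z; have := expf_neq0 a qq_neq0.
  have e0 : ((-1) ^+ b : C) != 0 by rewrite expf_neq0 // oppr_eq0 oner_eq0.
  have := eps_sq b; move: e0.
  move: (E z) ((-1) ^+ b) qq (qq ^+ a) (E z ^+ a) => x t q qa xa t0 t2 qa0 x0 q0.
  have tV : t^-1 = t by apply: (mulIf t0); rewrite mulVf // -expr2.
  by rewrite !invfM tV; field; rewrite x0 q0 qa0.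
Qed.

Lemma tht_opp a b z : tht a b (- z) = (-1) ^+ (a && b) * tht a b z.
Proof.
have e0 : ((-1) ^+ b : C) != 0 by rewrite expf_neq0 // oppr_eq0 oner_eq0.
have eV : ((-1) ^+ b : C)^-1 = (-1) ^+ b by apply: (mulIf e0); rewrite mulVf // -expr2 eps_sq.
rewrite /tht EN !exprVn; case: a; last first.
  rewrite /eta /= !expr0 invr1 !mulr1 !mul1r.
  rewrite (_ : (-1) ^+ b / E z ^+ 2 = ((-1) ^+ b * E z ^+ 2)^-1) ?ThV //.
  by rewrite [RHS]invfM eV.
rewrite /= /eta !expr1; set w := (-1) ^+ b * qq^-1 * E z ^+ 2.
rewrite (_ : (-1) ^+ b * qq / E z ^+ 2 = w^-1) ?ThV; last first.
  by rewrite /w [RHS]invfM [((-1) ^+ b / qq)^-1]invfM invrK eV.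
have w0 : w != 0 by rewrite /w !mulf_neq0 ?expf_neq0 ?invr_eq0 ?E_neq0 ?qq_neq0.
have := Th_q2 w0.
rewrite (_ : qq ^+ 2 * w = (-1) ^+ b * qq * E z ^+ 2); last first.
  by rewrite /w; move: ((-1) ^+ b) => t; field; exact: qq_neq0.
rewrite (_ : qq * w = (-1) ^+ b * E z ^+ 2); last first.
  by rewrite /w; move: ((-1) ^+ b) => t; field; exact: qq_neq0.
move=> ->; move: (Th w) (E_neq0 z) e0; move: (E z) ((-1) ^+ b) (eps_sq b) eV => x t t2 tV T x0 t0.
by field; rewrite x0 t0.
Qed.

Lemma E_eq1 z : E z = 1 -> exists n : int, z = 2 * n%:~R.
Proof.
rewrite EE => /cexp_eq1 [n]; rewrite (_ : n%:~R * _ = cpi R * 'i * (2 * n%:~R)); last by ring.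
by move=> /(mulfI (mulf_neq0 (cpi_neq0 R) (i_neq0 R))) ->; exists n.
Qed.

Lemma E_nat n z : E (n%:R * z) = E z ^+ n.
Proof. by rewrite En EE mulrCA. Qed.

(** By theta_lower a zero of the series is a zero of one of the factors 1 +
    q^(2j+1) s^(+-1), and these are equations of the form E _ = 1. *)
Lemma tht_zero a b z : tht a b z = 0 ->
  exists m n : int, 2 * z = (2 * m%:~R + b%:R + 1) + (2 * n%:~R + a%:R + 1) * tau.
Proof.
move=> /eqP; rewrite mulf_eq0 expf_eq0 (negbTE (E_neq0 z)) andbF /=.
set s := eta a b * E z ^+ 2 => /eqP Ts.
have s0 : s != 0 by rewrite mulf_neq0 ?eta_neq0 ?expf_neq0 ?E_neq0.
have sE : s = E (b%:R + a%:R * tau + 2 * z).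
  by rewrite !ED -(mulr1 b%:R) !E_nat E1 Etau.
have [|J [c c0 h]] := @theta_lower R qq qq_lt1 qq_neq0 (1 + cabs s + cabs s^-1).
  by rewrite -addrA lerDl addr_ge0 ?cabs_ge0.
have s1 := cabs_ge0 s; have s2 := cabs_ge0 s^-1.
have : c * cabs (jprod qq J s) <= 0 by rewrite -(cabs0 R) -Ts ThE; apply: h => //; lra.
rewrite pmulr_rle0 // => H; have {H} : cabs (jprod qq J s) == 0.
  by rewrite eq_le H cabs_ge0.
rewrite cabs_eq0 => /prodf_eq0 [j _]; rewrite mulf_eq0 => /orP[] /eqP hj.
  have : E (b%:R + a%:R * tau + 2 * z + (2 * j + 1)%:R * tau + 1) = 1.
    rewrite ED E1 (ED _ (_ * tau)) -sE E_nat Etau mulrC.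
    by rewrite (_ : s * _ = -1) ?mulrNN ?mulr1 //; apply/eqP; rewrite -addr_eq0 addrC mulrC hj.
  move=> /E_eq1[n hn]; exists (n - b%:Z - 1), (- (a%:Z + j%:Z + 1)).
  apply/eqP; rewrite -subr_eq0; apply/eqP.
  have : b%:R + a%:R * tau + 2 * z + (2 * j + 1)%:R * tau + 1 - 2 * n%:~R = 0.
    by rewrite hn subrr.
  by move=> <-; ring.
have : E (b%:R + a%:R * tau + 2 * z - (2 * j + 1)%:R * tau + 1) = 1.
  rewrite ED E1 (ED _ (- _)) EN -sE E_nat Etau.
  have q0 : qq ^+ (2 * j + 1) != 0 by rewrite expf_neq0 // qq_neq0.
  have -> : qq ^+ (2 * j + 1) = - s.
    apply: (mulIf (_ : s^-1 != 0)); rewrite ?invr_eq0 // mulNr mulfV //.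
    by apply/eqP; rewrite -addr_eq0 addrC hj.
  by move: (s) s0 => t t0; field; rewrite t0.
move=> /E_eq1[n hn]; exists (n - b%:Z - 1), (j%:Z - a%:Z).
apply/eqP; rewrite -subr_eq0; apply/eqP.
have : b%:R + a%:R * tau + 2 * z - (2 * j + 1)%:R * tau + 1 - 2 * n%:~R = 0.
  by rewrite hn subrr.
by move=> <-; ring.
Qed.

Lemma tht_half_neq0 a b x : ~ lattice tau x -> tht a b (x / 2) != 0.
Proof.
move=> hx; apply/eqP => /tht_zero [m [n h]]; apply: hx.
exists (2 * m + b%:Z + 1), (2 * n + a%:Z + 1).
have -> : x = 2 * (x / 2) by rewrite mulrCA mulfV ?mulr1.
by rewrite h; ring.
Qed.

Local Notation th1 := (tht true true).

Lemma th1_eq0 z : th1 z = 0 -> lattice tau z.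
Proof.
move=> /tht_zero [m [n h]]; exists (m + 1), (n + 1).
apply: (mulfI (_ : 2 != 0 :> C)) => //.
by rewrite h (_ : true%:R = 1) //; ring.
Qed.

Lemma th1_0 : th1 0 = 0.
Proof.
have := tht_opp true true 0; rewrite oppr0 /= expr1 mulN1r => /eqP.
by rewrite -addr_eq0 -mulr2n mulrn_eq0 /= => /eqP.
Qed.

(** Lets properties be checked at one point of each class modulo the lattice. *)
Lemma lattice_ind (P : C -> Prop) : (forall z, P z <-> P (z + 1)) ->
  (forall z, P z <-> P (z + tau)) -> forall z w, lattice tau w -> P z -> P (z + w).
Proof.
move=> h1 h2.
have n1 (n : nat) z : P z <-> P (z + n%:R).
  elim: n z => [|n ih] z; first by rewrite addr0.
  by rewrite -natr1 addrA -h1.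
have n2 (n : nat) z : P z <-> P (z + n%:R * tau).
  elim: n z => [|n ih] z; first by rewrite mul0r addr0.
  by rewrite -natr1 mulrDl mul1r addrA -h2.
have i1 (n : int) z : P z <-> P (z + n%:~R).
  case: n => n; first by rewrite -pmulrn.
  by rewrite NegzE mulrNz -pmulrn (n1 n.+1 (z - _)) subrK.
have i2 (n : int) z : P z <-> P (z + n%:~R * tau).
  case: n => n; first by rewrite -pmulrn.
  by rewrite NegzE mulrNz -pmulrn mulNr (n2 n.+1 (z - _)) subrK.
by move=> z w [m [n ->]]; rewrite addrA -i2 -i1.
Qed.

Lemma sgn_neq0 b : (-1) ^+ b != 0 :> C.
Proof. by rewrite expf_neq0 // oppr_eq0 oner_eq0. Qed.

Lemma th1_lattice z : lattice tau z -> th1 z = 0.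
Proof.
move=> hz; have := @lattice_ind (fun w => th1 w = 0) _ _ 0 z hz th1_0.
rewrite add0r; apply => w; rewrite ?tht_add1 ?tht_addtau.
  split=> [->|h]; first by rewrite mulr0.
  by apply: (mulfI (sgn_neq0 true)); rewrite h mulr0.
split=> [->|h]; first by rewrite mulr0.
by apply: (mulfI (mulf_neq0 (sgn_neq0 true) (tfac_neq0 w))); rewrite h mulr0.
Qed.

Local Notation pii := (cpi R * 'i : C).

Lemma hasd_E z : hasd E z (pii * E z).
Proof.
have h : hasd (fun w => pii * w) z pii.
  by apply: (hasd_eq (hasdZ pii (hasd_id z))); rewrite mulr1.
apply: (hasd_ext (f := fun w => cexp (pii * w))); first by move=> w; rewrite EE.
by apply: (hasd_eq (hasd_comp h (hasd_cexp _))); rewrite EE mulrC.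
Qed.

Lemma hasd_Epow a z : hasd (fun w => E w ^+ a) z (a%:R * pii * E z ^+ a).
Proof.
case: a => /=; first by apply: (hasd_eq (hasd_E z)); rewrite mul1r expr1.
by apply: (hasd_eq (hasd_cst 1 z)); rewrite !mul0r.
Qed.

Definition dTh s : C := psum (dcoef g) s - psum (dcoef g) s^-1 / s ^+ 2.

Lemma hasd_Th s : s != 0 -> hasd Th s (dTh s).
Proof.
move=> s0; have gE := gauss_entire qq_lt1.
apply: (hasd_ext (f := fun w => psum g w + psum g w^-1 + (-1))); first by move=> w; rewrite ThE.
have hV := hasdV (hasd_id s) s0.
apply: (hasd_eq (hasdD (hasdD (hasd_psum s gE) (hasd_comp hV (hasd_psum _ gE))) (hasd_cst (-1) s))).
by rewrite /dTh addr0 mulNr mul1r mulrN.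
Qed.

Lemma holo_dTh s : s != 0 -> exists d, hasd dTh s d.
Proof.
move=> s0; have gE := dcoef_entire (gauss_entire qq_lt1).
have hV := hasdV (hasd_id s) s0.
have hs2 := hasdM (hasd_id s) (hasd_id s).
have s20 : s * s != 0 by rewrite mulf_neq0.
have h := hasdD (hasd_psum s gE) (hasdN (hasdM (hasd_comp hV (hasd_psum _ gE)) (hasdV hs2 s20))).
by eexists; apply: hasd_ext h => w; rewrite /dTh expr2.
Qed.

Definition targ a b z : C := eta a b * E z ^+ 2.

Lemma targ_neq0 a b z : targ a b z != 0.
Proof. by rewrite mulf_neq0 ?eta_neq0 ?expf_neq0 ?E_neq0. Qed.

Lemma hasd_targ a b z : hasd (targ a b) z (2 * pii * targ a b z).
Proof.
have h := hasdZ (eta a b) (hasdM (hasd_E z) (hasd_E z)).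
apply: (hasd_ext (f := fun w => eta a b * (E w * E w))) => [w|]; first by rewrite /targ expr2.
by apply: (hasd_eq h); rewrite /targ; ring.
Qed.

Definition dtht a b z : C :=
  E z ^+ a * (dTh (targ a b z) * (2 * pii * targ a b z)) + Th (targ a b z) * (a%:R * pii * E z ^+ a).

Lemma hasd_tht a b z : hasd (tht a b) z (dtht a b z).
Proof. exact: (hasdM (hasd_Epow a z) (hasd_comp (hasd_targ a b z) (hasd_Th (targ_neq0 a b z)))). Qed.

Lemma holo_dtht a b z : exists d, hasd (dtht a b) z d.
Proof.
have [d hd] := holo_dTh (targ_neq0 a b z).
have hE := hasd_Epow a z; have ht := hasd_targ a b z.
have h1 := hasdM hE (hasdM (hasd_comp ht hd) (hasdZ (2 * pii) ht)).
have h2 := hasdM (hasd_comp ht (hasd_Th (targ_neq0 a b z))) (hasdZ (a%:R * pii) hE).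
by eexists; exact: (hasdD h1 h2).
Qed.

Lemma clim_prod n (f : 'I_n -> C -> C) z : (forall i, ccont (f i) z) ->
  ccont (fun w => \prod_i f i w) z.
Proof.
elim: n f => [|n ih] f hf.
  by rewrite /ccont; under eq_fun do rewrite big_ord0; rewrite big_ord0; exact: clim_cst.
rewrite /ccont; under eq_fun do rewrite big_ord_recl.
rewrite big_ord_recl; apply: climM; first exact: hf.
by apply: (ih (fun i => f (lift ord0 i))) => i; exact: hf.
Qed.

Lemma clim_cabs_le f h (k : R) z l m : 0 < k -> clim f z l -> clim h z m ->
  (\forall w \near z^', k * cabs (f w) <= cabs (h w)) -> k * cabs l <= cabs m.
Proof.
move=> k0 /climP hf /climP hh /dnearC[r r0 hr]; apply/ler_addgt0Pr => e e0.
have e20 : 0 < e / 2 by rewrite divr_gt0.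
have [r1 r10 h1] := hf (e / 2 / k) (divr_gt0 e20 k0).
have [r2 r20 h2] := hh (e / 2) e20.
pose t : R := Num.min r (Num.min r1 r2) / 2.
have m0 : 0 < Num.min r (Num.min r1 r2) by rewrite !lt_min r0 r10 r20.
have t0 : 0 < t by rewrite divr_gt0.
have [w wz wt] : exists2 w, w != z & cabs (w - z) = t.
  exists (z + t%:C); last by rewrite addrC addKr cabs_real gtr0_norm.
  by rewrite -subr_eq0 addrC addKr -cabs_eq0 cabs_real normr_eq0 gt_eqF.
have tm : t < Num.min r (Num.min r1 r2) by rewrite ltr_pdivrMr // ltr_pMr // ltr1n.
move: (tm); rewrite !lt_min => /and3P[tr tr1 tr2].
have a1 := h1 w wz; rewrite wt in a1; have {}a1 := a1 tr1.
have a2 := h2 w wz; rewrite wt in a2; have {}a2 := a2 tr2.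
have a3 := hr w wz; rewrite wt in a3; have {}a3 := a3 tr.
move: a1; rewrite ltr_pdivlMr // => a1.
have b1 := cabsB l (f w); rewrite (cabsBC l) in b1.
have b2 := cabsB (h w) m.
have b3 : k * (cabs l - cabs (f w)) <= k * cabs (f w - l) by rewrite ler_wpM2l // ltW.
lra.
Qed.

Lemma qpow_neq1 n : 1 - qq ^+ n.+1 != 0.
Proof.
rewrite subr_eq0 eq_sym; apply/eqP => h.
have := cabsX qq n.+1; rewrite h cabs1 => /esym/eqP.
by rewrite lt_eqF // exprn_ilt1 ?cabs_ge0 // qq_lt1.
Qed.

(** In theta_lower only the factor 1 + q/s of the finite product vanishes at z
    = 0, and it does so to first order; dividing by w and letting w tend to 0
    bounds the derivative from below. *)
Lemma dth1_neq0 : dtht true true 0 != 0.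
Proof.
have E0 : E 0 = 1 by rewrite EE mulr0 cexp0.
have q0 := qq_neq0.
have s00 : targ true true 0 = - qq by rewrite /targ E0 expr1n mulr1 /eta expr1 mulN1r.
have lo := @theta_lower R qq qq_lt1 q0 (2 * (1 + cabs qq + (cabs qq)^-1)).
have cq : 0 < cabs qq by rewrite cabs_gt0.
have cqV : 0 < (cabs qq)^-1 by rewrite invr_gt0.
have [|J [c c0 h]] := lo; first by lra.
have Ts0 : Th (- qq) = 0.
  by have := th1_0; rewrite /tht -/(targ _ _ _) s00 E0 expr1n mul1r.
(* with an empty product Thb would not vanish at - q *)
case: J h => [|J] h.
  have := h (- qq); rewrite -ThE Ts0 /jprod big_ord0 cabs1 cabs0 mulr1 oppr_eq0 q0.
  rewrite invrN !cabsN cabsV => /(_ isT) H; suff : c <= 0 by lra.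
  by apply: H; lra.
(* the finite product without the factor 1 + q / s, which vanishes at s = - q *)
pose G z := (1 + qq * targ true true z) * \prod_(j < J)
  ((1 + qq ^+ (2 * j.+1 + 1) * targ true true z) *
   (1 + qq ^+ (2 * j.+1 + 1) * (targ true true z)^-1)).
have tc := hasd_cont (hasd_targ true true 0).
have t0 := targ_neq0 true true 0.
have k1 (k : C) : ccont (fun w => 1 + k * targ true true w) 0.
  exact: (climD (clim_cst 1 0) (climM (clim_cst k 0) tc)).
have k2 (k : C) : ccont (fun w => 1 + k * (targ true true w)^-1) 0.
  exact: (climD (clim_cst 1 0) (climM (clim_cst k 0) (climV t0 tc))).
have k3 (j : 'I_J) : ccont (fun z => (1 + qq ^+ (2 * j.+1 + 1) * targ true true z) *
   (1 + qq ^+ (2 * j.+1 + 1) * (targ true true z)^-1)) 0.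
  exact: (climM (k1 _) (k2 _)).
have Gc : ccont G 0 by exact: (climM (k1 qq) (clim_prod k3)).
have G0 : G 0 != 0.
  rewrite /G s00 mulf_neq0 //; first by rewrite mulrN -expr2 qpow_neq1.
  apply/prodf_neq0 => j _; rewrite invrN !mulrN mulf_neq0 //.
    by rewrite -exprSr addn1 -addn1 addn1 qpow_neq1.
  by rewrite addn1 exprSr mulfK // mulnS addSn qpow_neq1.
have pii0 : pii != 0 by rewrite mulf_neq0 ?cpi_neq0 ?i_neq0.
have hnum : hasd (fun w => E w + - E (- w)) 0 (2 * pii).
  have h1 := hasd_comp (hasdN (hasd_id 0)) (hasd_E (- 0)).
  apply: (hasd_eq (hasdD (hasd_E 0) (hasdN h1))).
  by rewrite oppr0 E0; ring.
have lim1 : clim (fun w => (E w + - E (- w)) / w * G w) 0 (2 * pii * G 0).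
  apply: climM Gc; move/hasdE : hnum; apply: clim_eq; apply: nearW => w.
  have -> : E w + - E (- w) - (E 0 + - E (- 0)) = E w + - E (- w) by rewrite oppr0; ring.
  by rewrite subr0.
have lim2 : clim (fun w => th1 w / w) 0 (dtht true true 0).
  move/hasdE : (hasd_tht true true 0); apply: clim_eq; apply: nearW => w.
  by rewrite th1_0 !subr0.
have : c * cabs (2 * pii * G 0) <= cabs (dtht true true 0).
  apply: (clim_cabs_le c0 lim1 lim2).
  have q20 : 0 < cabs qq / 2 by rewrite divr_gt0.
  have /climP /(_ _ q20) [r r0 hr] := tc.
  apply/dnearC; exists r => // w w0 /(hr w w0); rewrite s00 opprK => ht.
  set s := targ true true w in ht *.
  have s0 : s != 0 by exact: targ_neq0.
  have s1 : cabs s <= 2 * (1 + cabs qq + (cabs qq)^-1).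
    by have := cabsD (s + qq) (- qq); rewrite addrK cabsN; lra.
  have s2 : cabs s^-1 <= 2 * (1 + cabs qq + (cabs qq)^-1).
    have : cabs qq / 2 <= cabs s.
      have := cabsB qq (s + qq); have -> : qq - (s + qq) = - s by ring.
      by rewrite cabsN; lra.
    rewrite cabsV => hs; apply: le_trans (_ : (cabs qq / 2)^-1 <= _).
      by rewrite lef_pV2 ?posrE ?cabs_gt0 //; lra.
    by rewrite invfM invrK; lra.
  have := h s s0 s1 s2; rewrite -ThE => hh.
  have -> : th1 w / w = E w / w * Th s by rewrite /tht expr1 mulrAC.
  have -> : (E w + - E (- w)) / w * G w = E w / w * jprod qq J.+1 s.
    rewrite /jprod big_ord_recl /= muln0 add0n expr1 /G -/s.
    rewrite (_ : \prod_(i < J) _ = \prod_(i < J) ((1 + qq ^+ (2 * bump 0 i + 1) * s) *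
       (1 + qq ^+ (2 * bump 0 i + 1) / s))) //.
    move: (\prod_(i < J) _) => Pr; rewrite EN.
    have -> : E w - (E w)^-1 = E w * (1 + qq / s).
      by rewrite /s /targ /eta !expr1; move: (E w) (E_neq0 w) => x x0; field; rewrite x0 q0.
    by ring.
  rewrite !(cabsM (E w / w)) mulrCA ler_wpM2l ?cabs_ge0 //.
apply: contraTneq => ->; rewrite cabs0 -ltNge mulr_gt0 // cabs_gt0.
exact: (mulf_neq0 (mulf_neq0 _ pii0) G0).
Qed.

End Theta.

(** * Integration of complex curves *)

Section RealIntegral.
Variable R : realType.
Implicit Types (f g : R -> R) (a b c : R).

Definition Rint f a b : R := (\int[lebesgue_measure]_(x in `[a, b]) f x)%R.

Lemma cont_integrable f a b : continuous f ->
  lebesgue_measure.-integrable `[a, b] (EFin \o f).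
Proof.
move=> fc; apply: continuous_compact_integrable; first exact: segment_compact.
exact: continuous_subspaceT.
Qed.

Lemma Rint_split f a b c : continuous f -> a <= b -> b <= c ->
  Rint f a c = Rint f a b + Rint f b c.
Proof.
move=> fc ab bc; apply/eqP; rewrite addrC -subr_eq; apply/eqP.
rewrite /Rint Rintegral_itvB ?bnd_simp //; last exact: cont_integrable.
rewrite Rintegral_itv_obnd_cbnd //.
by apply: integrableS (cont_integrable b c fc) => //; apply: subset_itvr; rewrite bnd_simp.
Qed.

Lemma Rint_cst (k : R) a b : a <= b -> Rint (fun=> k) a b = k * (b - a).
Proof.
move=> ab; rewrite /Rint Rintegral_cst //=; congr (_ * _).
have -> : lebesgue_measure (`[a, b] : set (measurableTypeR R)) = (b - a)%:E.
  rewrite lebesgue_measure_itv /= lte_fin.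
  case: ltP => // h; suff -> : a = b by rewrite subrr.
  by apply/eqP; rewrite eq_le ab h.
by [].
Qed.

Lemma RintD f g a b : continuous f -> continuous g ->
  Rint (fun x => f x + g x) a b = Rint f a b + Rint g a b.
Proof. by move=> fc gc; apply: RintegralD => //; exact: cont_integrable. Qed.

Lemma RintZ f (k : R) a b : continuous f -> Rint (fun x => k * f x) a b = k * Rint f a b.
Proof. by move=> fc; apply: RintegralZl => //; exact: cont_integrable. Qed.

Lemma Rint_bound f (M : R) a b : a <= b -> continuous f ->
  (forall x, a <= x <= b -> `|f x| <= M) -> `|Rint f a b| <= M * (b - a).
Proof.
move=> ab fc h; rewrite -Rint_cst // /Rint.
apply: (le_trans (le_normr_Rintegral _ _)) => //; first exact: cont_integrable.
apply: le_Rintegral => //; try exact: cont_integrable.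
- by apply: cont_integrable => x; apply: continuous_comp; [exact: fc | exact: norm_continuous].
- by apply: cont_integrable => x; exact: cst_continuous.
Qed.

Lemma Rint_id a b : a <= b -> Rint (fun x => x) a b = (b ^+ 2 - a ^+ 2) / 2.
Proof.
rewrite le_eqVlt => /orP[/eqP ->|ab].
  by rewrite subrr mul0r /Rint set_itv1 Rintegral_set1.
have dF (x : R) : is_derive x 1 (fun t : R => t ^+ 2 / 2) x.
  have -> : (fun t : R => t ^+ 2 / 2) = 2^-1 \*: ((@id R) * (@id R)).
    by apply/funext => t; rewrite /= mulrC expr2.
  by apply: is_derive_eq; rewrite /GRing.scale /=; field.
rewrite /Rint /Rintegral.
have -> : (\int[lebesgue_measure]_(x in `[a, b]) x%:E = (b ^+ 2 / 2)%:E - (a ^+ 2 / 2)%:E)%E.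
  apply: (@continuous_FTC2 _ (fun x => x) (fun t => t ^+ 2 / 2)) => //.
  - by apply: continuous_subspaceT => x; exact: cvg_id.
  - have cF : continuous (fun t : R => t ^+ 2 / 2).
      by move=> x; apply: differentiable_continuous; apply/derivable1_diffP; have [] := dF x.
    split.
    + by move=> x _; have [] := dF x.
    + by apply: cvg_at_right_filter; exact: cF.
    + by apply: cvg_at_left_filter; exact: cF.
  by move=> x _; rewrite derive1E; have [_ ->] := dF x.
by rewrite -EFinB /=; field.
Qed.

End RealIntegral.

Section ComplexIntegral.
Variable R : realType.
Local Notation C := R[i].
Implicit Types (g k : R -> C) (a b c : R).

(** Continuity of curves, coordinate by coordinate because the integral is. *)
Definition curve_cont g := continuous (fun t => complex.Re (g t)) /\
  continuous (fun t => complex.Im (g t)).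

Definition cint g a b : C := Rint (fun t => complex.Re (g t)) a b +i*
  Rint (fun t => complex.Im (g t)) a b.

Lemma curve_contP g : (forall t (e : R), 0 < e -> exists2 r : R, 0 < r &
   forall u, `|u - t| < r -> cabs (g u - g t) < e) -> curve_cont g.
Proof.
move=> h; split=> t; apply/cvgrPdist_lt => e e0; have [r r0 hr] := h t e e0;
  apply/nbhs_normP; exists r => // u /=; rewrite distrC => /hr; apply: le_lt_trans;
  rewrite distrC -raddfB /=; [exact: cabs_Re | exact: cabs_Im].
Qed.

Lemma cint_split g a b c : curve_cont g -> a <= b -> b <= c ->
  cint g a c = cint g a b + cint g b c.
Proof.
move=> [g1 g2] ab bc; rewrite /cint (Rint_split g1 ab bc) (Rint_split g2 ab bc).
by [].
Qed.

Lemma cint_deg g a : curve_cont g -> cint g a a = 0.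
Proof.
move=> gc; have := cint_split gc (lexx a) (lexx a).
by move=> /eqP; rewrite -[X in X == _]addr0 (inj_eq (addrI _)) eq_sym => /eqP.
Qed.

Lemma ReD (x y : C) : complex.Re (x + y) = complex.Re x + complex.Re y.
Proof. by case: x y => [? ?] [? ?]. Qed.

Lemma ImD (x y : C) : complex.Im (x + y) = complex.Im x + complex.Im y.
Proof. by case: x y => [? ?] [? ?]. Qed.

Lemma cintD g k a b : curve_cont g -> curve_cont k ->
  cint (fun t => g t + k t) a b = cint g a b + cint k a b.
Proof.
move=> [g1 g2] [k1 k2]; apply/eqP; rewrite eq_complex /=.
have e1 := RintD a b g1 k1; have e2 := RintD a b g2 k2.
by apply/andP; split; apply/eqP; [rewrite -e1 | rewrite -e2];
  apply: eq_Rintegral => t _; rewrite ?ReD ?ImD.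
Qed.

Lemma cint_bound g (M : R) a b : curve_cont g -> a <= b ->
  (forall t, a <= t <= b -> cabs (g t) <= M) -> cabs (cint g a b) <= 2 * M * (b - a).
Proof.
move=> [g1 g2] ab h; apply: (le_trans (cabs_le _)) => /=.
have h1 := Rint_bound ab g1 (fun t ht => le_trans (cabs_Re _) (h t ht)).
have h2 := Rint_bound ab g2 (fun t ht => le_trans (cabs_Im _) (h t ht)).
lra.
Qed.

Lemma cint_affine (x y : C) a b : a <= b ->
  cint (fun t => x + y * t%:C) a b = x * (b - a)%:C + y * ((b ^+ 2 - a ^+ 2) / 2)%:C.
Proof.
move=> ab.
have aff (u v : R) : Rint (fun t => u + v * t) a b = u * (b - a) + v * ((b ^+ 2 - a ^+ 2) / 2).
  have c1 : continuous (fun _ : R => u) by move=> t; exact: cst_continuous.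
  have c2 : continuous (fun t : R => t) by move=> t; exact: cvg_id.
  have c3 : continuous (fun t : R => v * t).
    by move=> t; apply: cvgM; [exact: cvg_cst | exact: cvg_id].
  by rewrite (RintD _ _ c1 c3) (RintZ _ _ _ c2) Rint_cst // Rint_id.
case: x y => [x1 x2] [y1 y2]; rewrite /cint.
rewrite (_ : (fun t => complex.Re _) = fun t => x1 + y1 * t); last first.
  by apply/funext => t /=; ring.
rewrite (_ : (fun t => complex.Im _) = fun t => x2 + y2 * t); last first.
  by apply/funext => t /=; ring.
by rewrite !aff; apply/eqP; rewrite eq_complex /=; apply/andP; split; apply/eqP; ring.
Qed.

Lemma curve_cont_affine (x y : C) : curve_cont (fun t : R => x + y * t%:C).
Proof.
apply: curve_contP => t e e0; exists (e / (cabs y + 1)).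
  by rewrite divr_gt0 // ltr_wpDl ?cabs_ge0.
move=> u hu; have -> : x + y * u%:C - (x + y * t%:C) = y * (u - t)%:C.
  by rewrite rmorphB /=; ring.
rewrite cabsM cabs_real; move: hu; rewrite ltr_pdivlMr ?ltr_wpDl ?cabs_ge0 //.
by have := normr_ge0 (u - t); nra.
Qed.

End ComplexIntegral.

(** * Cauchy theorem for parallelograms *)

Section Bisection.
Variable R : realType.
Implicit Types (a b c d s t : R) (P : R -> R -> R -> R -> Prop).

Lemma midpointP a b : a <= b -> exists m, [/\ (a + b) / 2 = m, a <= m, m <= b,
  m - a = (b - a) / 2 & b - m = (b - a) / 2].
Proof. by move=> ab; exists ((a + b) / 2); split=> //; lra. Qed.

(** If P failed, it would fail on one of the quarters, and so on; the nested
    rectangles shrink to a point, where the local hypothesis is contradicted. *)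
Lemma bisection P (a0 a1 b0 b1 : R) : a0 <= a1 -> b0 <= b1 ->
  (forall a a' b b', a <= a' -> b <= b' ->
     P a ((a + a') / 2) b ((b + b') / 2) -> P ((a + a') / 2) a' b ((b + b') / 2) ->
     P a ((a + a') / 2) ((b + b') / 2) b' -> P ((a + a') / 2) a' ((b + b') / 2) b' ->
     P a a' b b') ->
  (forall s t, a0 <= s <= a1 -> b0 <= t <= b1 -> exists2 r : R, 0 < r &
     forall a a' b b', a0 <= a -> a' <= a1 -> b0 <= b -> b' <= b1 ->
     a <= s <= a' -> b <= t <= b' -> a' - a < r -> b' - b < r -> P a a' b b') ->
  P a0 a1 b0 b1.
Proof.
move=> ha hb split4 loc; apply: contrapT => NP.
pose Q := (R * R * R * R)%type.
pose bad (x : Q) := [/\ x.1.1.1 <= x.1.1.2, x.1.2 <= x.2 & ~ P x.1.1.1 x.1.1.2 x.1.2 x.2].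
pose half (x y : Q) := [/\ x.1.1.1 <= y.1.1.1, y.1.1.2 <= x.1.1.2, x.1.2 <= y.1.2, y.2 <= x.2
  & y.1.1.2 - y.1.1.1 = (x.1.1.2 - x.1.1.1) / 2 /\ y.2 - y.1.2 = (x.2 - x.1.2) / 2].
(* when P fails on a rectangle, it fails on one of the quarters *)
have step (x : Q) : exists y, bad x -> bad y /\ half x y.
  case: x => [[[a a'] b] b']; have [[/= aa bb NPx]|] := pselect (bad (a, a', b, b')); last first.
    by move=> nb; exists (a, a', b, b').
  have [m [e1 e2 e3 e4 e5]] := midpointP aa; have [k [d1 d2 d3 d4 d5]] := midpointP bb.
  have := split4 _ _ _ _ aa bb; rewrite e1 d1 => {}split4.
  have [h1|h1] := pselect (P a m b k); last by exists (a, m, b, k) => _; split; split.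
  have [h2|h2] := pselect (P m a' b k); last by exists (m, a', b, k) => _; split; split.
  have [h3|h3] := pselect (P a m k b'); last by exists (a, m, k, b') => _; split; split.
  have [h4|h4] := pselect (P m a' k b'); last by exists (m, a', k, b') => _; split; split.
  by case: NPx; apply: split4.
have [next nextP] := choice step.
pose x n := iter n next (a0, a1, b0, b1).
have xbad n : bad (x n).
  by elim: n => [|n /nextP[]]; [split|].
have xhalf n : half (x n) (x n.+1) by have [] := nextP _ (xbad n).
pose A n := (x n).1.1.1; pose A' n := (x n).1.1.2; pose B n := (x n).1.2; pose B' n := (x n).2.
have AA n m : (n <= m)%N -> A n <= A m /\ A' m <= A' n.
  elim: m => [|m ih]; first by rewrite leqn0 => /eqP ->.
  rewrite leq_eqVlt => /orP[/eqP ->//|]; rewrite ltnS => /ih [h1 h2].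
  by have [h3 h4 _ _ _] := xhalf m; split; [apply: le_trans h1 _ | apply: le_trans h2].
have BB n m : (n <= m)%N -> B n <= B m /\ B' m <= B' n.
  elim: m => [|m ih]; first by rewrite leqn0 => /eqP ->.
  rewrite leq_eqVlt => /orP[/eqP ->//|]; rewrite ltnS => /ih [h1 h2].
  by have [_ _ h3 h4 _] := xhalf m; split; [apply: le_trans h1 _ | apply: le_trans h2].
have Ale n m : A n <= A' m.
  have [nm|/ltnW mn] := leqP n m.
    by have [h1 _] := AA _ _ nm; have [h2 _ _] := xbad m; apply: le_trans h1 h2.
  by have [_ h1] := AA _ _ mn; have [h2 _ _] := xbad n; apply: le_trans h2 h1.
have Ble n m : B n <= B' m.
  have [nm|/ltnW mn] := leqP n m.
    by have [h1 _] := BB _ _ nm; have [_ h2 _] := xbad m; apply: le_trans h1 h2.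
  by have [_ h1] := BB _ _ mn; have [_ h2 _] := xbad n; apply: le_trans h2 h1.
have nest (F F' : nat -> R) : (forall n m, F n <= F' m) -> exists s, forall n, F n <= s <= F' n.
  move=> h; exists (sup (range F)) => n.
  have hs : has_sup (range F) by split; [exists (F 0%N), 0%N|exists (F' 0%N) => _ [m _ <-]].
  apply/andP; split; first by apply: ub_le_sup; [case: hs|exists n].
  by apply: ge_sup; [case: hs|move=> _ [m _ <-]].
have [s hs] := nest _ _ Ale; have [t ht] := nest _ _ Ble.
have [r r0 hr] := loc s t (hs 0%N) (ht 0%N).
have wA n : A' n - A n = (a1 - a0) / 2 ^+ n /\ B' n - B n = (b1 - b0) / 2 ^+ n.
  elim: n => [|n [ih1 ih2]]; first by rewrite expr0 !divr1.
  have [_ _ _ _ [h1 h2]] := xhalf n; rewrite /A' /A /B' /B h1 h2.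
  by rewrite -/(A' n) -/(A n) -/(B' n) -/(B n) ih1 ih2 exprS !invfM; split; ring.
have sm (w : R) : 0 <= w -> exists n0, forall n, (n0 <= n)%N -> w / 2 ^+ n < r.
  move=> w0; have h : (fun n => w * 2^-1 ^+ n) @ \oo --> (0 : R).
    rewrite -[X in _ --> X](mulr0 w); apply: (cvgM (cvg_cst _)); apply: cvg_expr.
    by rewrite ger0_norm ?invr_ge0 // invf_lt1 // ltr1n.
  move/cvgrPdist_lt : h => /(_ _ r0)[n0 _ hn]; exists n0 => n /hn /=.
  by rewrite sub0r normrN exprVn => /(le_lt_trans (ler_norm _)).
have [n1 h1] := sm (a1 - a0) (ltac:(lra)); have [n2 h2] := sm (b1 - b0) (ltac:(lra)).
pose n := maxn n1 n2; have [_ _] := xbad n; apply; apply: hr => //.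
- by have [] := AA 0%N n (leq0n _).
- by have [] := AA 0%N n (leq0n _).
- by have [] := BB 0%N n (leq0n _).
- by have [] := BB 0%N n (leq0n _).
- exact: hs.
- exact: ht.
- by have [e _] := wA n; rewrite -/(A' n) -/(A n) e h1 // leq_maxl.
- by have [_ e] := wA n; rewrite -/(B' n) -/(B n) e h2 // leq_maxr.
Qed.

End Bisection.

Section Goursat.
Variables (R : realType) (tau : R[i]).
Local Notation C := R[i].
Hypothesis htau : 0 < complex.Im tau.
Implicit Types (f g : C -> C) (a b s t : R).

(** Coordinates with respect to the basis 1, tau, in which period
    parallelograms are rectangles. *)
Definition pt s t : C := s%:C + t%:C * tau.

Lemma pt_dist s t s' t' : cabs (pt s t - pt s' t') <= `|s - s'| + `|t - t'| * cabs tau.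
Proof.
have -> : pt s t - pt s' t' = (s - s')%:C + (t - t')%:C * tau.
  by rewrite /pt !rmorphB /=; ring.
by apply: le_trans (cabsD _ _) _; rewrite cabsM !cabs_real.
Qed.

Lemma pt_Re s t : complex.Re (pt s t) = s + t * complex.Re tau.
Proof. by rewrite /pt; case: tau => x y /=; ring. Qed.

Lemma pt_Im s t : complex.Im (pt s t) = t * complex.Im tau.
Proof. by rewrite /pt; case: tau => x y /=; ring. Qed.

Lemma pt_inj s t s' t' : pt s t = pt s' t' -> s = s' /\ t = t'.
Proof.
move=> h; have := pt_Im s t; rewrite h pt_Im => /(mulIf (lt0r_neq0 htau)) tt.
by have := pt_Re s t; rewrite h pt_Re tt => /addIr.
Qed.

Definition contour f a a' b b' : C :=
  cint (fun s => f (pt s b)) a a' + tau * cint (fun t => f (pt a' t)) b b'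
  - cint (fun s => f (pt s b')) a a' - tau * cint (fun t => f (pt a t)) b b'.

Definition centire f := forall z, ccont f z.

Lemma curve_h f t : centire f -> curve_cont (fun s => f (pt s t)).
Proof.
move=> fc; apply: curve_contP => s e e0; have /ccontP /(_ _ e0) [r r0 hr] := fc (pt s t).
exists r => // u hu; apply: hr; apply: le_lt_trans (pt_dist _ _ _ _) _.
by rewrite subrr normr0 mul0r addr0.
Qed.

Lemma curve_v f s : centire f -> curve_cont (fun t => f (pt s t)).
Proof.
move=> fc; apply: curve_contP => t e e0; have /ccontP /(_ _ e0) [r r0 hr] := fc (pt s t).
have ct : 0 < cabs tau + 1 by rewrite ltr_wpDl ?cabs_ge0.
exists (r / (cabs tau + 1)); first by rewrite divr_gt0.
move=> u; rewrite ltr_pdivlMr // => hu; apply: hr; apply: le_lt_trans (pt_dist _ _ _ _) _.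
rewrite subrr normr0 add0r; apply: le_lt_trans hu.
by rewrite ler_wpM2l //; lra.
Qed.

Lemma contour_splith f a a' a'' b b' : centire f -> a <= a' -> a' <= a'' ->
  contour f a a'' b b' = contour f a a' b b' + contour f a' a'' b b'.
Proof.
move=> fc h h'; rewrite /contour (cint_split (curve_h b fc) h h') (cint_split (curve_h b' fc) h h').
by do ![move: (cint _ _ _) => ?]; ring.
Qed.

Lemma contour_splitv f a a' b b' b'' : centire f -> b <= b' -> b' <= b'' ->
  contour f a a' b b'' = contour f a a' b b' + contour f a a' b' b''.
Proof.
move=> fc h h'; rewrite /contour (cint_split (curve_v a fc) h h') (cint_split (curve_v a' fc) h h').
by do ![move: (cint _ _ _) => ?]; ring.
Qed.

Lemma contour_degh f a b b' : centire f -> contour f a a b b' = 0.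
Proof.
by move=> fc; rewrite /contour (cint_deg a (curve_h b fc)) (cint_deg a (curve_h b' fc)); ring.
Qed.

Lemma contour_degv f a a' b : centire f -> contour f a a' b b = 0.
Proof.
by move=> fc; rewrite /contour (cint_deg b (curve_v a fc)) (cint_deg b (curve_v a' fc)); ring.
Qed.

Lemma contour_bound f (M : R) a a' b b' : centire f -> a <= a' -> b <= b' ->
  (forall s t, a <= s <= a' -> b <= t <= b' -> cabs (f (pt s t)) <= M) ->
  cabs (contour f a a' b b') <= 4 * M * ((a' - a) + cabs tau * (b' - b)).
Proof.
move=> fc aa bb h.
have h1 := cint_bound (curve_h b fc) aa (fun s hs => h s b hs (ltac:(lra))).
have h2 := cint_bound (curve_h b' fc) aa (fun s hs => h s b' hs (ltac:(lra))).
have h3 := cint_bound (curve_v a fc) bb (fun t ht => h a t (ltac:(lra)) ht).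
have h4 := cint_bound (curve_v a' fc) bb (fun t ht => h a' t (ltac:(lra)) ht).
have h5 := ler_wpM2l (cabs_ge0 tau) h3; have h6 := ler_wpM2l (cabs_ge0 tau) h4.
rewrite /contour.
move: h1 h2 h5 h6; rewrite -!cabsM.
set X := cint _ a a'; set Y := tau * _; set Z := cint _ a a'; set W := tau * _.
move=> h1 h2 h5 h6.
have t1 := cabsD (X + W - Z) (- Y); have t2 := cabsD (X + W) (- Z); have t3 := cabsD X W.
rewrite !cabsN in t1 t2; clearbody X Y Z W; lra.
Qed.

Lemma contourD f g a a' b b' : centire f -> centire g ->
  contour (fun z => f z + g z) a a' b b' = contour f a a' b b' + contour g a a' b b'.
Proof.
move=> fc gc; rewrite /contour (cintD _ _ (curve_h b fc) (curve_h b gc)).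
rewrite (cintD _ _ (curve_h b' fc) (curve_h b' gc)) (cintD _ _ (curve_v a fc) (curve_v a gc)).
by rewrite (cintD _ _ (curve_v a' fc) (curve_v a' gc)); do ![move: (cint _ _ _) => ?]; ring.
Qed.

Lemma contour_affine (x y : C) a a' b b' : a <= a' -> b <= b' ->
  contour (fun z => x + y * z) a a' b b' = 0.
Proof.
move=> aa bb; rewrite /contour.
have H u : (fun s => x + y * pt s u) = (fun s : R => (x + y * (u%:C * tau)) + y * s%:C).
  by apply/funext => s; rewrite /pt; ring.
have V u : (fun t => x + y * pt u t) = (fun t : R => (x + y * u%:C) + (y * tau) * t%:C).
  by apply/funext => t; rewrite /pt; ring.
rewrite !H !V !cint_affine // !(rmorphM, rmorphB, rmorphXn, fmorphV) /=.
by field.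
Qed.

Lemma centire_lin (x y : C) : centire (fun z => x + y * z).
Proof.
move=> z; have := hasd_cont (hasdD (hasd_cst x z) (hasdZ y (hasd_id z))).
by [].
Qed.

Lemma centireD f g : centire f -> centire g -> centire (fun z => f z + g z).
Proof. by move=> fc gc z; exact: (climD (fc z) (gc z)). Qed.

(** Bisection applied to the estimate that the contour is at most e1 times the
    square of the half-perimeter.  Near each point f is affine up to a small
    relative error, and affine functions have zero contour. *)
Lemma goursat_smooth f a a' b b' : centire f -> a <= a' -> b <= b' ->
  (forall s t, a <= s <= a' -> b <= t <= b' -> differentiable f (pt s t)) ->
  contour f a a' b b' = 0.
Proof.
move=> fc aa bb hd; apply/eqP; rewrite -cabs_eq0 eq_le cabs_ge0 andbT.
apply/ler_addgt0Pr => e e0; rewrite add0r.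
pose K := (a' - a) + (b' - b) + 1.
have K0 : 0 < K by rewrite /K; lra.
pose e1 := e / K ^+ 2.
have e10 : 0 < e1 by rewrite divr_gt0 // exprn_gt0.
suff : cabs (contour f a a' b b') <= e1 * ((a' - a) + (b' - b)) ^+ 2.
  move/le_trans; apply; rewrite /e1 mulrAC ler_pdivrMr ?exprn_gt0 // ler_wpM2l ?(ltW e0) //.
  by rewrite lerXn2r ?nnegrE // /K; lra.
apply: (@bisection R (fun a a' b b' => cabs (contour f a a' b b') <=
   e1 * ((a' - a) + (b' - b)) ^+ 2)) => //.
  move=> x x' y y' xx yy h1 h2 h3 h4.
  have [m [m1 m3 m4 e2 e3]] := midpointP xx; have [k [k1 k3 k4 e4 e5]] := midpointP yy.
  move: h1 h2 h3 h4; rewrite m1 k1 => h1 h2 h3 h4.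
  rewrite (contour_splith _ _ fc m3 m4) (contour_splitv _ _ fc k3 k4) (contour_splitv _ _ fc k3 k4).
  move: h1 h2 h3 h4.
  move: (contour f x m y k) (contour f m x' y k) (contour f x m k y') (contour f m x' k y').
  move=> A B A' B' h1 h2 h3 h4.
  have t1 := cabsD (A + A') (B + B'); have t2 := cabsD A A'; have t3 := cabsD B B'.
  rewrite e2 e4 in h1; rewrite e3 e4 in h2; rewrite e2 e5 in h3; rewrite e3 e5 in h4.
  have S : ((x' - x) / 2 + (y' - y) / 2) ^+ 2 = ((x' - x) + (y' - y)) ^+ 2 / 4 by field.
  rewrite S in h1 h2 h3 h4; lra.
move=> s t hs ht.
have [d /hasdE /climP hfd] : exists d, hasd f (pt s t) d by eexists; apply: hasd_ex; exact: hd.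
pose T := 1 + cabs tau; have T0 : 1 <= T by rewrite lerDl cabs_ge0.
pose e2 := e1 / (4 * T ^+ 2).
have e20 : 0 < e2 by rewrite divr_gt0 // mulr_gt0 // exprn_gt0 //; lra.
have [r r0 hr] := hfd _ e20.
exists (r / (2 * T)); first by rewrite divr_gt0 //; lra.
move=> x x' y y' ax xa by_ yb xs yt xr yr.
have xx : x <= x' by lra.
have yy : y <= y' by lra.
(* subtracting the first-order expansion of f at c does not change the contour *)
pose c := pt s t; pose L z := (d * c - f c) + (- d) * z; pose g z := f z + L z.
have Lc : centire L by exact: centire_lin.
have -> : contour f x x' y y' = contour g x x' y y'.
  by rewrite (contourD _ _ _ _ fc Lc) (contour_affine _ _ xx yy) addr0.
have gc : centire g by exact: centireD.
pose D := (x' - x) + (y' - y).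
have D0 : 0 <= D by rewrite /D; lra.
have T00 : 0 <= T by lra.
have TD0 : 0 <= T * D by rewrite mulr_ge0.
have hD : T * D < r.
  move: xr yr; rewrite !ltr_pdivlMr ?mulr_gt0 //; try lra.
  by rewrite /D => h1 h2; lra.
have gb s' t' : x <= s' <= x' -> y <= t' <= y' -> cabs (g (pt s' t')) <= e2 * (T * D).
  move=> hs' ht'; set z := pt s' t'.
  have zc : cabs (z - c) <= T * D.
    apply: le_trans (pt_dist _ _ _ _) _.
    have h1 : `|s' - s| <= x' - x by rewrite ler_norml; lra.
    have h2 : `|t' - t| <= y' - y by rewrite ler_norml; lra.
    have := ler_wpM2r (cabs_ge0 tau) h2; have := cabs_ge0 tau.
    have : 0 <= (x' - x) * cabs tau by rewrite mulr_ge0 ?cabs_ge0 //; lra.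
    by rewrite /T /D; lra.
  have [->|nz] := eqVneq z c.
    rewrite /g /L (_ : f c + _ = 0) ?cabs0; last by ring.
    by rewrite mulr_ge0 // ltW.
  have nz' : z - c != 0 by rewrite subr_eq0.
  have := hr z nz (le_lt_trans zc hD).
  have -> : (f z - f c) / (z - c) - d = g z / (z - c).
    by rewrite /g /L; move: (f z) (f c) => u v; field.
  rewrite cabsM cabsV ltr_pdivrMr ?cabs_gt0 // => /ltW /le_trans; apply.
  by rewrite ler_wpM2l // ltW.
apply: le_trans (contour_bound gc xx yy gb) _.
have h1 : x' - x + cabs tau * (y' - y) <= T * D.
  have := cabs_ge0 tau; have : 0 <= cabs tau * (x' - x) by rewrite mulr_ge0 ?cabs_ge0 //; lra.
  by rewrite /T /D; lra.
have h2 : 0 <= 4 * (e2 * (T * D)).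
  by rewrite (mulr_ge0 _ (mulr_ge0 (ltW e20) TD0)).
apply: le_trans (ler_wpM2l h2 h1) _.
rewrite le_eqVlt; apply/orP; left; apply/eqP; rewrite /e2 -/D; field.
by rewrite gt_eqF //; lra.
Qed.

Lemma small_scale (r e T A : R) : 0 < r -> 0 < e -> 0 < T -> 0 <= A ->
  exists p : R, [/\ 0 < p, T * p < r & A * p <= e].
Proof.
move=> r0 e0 T0 A0; have A1 : 0 < A + 1 by rewrite ltr_wpDl.
have T2 : 0 < 2 * T by rewrite mulr_gt0.
pose p := Num.min (r / (2 * T)) (e / (A + 1)).
have p0 : 0 < p by rewrite lt_min !divr_gt0.
have : p <= r / (2 * T) by rewrite ge_min lexx.
have : p <= e / (A + 1) by rewrite ge_min lexx orbT.
rewrite !ler_pdivlMr // => h1 h2; exists p; split=> //.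
  have := mulr_gt0 p0 T0; lra.
lra.
Qed.

Lemma left_cut a s (p : R) : 0 < p -> a <= s ->
  exists l, [/\ a <= l, l <= s, s - p <= l & l = a \/ l < s].
Proof.
move=> p0 as_; have [h|h] := leP (s - p) a; first by exists a; split=> //; left.
by exists (s - p); split; [exact: ltW|lra|exact: lexx|right; lra].
Qed.

Lemma right_cut a s (p : R) : 0 < p -> s <= a ->
  exists u, [/\ s <= u, u <= a, u <= s + p & u = a \/ s < u].
Proof.
move=> p0 sa; have [h|h] := leP a (s + p); first by exists a; split=> //; left.
by exists (s + p); split; [lra|exact: ltW|exact: lexx|right; lra].
Qed.

(** Cut the parallelogram along two lines on either side of the exceptional
    point in each direction: the outer pieces do not contain it, and the
    inner one is so small that its contour is negligible because f is bounded
    near the point. *)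
Lemma goursat_point f s t a a' b b' : centire f ->
  a <= s <= a' -> b <= t <= b' ->
  (forall s' t', a <= s' <= a' -> b <= t' <= b' -> pt s' t' != pt s t ->
     differentiable f (pt s' t')) ->
  contour f a a' b b' = 0.
Proof.
move=> fc /andP[as_ sa] /andP[bt tb] hd.
have sm u u' v v' : a <= u -> u <= u' -> u' <= a' -> b <= v -> v <= v' -> v' <= b' ->
    (forall s' t', u <= s' <= u' -> v <= t' <= v' -> s' = s -> t' = t -> False) ->
    contour f u u' v v' = 0.
  move=> h1 uu h2 h3 vv h4 h; apply: goursat_smooth => // s' t' hs' ht'.
  have /andP[x1 x2] := hs'; have /andP[y1 y2] := ht'.
  apply: hd; rewrite ?(le_trans h1 x1) ?(le_trans x2 h2) ?(le_trans h3 y1) ?(le_trans y2 h4) //.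
  by apply/eqP => /pt_inj [es et]; exact: (h s' t').
have /ccontP /(_ _ (ltr01)) [r r0 hr] := fc (pt s t).
pose M := cabs (f (pt s t)) + 1.
have M0 : 0 <= M by rewrite addr_ge0 ?cabs_ge0.
pose T := 1 + cabs tau; have T0 : 0 < T by rewrite ltr_wpDr ?cabs_ge0.
apply/eqP; rewrite -cabs_eq0 eq_le cabs_ge0 andbT; apply/ler_addgt0Pr => e e0; rewrite add0r.
have MT0 : 0 <= 8 * M * T by rewrite !mulr_ge0 // ltW.
have [p [p0 pr pe]] := small_scale r0 e0 T0 MT0.
have [l [al ls l2 l3]] := left_cut p0 as_; have [u [su ua u2 u3]] := right_cut p0 sa.
have [m [bm mt m2 m3]] := left_cut p0 bt; have [v [tv vb v2 v3]] := right_cut p0 tb.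
have lu := le_trans ls su; have mv := le_trans mt tv.
have la' := le_trans lu ua; have mb := le_trans mv vb; have bb := le_trans bt tb.
have aa := le_trans as_ sa.
have -> : contour f a a' b b' = contour f l u m v.
  rewrite (contour_splith _ _ fc al la') (contour_splith _ _ fc lu ua).
  rewrite (contour_splitv l u fc bm mb) (contour_splitv l u fc mv vb).
  have -> : contour f a l b b' = 0.
    case: l3 => [->|h]; first exact: contour_degh.
    by apply: sm => // s' t' /andP[_ h1] _ E; move: h1; rewrite E leNgt h.
  have -> : contour f u a' b b' = 0.
    case: u3 => [->|h]; first exact: contour_degh.
    apply: sm => //; first exact: le_trans al lu.
    by move=> s' t' /andP[h1 _] _ E; move: h1; rewrite E leNgt h.
  have -> : contour f l u b m = 0.
    case: m3 => [->|h]; first exact: contour_degv.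
    by apply: sm => // s' t' _ /andP[_ h1] _ E; move: h1; rewrite E leNgt h.
  have -> : contour f l u v b' = 0.
    case: v3 => [->|h]; first exact: contour_degv.
    apply: sm => //; first exact: le_trans bm mv.
    by move=> s' t' _ /andP[h1 _] _ E; move: h1; rewrite E leNgt h.
  by rewrite !add0r !addr0.
have gb s' t' : l <= s' <= u -> m <= t' <= v -> cabs (f (pt s' t')) <= M.
  move=> h1 h2; have -> : f (pt s' t') = (f (pt s' t') - f (pt s t)) + f (pt s t) by ring.
  apply: le_trans (cabsD _ _) _; rewrite addrC lerD2l ltW // hr //.
  apply: le_lt_trans (pt_dist _ _ _ _) (le_lt_trans _ pr).
  have h3 : `|s' - s| <= p by rewrite ler_norml; clear -h1 l2 u2; lra.
  have h4 : `|t' - t| <= p by rewrite ler_norml; clear -h2 m2 v2; lra.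
  have h5 := ler_wpM2r (cabs_ge0 tau) h4; rewrite /T; clear -h3 h5; lra.
apply: le_trans (contour_bound fc lu mv gb) _; apply: le_trans pe.
have h1 : u - l + cabs tau * (v - m) <= 2 * T * p.
  have h2 : cabs tau * (v - m) <= cabs tau * (2 * p).
    by rewrite ler_wpM2l ?cabs_ge0 //; clear -m2 v2; lra.
  rewrite /T; clear -h2 l2 u2; lra.
have := ler_wpM2l (mulr_ge0 (ler0n R 4) M0) h1; move: (u - l + _); clear; move=> X h; lra.
Qed.

(** Bisection again: a small rectangle containing a given point has no
    exceptional point except possibly that one, so goursat_point applies. *)
Lemma goursat f a a' b b' : centire f -> a <= a' -> b <= b' ->
  (forall z, \forall w \near z^', differentiable f w) -> contour f a a' b b' = 0.
Proof.
move=> fc aa bb hd.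
apply: (@bisection R (fun a a' b b' => contour f a a' b b' = 0)) => //.
  move=> x x' y y' xx yy h1 h2 h3 h4.
  have [m [m1 m3 m4 _ _]] := midpointP xx; have [k [k1 k3 k4 _ _]] := midpointP yy.
  rewrite m1 k1 in h1 h2 h3 h4.
  rewrite (contour_splith _ _ fc m3 m4) (contour_splitv _ _ fc k3 k4) (contour_splitv _ _ fc k3 k4).
  by rewrite h1 h2 h3 h4 !addr0.
move=> s t hs ht; have /dnearC [r r0 hr] := hd (pt s t).
have T0 : 0 < 1 + cabs tau by rewrite ltr_wpDr ?cabs_ge0.
exists (r / (1 + cabs tau)); first by rewrite divr_gt0.
move=> x x' y y' _ _ _ _ xs yt; rewrite !ltr_pdivlMr // => xr yr.
apply: (goursat_point fc xs yt) => s' t' hs' ht' nz; apply: hr => //.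
pose D := Num.max (x' - x) (y' - y).
have D1 : x' - x <= D by rewrite le_max lexx.
have D2 : y' - y <= D by rewrite le_max lexx orbT.
have D3 : D * (1 + cabs tau) < r by rewrite /D; case: (leP (x' - x) (y' - y)).
apply: le_lt_trans (pt_dist _ _ _ _) (le_lt_trans _ D3).
have h3 : `|s' - s| <= D by rewrite ler_norml; lra.
have h4 : `|t' - t| <= D by rewrite ler_norml; lra.
by have := ler_wpM2r (cabs_ge0 tau) h4; lra.
Qed.

End Goursat.

(** * The uniqueness principle for quasi-periodic functions *)

Section Removable.
Variable R : realType.
Local Notation C := R[i].
Implicit Types (f g : C -> C) (z w l c d : C).

Lemma near_shift (Q : C -> Prop) z l :
  (\forall y \near (z + l)^', Q y) <-> (\forall y \near z^', Q (y + l)).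
Proof.
split=> /dnearC[r r0 h]; apply/dnearC; exists r => // y yz yr.
  by apply: h; [rewrite (inj_eq (addIr l))|rewrite opprD addrACA subrr addr0].
rewrite -(subrK l y); apply: h; first by rewrite subr_eq.
by rewrite -addrA -opprD (addrC l).
Qed.

Lemma clim_shift f z l m : clim f (z + l) m <-> clim (fun y => f (y + l)) z m.
Proof.
split=> /climP h; apply/climP => e /h [r r0 hr]; exists r => // y yz yr.
  by apply: hr; [rewrite (inj_eq (addIr l))|rewrite opprD addrACA subrr addr0].
rewrite -(subrK l y); apply: hr; first by rewrite subr_eq.
by rewrite -addrA -opprD (addrC l).
Qed.

Lemma near_dnear (Q : C -> Prop) z : (\forall y \near z^', Q y) ->
  \forall y \near z^', \forall w \near y, Q w.
Proof.
move=> /dnearC[r r0 h]; apply/dnearC; exists r => // y yz yr; apply/nearC.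
exists (Num.min (r - cabs (y - z)) (cabs (y - z))).
  by rewrite lt_min subr_gt0 yr cabs_gt0 subr_eq0.
move=> w; rewrite lt_min => /andP[w1 w2]; apply: h.
  by apply: contraTneq w2 => ->; rewrite cabsBC ltxx.
have -> : w - z = (w - y) + (y - z) by ring.
by apply: le_lt_trans (cabsD _ _) _; rewrite -ltrBrDr.
Qed.

(** An isolated removable singularity. *)
Definition nice f z := (exists l, clim f z l) /\ \forall w \near z^', differentiable f w.

Definition cont_ext f z : C := xget 0 (clim f z).

Lemma cont_ext_clim f z : (exists l, clim f z l) -> clim f z (cont_ext f z).
Proof. by move=> [l hl]; rewrite /cont_ext; apply: (xgetPex 0); exists l. Qed.

Lemma clim_cont_ext f z l : clim f z l -> cont_ext f z = l.
Proof. by move=> h; apply: (@clim_unique _ f z) => //; apply: cont_ext_clim; exists l. Qed.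

Lemma diff_cont_ext f z : differentiable f z -> cont_ext f z = f z.
Proof. by move=> /hasd_ex /hasd_cont h; exact: clim_cont_ext. Qed.

Lemma cont_ext_continuous f : (forall z, nice f z) -> centire (cont_ext f).
Proof.
move=> h z; have [hl hd] := h z; rewrite /ccont; have := cont_ext_clim hl; apply: clim_eq.
by apply: filterS hd => w /diff_cont_ext ->.
Qed.

Lemma cont_ext_diff f : (forall z, nice f z) -> forall z, \forall w \near z^', differentiable (cont_ext f) w.
Proof.
move=> h z; have [_ /near_dnear] := h z; apply: filterS => w hw.
have /nearC[r r0 hr] := hw.
have [d hd] : exists d, hasd f w d by eexists; apply: hasd_ex; apply: hr; rewrite subrr cabs0.
suff [] : hasd (cont_ext f) w d by [].
apply: hasd_near hd; apply/nearC; exists r => // y /hr hy; by rewrite diff_cont_ext.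
Qed.

Lemma hasd_shift f z l d : hasd (fun y => f (y + l)) z d <-> hasd f (z + l) d.
Proof.
have H g x k e : hasd g (x + k) e -> hasd (fun y => g (y + k)) x e.
  move=> h; have hk : hasd (fun y => y + k) x 1.
    by apply: (hasd_eq (hasdD (hasd_id x) (hasd_cst k x))); rewrite addr0.
  by apply: (hasd_eq (hasd_comp hk h)); rewrite mulr1.
split; last exact: H.
move=> h; have /(H (fun y => f (y + l)) (z + l) (- l)) : hasd (fun y => f (y + l)) (z + l - l) d.
  by rewrite addrK.
by apply: hasd_ext => y; rewrite subrK.
Qed.

Lemma nice_shift f z l c : c != 0 -> (forall y, f (y + l) = c * f y) -> nice f z <-> nice f (z + l).
Proof.
move=> c0 h; have h' y : f y = c^-1 * f (y + l) by rewrite h mulrA mulVf // mul1r.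
have D y : differentiable f y <-> differentiable f (y + l).
  split=> /hasd_ex hd.
    suff [] : hasd f (y + l) (c * derive1 f y) by [].
    by apply/hasd_shift; apply: hasd_ext (hasdZ c hd) => w; rewrite h.
  suff [] : hasd f y (c^-1 * derive1 f (y + l)) by [].
  by apply: hasd_ext (hasdZ c^-1 (proj2 (hasd_shift _ _ _ _) hd)) => w; rewrite -h'.
split=> -[[m hm] hd]; split.
- exists (c * m); apply/clim_shift; apply: clim_eq (climM (clim_cst c z) hm).
  by apply: nearW => y; rewrite h.
- by apply/near_shift; apply: filterS hd => y /D.
- exists (c^-1 * m); move/clim_shift : hm => hm.
  by apply: clim_eq (climM (clim_cst c^-1 z) hm); apply: nearW => y; rewrite -h'.
have hd' := proj1 (near_shift (fun y => differentiable f y) z l) hd.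
by apply: filterS hd' => y; exact: (proj2 (D y)).
Qed.

(** l'Hopital's rule at a common zero. *)
Lemma clim_div f g z d e : hasd f z d -> hasd g z e -> f z = 0 -> g z = 0 -> e != 0 ->
  clim (fun w => f w / g w) z (d / e).
Proof.
move=> /hasdE hf /hasdE hg f0 g0 e0.
have := climM hf (climV e0 hg); apply: clim_eq; apply/dnearC; exists 1 => // w wz _.
rewrite f0 g0 !subr0 invfM invrK mulrACA -mulrA mulVf ?mulr1 //.
by rewrite subr_eq0.
Qed.

End Removable.

Section Liouville.
Variables (R : realType) (tau : R[i]).
Local Notation C := R[i].
Hypothesis htau : 0 < complex.Im tau.
Implicit Types (z w u : C) (a b : bool) (g : C -> C).
Local Notation tht := (tht tau).
Local Notation th1 := (tht true true).
Local Notation dth1 := (dtht tau true true).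
Local Notation fac := (tfac tau).
Local Notation pii := (cpi R * 'i : C).

(** The zeros of theta1 are the lattice points, and these are simple zeros. *)
Lemma th1_near z : \forall y \near z^', th1 y != 0.
Proof.
have [h0|h0] := eqVneq (th1 z) 0; last first.
  exact: clim_neq0 (hasd_cont (hasd_tht htau true true z)) h0.
have e (c t : C) : c != 0 -> (c * t != 0) = (t != 0).
  by move=> c0; rewrite mulf_eq0 (negbTE c0).
have := @lattice_ind _ tau (fun z => \forall y \near z^', th1 y != 0) _ _ 0 z (th1_eq0 htau h0).
rewrite add0r; apply.
- move=> x; rewrite near_shift; split; apply: filterS => y;
    by rewrite tht_add1 (e _ (th1 y)) // sgn_neq0.
- move=> x; rewrite near_shift; split; apply: filterS => y;
    by rewrite tht_addtau // (e _ (th1 y)) // mulf_neq0 ?tfac_neq0 ?sgn_neq0.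
have /hasdE h := hasd_tht htau true true 0.
have /dnearC[r r0 hr] := clim_neq0 h (dth1_neq0 htau).
apply/dnearC; exists r => // y y0 yr; have := hr y y0 yr.
by rewrite (th1_0 htau) !subr0; apply: contraNneq => ->; rewrite mul0r.
Qed.

Lemma latticeN z : lattice tau z -> lattice tau (- z).
Proof. by move=> [m [n ->]]; exists (- m), (- n); ring. Qed.

Lemma fac_shift z u : fac (z - u / 2) = fac z * E u.
Proof.
have e2 : E (u / 2) ^+ 2 = E u by rewrite -E_nat; congr E; field.
rewrite /tfac ED EN exprMn exprVn e2; have := E_neq0 u; have := E_neq0 z.
by move: (E z) (E u) (qq_neq0 tau) => x y q0 x0 y0; field; rewrite q0 x0 y0.
Qed.

Lemma dth1_add1 z : dth1 (z + 1) = - dth1 z.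
Proof.
have h1 : hasd (fun y => th1 (y + 1)) z (dth1 (z + 1)).
  by apply/hasd_shift; exact: hasd_tht.
have h2 : hasd (fun y => th1 (y + 1)) z (- dth1 z).
  apply: hasd_ext (hasdN (hasd_tht htau true true z)) => y.
  by rewrite tht_add1 /= expr1 mulN1r.
exact: hasd_unique h1 h2.
Qed.

Lemma hasd_fac z : hasd fac z (- (2 * pii) * fac z).
Proof.
have hE := hasd_E z; have hE2 := hasdZ (qq tau) (hasdM hE hE).
have n0 : qq tau * (E z * E z) != 0 by rewrite !mulf_neq0 ?qq_neq0 ?E_neq0.
apply: (hasd_ext (f := fun y => (qq tau * (E y * E y))^-1)) => [y|]; first by rewrite /tfac expr2.
apply: (hasd_eq (hasdV hE2 n0)); rewrite /tfac.
move: (E z) (E_neq0 z) (qq tau) (qq_neq0 tau) => x x0 q q0.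
by field; rewrite x0 q0.
Qed.

Lemma dth1_addtau z : dth1 (z + tau) = - fac z * (dth1 z - 2 * pii * th1 z).
Proof.
have h1 : hasd (fun y => th1 (y + tau)) z (dth1 (z + tau)).
  by apply/hasd_shift; exact: hasd_tht.
have h2 := hasdN (hasdM (hasd_fac z) (hasd_tht htau true true z)).
have h3 : hasd (fun y => th1 (y + tau)) z (- (fac z * dth1 z + th1 z * (- (2 * pii) * fac z))).
  by apply: hasd_ext h2 => y; rewrite tht_addtau //= expr1 mulN1r mulNr.
by rewrite (hasd_unique h1 h3); ring.
Qed.

Lemma E_half_ne a b u : ~ lattice tau u -> tht a b (- (u / 2)) != 0.
Proof.
by move=> hu; rewrite tht_opp // mulf_neq0 ?sgn_neq0 ?tht_half_neq0.
Qed.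

(** For fixed w, the function H below has no poles, since its numerator
    vanishes at w.  The multipliers of g and of the theta quotient are inverse
    to each other, so the first term of H is elliptic, while theta1'/theta1
    contributes - 2 pi i under tau.  The contour integral around a period
    parallelogram then computes to - 2 pi i g(w), and vanishes by goursat. *)
Lemma liouville a b u g : ~ lattice tau u ->
  (forall z, g (z + 1) = (-1) ^+ (~~ a) * g z) ->
  (forall z, g (z + tau) = (-1) ^+ (~~ b) * E (- u) * g z) ->
  (forall z, exists2 w, lattice tau w & nice g (z + w)) ->
  forall w, differentiable g w -> g w = 0.
Proof.
move=> hu g1 g2 gn w gw.
have sN c : (-1) ^+ (~~ c) = - (-1) ^+ c :> C by case: c; rewrite ?expr0 ?expr1 ?opprK.
have gnice z : nice g z.
  have [l hl hn] := gn z.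
  have n1 x : nice g x <-> nice g (x + 1) by apply: nice_shift g1; exact: sgn_neq0.
  have n2 x : nice g x <-> nice g (x + tau).
    by apply: nice_shift g2; rewrite mulf_neq0 ?sgn_neq0 ?E_neq0.
  by have := lattice_ind n1 n2 (latticeN hl) hn; rewrite addrK.
pose B := tht a b (- (u / 2)); have B0 : B != 0 by exact: E_half_ne.
(* chosen so that the numerator N of H vanishes at w *)
pose A := dth1 0 / B.
pose N z := g z * (A * tht a b (z - w - u / 2)) - g w * dth1 (z - w).
pose H z := N z / th1 (z - w).
pose c : C := 2 * pii * g w.
(* g and the theta quotient have inverse multipliers *)
have H1 z : H (z + 1) = H z.
  rewrite /H /N g1 sN (addrAC z 1) (addrAC (z - w)) !tht_add1 dth1_add1 /= expr1 mulN1r.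
  have s2 := eps_sq R a; rewrite invrN.
  move: (tht a b _) (th1 _)^-1 (g z) (g w) (dth1 _) => T t x y D.
  rewrite (_ : _ * (A * ((-1) ^+ a * T)) = - (((-1) ^+ a) ^+ 2 * (x * (A * T)))); last by ring.
  by rewrite s2; ring.
have H2 z : th1 (z - w) != 0 -> H (z + tau) = H z + c.
  move=> t0; rewrite /H /N g2 sN (addrAC z tau) (addrAC (z - w)) !tht_addtau // dth1_addtau.
  rewrite fac_shift EN /= expr1 mulN1r; have f0 := tfac_neq0 tau (z - w).
  have s2 := eps_sq R b; have E0 := E_neq0 u; move: t0.
  rewrite /c; move: (tht a b _) (th1 _) (g z) (g w) (dth1 _) (fac _) f0 (E u) E0.
  move=> T t x y D f f0 e e0 t0.
  rewrite (_ : _ * (A * ((-1) ^+ b * (f * e) * T)) =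
    - (((-1) ^+ b) ^+ 2 * (x * (A * T * f)))); last by field; exact: e0.
  by rewrite s2; field; rewrite t0 f0.
have tn z : \forall y \near z^', th1 (y - w) != 0.
  exact (proj1 (near_shift (fun y => th1 y != 0) z (- w)) (th1_near (z - w))).
have cT z : clim (fun y => th1 (y - w)) z (th1 (z - w)).
  exact: (hasd_cont (proj2 (hasd_shift _ _ _ _) (hasd_tht htau true true (z - w)))).
have hN1 z : exists d, hasd (fun y => A * tht a b (y - w - u / 2)) z d.
  eexists; apply: hasdZ; apply: (proj2 (hasd_shift (fun y => tht a b (y - u / 2)) _ _ _)).
  by apply: (proj2 (hasd_shift _ _ _ _)); exact: hasd_tht.
have hN2 z : exists d, hasd (fun y => - (g w * dth1 (y - w))) z d.
  have [d hd] := holo_dtht htau true true (z - w).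
  by eexists; apply: hasdN; apply: hasdZ; apply: (proj2 (hasd_shift _ _ _ _)); exact: hd.
have hNd z : differentiable g z -> exists d, hasd N z d.
  move=> /hasd_ex hg; have [d1 h1] := hN1 z; have [d2 h2] := hN2 z.
  by eexists; exact: (hasdD (hasdM hg h1) h2).
have Hd z : \forall y \near z^', differentiable H y.
  have [_ hgd] := gnice z; apply: filterS2 (tn z) hgd => y t0 /hNd [d hd].
  have ht := proj2 (hasd_shift th1 y (- w) _) (hasd_tht htau true true (y - w)).
  by have [] := hasdM hd (hasdV ht t0).
have Hw : exists l, clim H w l.
  have [d hd] := hNd w gw.
  have ht := proj2 (hasd_shift th1 w (- w) _) (hasd_tht htau true true (w - w)).
  eexists; apply: (clim_div hd ht); rewrite ?subrr ?(th1_0 htau) ?dth1_neq0 //.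
  rewrite /N subrr sub0r -/B /A; move: (g w) (dth1 0) => x D.
  by field; exact: B0.
have clH1 z : (exists l, clim H z l) <-> (exists l, clim H (z + 1) l).
  split=> -[l hl]; exists l; first apply/clim_shift.
    by apply: clim_eq hl; apply: nearW => y; rewrite H1.
  by move/clim_shift : hl; apply: clim_eq; apply: nearW => y; rewrite H1.
have clH2' z l : clim H z l -> clim H (z + tau) (l + c).
  move=> hl; apply/clim_shift; apply: clim_eq (climD hl (clim_cst c z)).
  by apply: filterS (tn z) => y /H2 ->.
have clH2 z : (exists l, clim H z l) <-> (exists l, clim H (z + tau) l).
  split=> -[l hl]; first by exists (l + c); exact: clH2'.
  exists (l + - c); move/clim_shift : hl => hl; apply: clim_eq (climD hl (clim_cst (- c) z)).
  by apply: filterS (tn z) => y /H2 ->; rewrite addrK.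
have Hnice z : nice H z.
  split; last exact: Hd.
  have [h0|t0] := eqVneq (th1 (z - w)) 0.
    by have := lattice_ind clH1 clH2 (th1_eq0 htau h0) Hw; rewrite addrC subrK.
  have [[l hl] _] := gnice z; have [d1 /hasd_cont h1] := hN1 z; have [d2 /hasd_cont h2] := hN2 z.
  by eexists; exact: (climM (climD (climM hl h1) h2) (climV t0 (cT z))).
pose K := cont_ext H.
have K1 z : K (z + 1) = K z.
  apply: clim_cont_ext; apply/clim_shift; have [/cont_ext_clim hl _] := Hnice z.
  by apply: clim_eq hl; apply: nearW => y; rewrite H1.
have K2 z : K (z + tau) = K z + c.
  by apply: clim_cont_ext; apply: clH2'; have [/cont_ext_clim hl _] := Hnice z.
have Kc : centire K by exact: cont_ext_continuous.
have := @goursat _ _ htau K 0 1 0 1 Kc ler01 ler01 (cont_ext_diff Hnice).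
rewrite /contour.
have -> : (fun t => K (pt tau 1 t)) = (fun t => K (pt tau 0 t)).
  by apply/funext => t; rewrite -(K1 (pt tau 0 t)) /pt rmorph0 rmorph1; congr K; ring.
have -> : (fun s => K (pt tau s 1)) = (fun s => K (pt tau s 0) + c).
  by apply/funext => s; rewrite -(K2 (pt tau s 0)) /pt rmorph0 rmorph1; congr K; ring.
have cc : curve_cont (fun t : R => c + 0 * t%:C) by exact: curve_cont_affine.
have -> : (fun s => K (pt tau s 0) + c) = (fun s => K (pt tau s 0) + (c + 0 * s%:C)).
  by apply/funext => s; rewrite mul0r addr0.
rewrite (cintD _ _ (curve_h tau 0 Kc) cc) cint_affine ?ler01 // mul0r addr0 subr0 mulr1.
move=> h; have c0 : c = 0.
  by move: h; move: (cint _ _ _) (cint _ _ _) => X Y /eqP; rewrite (_ : _ - _ = - c); [rewrite oppr_eq0 => /eqP|ring].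
have n0 : 2 * pii != 0 by rewrite !mulf_neq0 ?cpi_neq0 ?i_neq0.
by apply: (mulfI n0); rewrite mulr0.
Qed.

End Liouville.

(** * Kronecker functions and the Fay identities *)

Section Fay.
Variables (R : realType) (tau : R[i]).
Local Notation C := R[i].
Hypothesis htau : 0 < complex.Im tau.
Implicit Types (x y z w u v : C) (a b c d : bool).
Local Notation tht := (tht tau).
Local Notation th1 := (tht true true).
Local Notation dth1 := (dtht tau true true).
Local Notation fac := (tfac tau).

Definition kron_num a b u y : C := dth1 0 * (tht a b (y + u / 2) / tht a b (u / 2)).

(** Kronecker's function attached to a theta characteristic, normalised to
    have residue 1 at the origin. *)
Definition kron a b u y : C := kron_num a b u y / th1 y.

Lemma kron_num0 a b u : ~ lattice tau u -> kron_num a b u 0 = dth1 0.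
Proof. by move=> hu; rewrite /kron_num add0r mulfV ?mulr1 // tht_half_neq0. Qed.

Lemma hasd_kron_num a b u y : exists e, hasd (kron_num a b u) y e.
Proof.
have h := proj2 (hasd_shift (tht a b) y (u / 2) _) (hasd_tht htau a b (y + u / 2)).
eexists; apply: hasd_ext (hasdZ (dth1 0 / tht a b (u / 2)) h) => w.
by rewrite /kron_num mulrAC mulrA.
Qed.

Lemma hasd_kron a b u y : th1 y != 0 -> exists e, hasd (kron a b u) y e.
Proof.
move=> t0; have [e he] := hasd_kron_num a b u y; eexists.
exact: (hasdM he (hasdV (hasd_tht htau true true y) t0)).
Qed.

Lemma sgnN a : (-1) ^+ (~~ a) = - (-1) ^+ a :> C.
Proof. by case: a; rewrite ?expr0 ?expr1 ?opprK. Qed.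

Lemma kron_add1 a b u y : kron a b u (y + 1) = (-1) ^+ (~~ a) * kron a b u y.
Proof.
rewrite /kron /kron_num (addrAC y) !tht_add1 /= expr1 mulN1r invrN sgnN.
by move: (tht a b _) (tht a b _)^-1 (th1 y)^-1 => X Y Z; ring.
Qed.

Lemma kron_addtau a b u y : kron a b u (y + tau) = (-1) ^+ (~~ b) * E (- u) * kron a b u y.
Proof.
rewrite /kron /kron_num (addrAC y) !tht_addtau // /= expr1 sgnN.
have -> : fac (y + u / 2) = fac y * E (- u) by rewrite -fac_shift mulNr opprK.
have f0 := tfac_neq0 tau y; rewrite !mulN1r mulNr invrN (invfM (fac y)).
move: (tht a b _) (tht a b _)^-1 (th1 y)^-1 (E _) (fac y) f0 => X Y Z e f f0.
by field; exact: f0.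
Qed.

Lemma kron_opp a b u y : kron a b (- u) (- y) = - kron a b u y.
Proof.
rewrite /kron /kron_num mulNr -opprD !tht_opp // /= expr1 mulN1r invrN (invfM ((-1) ^+ (a && b))).
have s0 := sgn_neq0 R (a && b).
move: (tht a b _) (tht a b _)^-1 (th1 y)^-1 => X Y Z.
by field; exact: s0.
Qed.

(** As functions of x both sides have the multipliers of kron a b u.  Their
    difference G can have poles only at 0 and at - y modulo the lattice, where
    the residues of its three terms cancel: at 0 because kron has residue 1,
    at - y because kron is odd under (u, y) -> (- u, - y). *)
Lemma fay a b c d u v x y : ~ lattice tau u -> ~ lattice tau v -> ~ lattice tau (u + v) ->
  ~ lattice tau x -> ~ lattice tau y -> ~ lattice tau (x + y) ->
  kron a b u x * kron c d (u + v) y =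
  kron c d (u + v) (x + y) * kron (a == c) (b == d) (- v) x +
  kron (a == c) (b == d) v y * kron a b u (x + y).
Proof.
move=> hu hv hw hx hy hxy; set w := u + v; set e1 := a == c; set e2 := b == d.
have hvN : ~ lattice tau (- v) by move=> /latticeN; rewrite opprK.
pose G z := kron a b u z * kron c d w y - kron c d w (z + y) * kron e1 e2 (- v) z -
  kron e1 e2 v y * kron a b u (z + y).
suff : G x = 0 by rewrite /G -addrA -opprD => /subr0_eq.
have th1N z : ~ lattice tau z -> th1 z != 0 by move=> hz; apply/eqP => /th1_eq0 h; exact: hz (h htau).
have tx (z : C) : \forall t \near z^', th1 t != 0 by exact: th1_near.
have ty (z : C) : \forall t \near z^', th1 (t + y) != 0.
  exact (proj1 (near_shift (fun t => th1 t != 0) z y) (th1_near htau (z + y))).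
have diffG z : th1 z != 0 -> th1 (z + y) != 0 -> exists k, hasd G z k.
  move=> z0 zy0.
  have [k1 h1] := hasd_kron a b u z0; have [k2 h2] := hasd_kron e1 e2 (- v) z0.
  have [k3 h3'] := hasd_kron c d w zy0; have h3 := proj2 (hasd_shift _ _ _ _) h3'.
  have [k4 h4'] := hasd_kron a b u zy0; have h4 := proj2 (hasd_shift _ _ _ _) h4'.
  have H := hasdD (hasdD (hasdM h1 (hasd_cst (kron c d w y) z)) (hasdN (hasdM h3 h2)))
    (hasdN (hasdZ (kron e1 e2 v y) h4)).
  by eexists; exact: H.
have nearG z : \forall t \near z^', differentiable G t.
  by apply: filterS2 (tx z) (ty z) => t h1 h2; have [k []] := diffG t h1 h2.
have g1 z : G (z + 1) = (-1) ^+ (~~ a) * G z.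
  rewrite /G (addrAC z) !kron_add1.
  have -> : (-1) ^+ (~~ a) = (-1) ^+ (~~ c) * (-1) ^+ (~~ e1) :> C.
    by rewrite /e1; case: (a); case: (c); rewrite ?expr0 ?expr1 ?mulr1 ?mul1r ?mulrNN ?mulr1.
  by ring.
have g2 z : G (z + tau) = (-1) ^+ (~~ b) * E (- u) * G z.
  rewrite /G (addrAC z) !kron_addtau.
  have -> : (-1) ^+ (~~ b) * E (- u) = ((-1) ^+ (~~ d) * E (- w)) * ((-1) ^+ (~~ e2) * E (- - v)) :> C.
    have -> : E (- u) = E (- w) * E (- - v) by rewrite -ED /w; congr E; ring.
    rewrite /e2; move: (E (- w)) (E (- - v)) => X Y.
    by case: (b); case: (d); rewrite /= ?expr0 ?expr1; ring.
  by ring.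
have gn z : exists2 l, lattice tau l & nice G (z + l).
  have [zL|zL] := pselect (lattice tau z).
    exists (- z); first exact: latticeN.
    rewrite subrr; split; last exact: nearG.
    have [k1 h1] := hasd_kron_num a b u 0; have [k2 h2] := hasd_kron_num e1 e2 (- v) 0.
    have y0 : th1 (0 + y) != 0 by rewrite add0r th1N.
    have [k3 h3'] := hasd_kron c d w y0; have h3 := proj2 (hasd_shift _ _ _ _) h3'.
    have [k4 h4'] := hasd_kron a b u y0; have h4 := proj2 (hasd_shift _ _ _ _) h4'.
    have H := hasdD (hasdM h1 (hasd_cst (kron c d w y) 0)) (hasdN (hasdM h3 h2)).
    eexists; apply: clim_eq (climD (clim_div H (hasd_tht htau true true 0) _ (th1_0 htau) (dth1_neq0 htau))
      (hasd_cont (hasdN (hasdZ (kron e1 e2 v y) h4)))).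
      apply: nearW => t; rewrite /G /kron; move: (th1 t)^-1 => T.
      by move: (kron_num a b u t) (kron_num e1 e2 (- v) t) => X Y; ring.
    by rewrite /= !kron_num0 // add0r; ring.
  have [yL|yL] := pselect (lattice tau (z + y)).
    exists (- (z + y)); first exact: latticeN.
    have -> : z - (z + y) = - y by ring.
    split; last exact: nearG.
    have y0 : th1 (- y) != 0 by apply: th1N => /latticeN; rewrite opprK.
    have yy : - y + y = 0 by rewrite addNr.
    have [k1' h1'] := hasd_kron_num a b u (- y + y); have h1 := proj2 (hasd_shift _ _ _ _) h1'.
    have [k2' h2'] := hasd_kron_num c d w (- y + y); have h2 := proj2 (hasd_shift _ _ _ _) h2'.
    have [k3 h3] := hasd_kron e1 e2 (- v) y0; have [k4 h4] := hasd_kron a b u y0.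
    have ht := proj2 (hasd_shift th1 (- y) y _) (hasd_tht htau true true (- y + y)).
    have H := hasdN (hasdD (hasdM h2 h3) (hasdZ (kron e1 e2 v y) h1)).
    eexists; apply: clim_eq (climD (hasd_cont (hasdM h4 (hasd_cst (kron c d w y) (- y))))
      (clim_div H ht _ _ _)); rewrite ?yy ?(th1_0 htau) ?dth1_neq0 //.
      apply: nearW => t; rewrite /G /kron; move: (th1 (t + y))^-1 => T.
      by move: (kron_num a b u _) (kron_num c d w _) => X Y; ring.
    by rewrite !kron_num0 // kron_opp; ring.
  exists 0; first by exists 0, 0; ring.
  rewrite addr0; split; last exact: nearG.
  have [k /hasd_cont hk] := diffG z (th1N _ zL) (th1N _ yL).
  by exists (G z).
have [k [gx _]] := diffG x (th1N _ hx) (th1N _ hxy).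
exact: (liouville htau hu g1 g2 gn gx).
Qed.

End Fay.

(** * The Yang-Baxter equation *)

Section Tensors.
Variable R : realType.
Local Notation C := R[i].
Local Notation M2 := 'M[C]_2.

Lemma lin_sum (U V : lmodType C) (f : U -> V) (I : finType) (c : I -> C) (F : I -> U) :
  linear f -> f (\sum_i c i *: F i) = \sum_i c i *: f (F i).
Proof.
move=> fl; have f0 : f 0 = 0 by have := fl (-1) 0 0; rewrite scaler0 addr0 scaleN1r addNr.
elim/big_rec2 : _ => // i x y _ <-; exact: fl.
Qed.

Lemma tensmx_linl m n p q (B : 'M[C]_(p, q)) : linear (fun A : 'M[C]_(m, n) => A *t B).
Proof. by move=> a A A'; apply/matrixP=> i j; rewrite !mxE mulrDl mulrA. Qed.

Lemma tensmx_linr m n p q (A : 'M[C]_(m, n)) : linear (fun B : 'M[C]_(p, q) => A *t B).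
Proof. by move=> a B B'; apply/matrixP=> i j; rewrite !mxE mulrDr mulrCA. Qed.

Lemma tensmxZl m n p q c (A : 'M[C]_(m, n)) (B : 'M[C]_(p, q)) : (c *: A) *t B = c *: (A *t B).
Proof. by apply/matrixP=> i j; rewrite !mxE mulrA. Qed.

Lemma tensmxZr m n p q c (A : 'M[C]_(m, n)) (B : 'M[C]_(p, q)) : A *t (c *: B) = c *: (A *t B).
Proof. by apply/matrixP=> i j; rewrite !mxE mulrCA. Qed.

Lemma tcoef_tens (A B : M2) i j k l : tcoef (A *t B) i j k l = A i j * B k l.
Proof. by rewrite /tcoef tensmxE. Qed.

Lemma tcoef_lin i j k l : linear (fun r : tensor2 R => tcoef r i j k l : C^o).
Proof. by move=> a r r'; rewrite /tcoef !mxE. Qed.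

(** The tensor r with its two factors inserted into the bilinear map f.  The
    three embeddings into threefold tensors and the contraction with a matrix
    are all of this form. *)
Definition insert (V : lmodType C) (f : M2 -> M2 -> V) (r : tensor2 R) : V :=
  \sum_(i < 2) \sum_(j < 2) \sum_(k < 2) \sum_(l < 2)
    tcoef r i j k l *: f (delta_mx i j) (delta_mx k l).

Lemma insert_lin (V : lmodType C) (f : M2 -> M2 -> V) : linear (insert f).
Proof.
move=> a r r'; rewrite /insert scaler_sumr -big_split; apply: eq_bigr => i _ /=.
rewrite scaler_sumr -big_split; apply: eq_bigr => j _ /=.
rewrite scaler_sumr -big_split; apply: eq_bigr => k _ /=.
rewrite scaler_sumr -big_split; apply: eq_bigr => l _ /=.
by rewrite tcoef_lin scalerDl scalerA.
Qed.

Lemma insert_tens (V : lmodType C) (f : M2 -> M2 -> V) A B :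
  (forall Y, linear (f^~ Y)) -> (forall X, linear (f X)) -> insert f (A *t B) = f A B.
Proof.
move=> f1 f2; have dec (g : M2 -> V) (X : M2) : linear g ->
    g X = \sum_(i < 2) \sum_(j < 2) X i j *: g (delta_mx i j).
  move=> gl; rewrite {1}(matrix_sum_delta X) !pair_bigA /=.
  exact: (lin_sum (fun p : 'I_2 * 'I_2 => X p.1 p.2) (fun p => delta_mx p.1 p.2) gl).
rewrite (dec (f^~ B) A (f1 B)); apply: eq_bigr => i _; apply: eq_bigr => j _.
rewrite (dec (f (delta_mx i j)) B) // scaler_sumr; apply: eq_bigr => k _.
by rewrite scaler_sumr; apply: eq_bigr => l _; rewrite tcoef_tens scalerA.
Qed.

Lemma leg12_lin : linear (@leg12 R).
Proof. exact: (insert_lin (fun X Y => X *t Y *t (1%:M : M2))). Qed.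
Lemma leg13_lin : linear (@leg13 R).
Proof. exact: (insert_lin (fun X Y => X *t (1%:M : M2) *t Y)). Qed.
Lemma leg23_lin : linear (@leg23 R).
Proof. exact: (insert_lin (fun X Y => (1%:M : M2) *t X *t Y)). Qed.

Lemma leg12_tens (A B : M2) : leg12 (A *t B) = A *t B *t (1%:M : M2).
Proof.
apply: (insert_tens (f := fun X Y => X *t Y *t (1%:M : M2))) => X a Y Y'.
  by rewrite tensmx_linl tensmx_linl.
by rewrite tensmx_linr tensmx_linl.
Qed.

Lemma leg13_tens (A B : M2) : leg13 (A *t B) = A *t (1%:M : M2) *t B.
Proof.
apply: (insert_tens (f := fun X Y => X *t (1%:M : M2) *t Y)) => X a Y Y'.
  by rewrite tensmx_linl tensmx_linl.
by rewrite tensmx_linr.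
Qed.

Lemma leg23_tens (A B : M2) : leg23 (A *t B) = (1%:M : M2) *t A *t B.
Proof.
apply: (insert_tens (f := fun X Y => (1%:M : M2) *t X *t Y)) => X a Y Y'.
  by rewrite tensmx_linr tensmx_linl.
by rewrite tensmx_linr.
Qed.

Lemma mulmx_sums (I J : finType) (c : I -> C) (d : J -> C) (F : I -> tensor3 R) (G : J -> tensor3 R) :
  (\sum_i c i *: F i) *m (\sum_j d j *: G j) = \sum_i \sum_j (c i * d j) *: (F i *m G j).
Proof.
rewrite mulmx_suml; apply: eq_bigr => i _; rewrite mulmx_sumr; apply: eq_bigr => j _.
by rewrite -scalemxAl -scalemxAr scalerA.
Qed.

(** The basis of M2 indexed by theta characteristics; the indices are the
    signs by which conjugation with h and with gamma act. *)
Definition pauli (p : bool * bool) : M2 :=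
  match p with
  | (true, true) => 1%:M | (true, false) => mxh R
  | (false, false) => mxsigma R | (false, true) => mxgamma R
  end.

(** The product in (Z/2)^2 with true as the neutral element, which corresponds
    to the product of matrices up to scalars. *)
Definition char_mul (p q : bool * bool) : bool * bool := (p.1 == q.1, p.2 == q.2).

Lemma char_mulKr q : involutive (char_mul^~ q).
Proof. by move: q => [[] []] [[] []]. Qed.

Lemma char_mulKl p : involutive (char_mul p).
Proof. by move: p => [[] []] [[] []]. Qed.

Lemma mulmx_mx2 (a b c d a' b' c' d' : C) : mx2 a b c d *m mx2 a' b' c' d' =
  mx2 (a * a' + b * c') (a * b' + b * d') (c * a' + d * c') (c * b' + d * d').
Proof.
apply/matrixP => i j; rewrite !mxE big_ord_recl big_ord1 !mxE /=.
by case: i => -[|[|//]] ?; case: j => -[|[|//]] ?.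
Qed.

Lemma mx2_1 : 1%:M = mx2 1 0 0 1 :> M2.
Proof.
apply/matrixP => i j; rewrite !mxE.
by case: i => -[|[|//]] ?; case: j => -[|[|//]] ?.
Qed.

Lemma scale_mx2 (k a b c d : C) : k *: mx2 a b c d = mx2 (k * a) (k * b) (k * c) (k * d).
Proof.
apply/matrixP => i j; rewrite !mxE.
by case: i => -[|[|//]] ?; case: j => -[|[|//]] ?.
Qed.

(** The same scalar occurs in all three cyclic products, because the squares
    of the four matrices are 1; this is why the Yang-Baxter equation has one
    common factor in each component. *)
Lemma pauli_mul p q : exists k : C, [/\ pauli p *m pauli q = k *: pauli (char_mul p q),
  pauli q *m pauli (char_mul p q) = k *: pauli p & pauli (char_mul p q) *m pauli p = k *: pauli q].
Proof.
have i2 : 'i * 'i = -1 :> C by rewrite -expr2 sqr_i.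
have [k hk] : exists k : C, k = match p, q with
  | (true, false), (false, true) | (false, true), (false, false)
  | (false, false), (true, false) => 'i
  | (false, true), (true, false) | (false, false), (false, true)
  | (true, false), (false, false) => - 'i
  | _, _ => 1 end by eexists.
exists k; rewrite {}hk; move: p q => [[] []] [[] []];
  rewrite /char_mul /= /mxh /mxsigma /mxgamma ?mx2_1; split;
  by rewrite mulmx_mx2 scale_mx2 ?(mulr0, mul0r, addr0, add0r, mulr1, mul1r, mulrN, mulNr, i2, opprK, oppr0).
Qed.

Lemma leg_mul (f g : tensor2 R -> tensor3 R) (c d : bool * bool -> C) : linear f -> linear g ->
  f (\sum_p c p *: (pauli p *t pauli p)) *m g (\sum_p d p *: (pauli p *t pauli p)) =
  \sum_p \sum_q (c p * d q) *: (f (pauli p *t pauli p) *m g (pauli q *t pauli q)).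
Proof. by move=> fl gl; rewrite (lin_sum _ _ fl) (lin_sum _ _ gl) mulmx_sums. Qed.

(** In each of the three products the component on pauli p, pauli (char_mul p
    q), pauli q receives exactly one contribution. *)
Lemma pauli_AYBE (c1 c2 c3 c4 c5 c6 : bool * bool -> C) :
  (forall p q, c1 p * c2 q = c3 q * c4 (char_mul p q) + c5 (char_mul p q) * c6 p) ->
  let r c : tensor2 R := \sum_p c p *: (pauli p *t pauli p) in
  leg12 (r c1) *m leg23 (r c2) = leg13 (r c3) *m leg12 (r c4) + leg23 (r c5) *m leg13 (r c6).
Proof.
move=> h r.
have L1 := leg_mul c1 c2 leg12_lin leg23_lin.
have L2 := leg_mul c3 c4 leg13_lin leg12_lin; have L3 := leg_mul c5 c6 leg23_lin leg13_lin.
apply: (eq_trans L1); apply/esym/(eq_trans (congr2 +%R L2 L3))/esym => {L1 L2 L3}.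
under [X in _ = X + _]eq_bigr => q _ do rewrite (reindex_inj (inv_inj (char_mulKr q))).
rewrite [X in _ = X + _]exchange_big [X in _ = _ + X]exchange_big /=.
under [X in _ = _ + X]eq_bigr => p _ do rewrite (reindex_inj (inv_inj (char_mulKl p))).
rewrite -big_split; apply: eq_bigr => p _ /=; rewrite -big_split; apply: eq_bigr => q _ /=.
have [k [k1 k2 k3]] := pauli_mul p q.
rewrite !leg12_tens !leg13_tens !leg23_tens !tensmx_mul !mulmx1 !mul1mx.
rewrite k1 k2 k3 tensmxZr !tensmxZl tensmxZr !scalerA -scalerDl; congr (_ *: _).
by rewrite h mulrDl.
Qed.

End Tensors.

Section YangBaxter.
Variables (R : realType) (tau : R[i]).
Local Notation C := R[i].
Hypothesis htau : 0 < complex.Im tau.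
Implicit Types (x y u v : C).

Lemma theta1_deriv0 : derive1 (theta1 tau) 0 = tcst tau true true * dtht tau true true 0.
Proof.
have [_ <-] := hasdZ (tcst tau true true) (hasd_tht htau true true 0).
have e : theta1 tau = (fun z => tcst tau true true * tht tau true true z).
  by apply/funext => z; exact: theta1E.
by rewrite e.
Qed.

Lemma r_ellE x y : r_ell tau x y =
  \sum_p (2^-1 * kron tau p.1 p.2 x y) *: (pauli R p *t pauli R p).
Proof.
have K a b (th : C -> C) : (forall z, th z = tcst tau a b * tht tau a b z) ->
    (2^-1 * (derive1 (theta1 tau) 0 / theta1 tau y)) * (th (y + x / 2) / th (x / 2)) =
    2^-1 * kron tau a b x y.
  move=> h; rewrite theta1_deriv0 (theta1E htau) !h /kron /kron_num.
  have c1 := tcst_neq0 tau true true; have c2 := tcst_neq0 tau a b.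
  move: (tht tau a b _) (tht tau a b _) (tht tau true true _) (tcst _ _ _) c1 (tcst _ _ _) c2.
  move=> X Y Z c c0 d d0; rewrite (invfM d) (invfM c).
  move: X^-1 Z^-1 => X' Z'.
  by field; rewrite c0 d0.
transitivity (\sum_a \sum_b (2^-1 * kron tau a b x y) *: (pauli R (a, b) *t pauli R (a, b))); last first.
  by rewrite pair_bigA; apply: eq_bigr => -[].
rewrite !big_bool /pauli /r_ell.
move: (1%:M *t 1%:M) (mxh R *t _) (mxsigma R *t _) (mxgamma R *t _) => T1 T2 T3 T4.
rewrite !scalerDr !scalerA.
rewrite (K _ _ _ (theta1E htau)) (K _ _ _ (theta2E htau)) (K _ _ _ (theta3E htau)) (K _ _ _ (theta4E htau)).
by rewrite -[LHS]addrA; congr (_ + _); exact: addrC.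
Qed.

Lemma r_ell_AYBE : AYBE (lattice tau) (r_ell tau).
Proof.
move=> u v x y hu hv hw hx hy hxy; rewrite !r_ellE; apply: pauli_AYBE => p q.
have := @fay R tau htau p.1 p.2 q.1 q.2 u v x y hu hv hw hx hy hxy.
move: (kron _ _ _ _ _) (kron _ _ _ _ _) (kron _ _ _ _ _) (kron _ _ _ _ _) (kron _ _ _ _ _) (kron _ _ _ _ _).
by move=> a b c d e f h; rewrite mulrACA h; ring.
Qed.

End YangBaxter.

(** * Simple poles *)

Section MeanValue.
Variable R : realType.
Local Notation C := R[i].
Implicit Types (f g : C -> C) (p z w d : C).

Lemma real_is_derive (f : R -> R) (x d : R) : (forall e : R, 0 < e -> exists2 r : R, 0 < r &
    forall y, `|y - x| < r -> `|f y - f x - d * (y - x)| <= e * `|y - x|) -> is_derive x 1 f d.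
Proof.
move=> h; have cv : (fun t : R => t^-1 *: (f (t *: (1 : R) + x) - f x)) t @[t --> 0^'] --> d.
  apply/cvgrPdist_le => e e0; have [r r0 hr] := h e e0.
  apply/nbhs_normP; exists r => // t /= tr t0.
  rewrite sub0r normrN in tr.
  have tx : t *: (1 : R) + x - x = t by rewrite addrK /GRing.scale /= mulr1.
  have := hr (t *: (1 : R) + x); rewrite tx => /(_ tr) {}hr.
  have -> : d - t^-1 *: (f (t *: (1 : R) + x) - f x) =
    - (t^-1 * (f (t *: (1 : R) + x) - f x - d * t)).
    rewrite {1}/GRing.scale /=; move: (f _) (f x) => a b.
    by field; exact: t0.
  by rewrite normrN normrM normfV mulrC ler_pdivrMr ?normr_gt0.
split; first by rewrite /derivable; apply/cvg_ex; exists d.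
exact: cvg_lim cv.
Qed.

(** Restriction to a segment, seen through a linear functional, reduces the
    mean value inequality to real functions. *)
Lemma line_deriv f c p v (t : R) d : hasd f (p + t%:C * v) d ->
  is_derive t 1 (fun s : R => complex.Re (c * f (p + s%:C * v))) (complex.Re (c * (d * v))).
Proof.
move=> h; have [phi [phic phid hphi]] := hasd_slope h; apply: real_is_derive => e e0.
pose M := cabs c * cabs v + 1.
have M0 : 0 < M by rewrite /M ltr_wpDl // mulr_ge0 ?cabs_ge0.
move/ccontP : phic => /(_ (e / M)); rewrite divr_gt0 // => /(_ isT) [r r0 hr].
pose N := cabs v + 1; have N0 : 0 < N by rewrite /N ltr_wpDl ?cabs_ge0.
exists (r / N); first by rewrite divr_gt0.
move=> s sr; have sv : p + s%:C * v - (p + t%:C * v) = (s - t)%:C * v.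
  by rewrite rmorphB; ring.
have : cabs (phi (p + s%:C * v) - d) < e / M.
  rewrite -phid; apply: hr; rewrite sv cabsM cabs_real.
  move: sr; rewrite ltr_pdivlMr // /N mulrDr mulr1; apply: le_lt_trans.
  by rewrite lerDl normr_ge0.
rewrite ltr_pdivlMr // => hlt.
have -> : complex.Re (c * f (p + s%:C * v)) - complex.Re (c * f (p + t%:C * v)) -
    complex.Re (c * (d * v)) * (s - t) =
    complex.Re (c * ((phi (p + s%:C * v) - d) * ((s - t)%:C * v))).
  have e1 : complex.Re (c * (d * v)) * (s - t) = complex.Re (c * (d * v) * (s - t)%:C).
    by case: (c * (d * v)) => a b /=; rewrite mulr0 subr0.
  rewrite e1 -!raddfB; congr complex.Re; have := hphi (p + s%:C * v); rewrite sv => hp.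
  by rewrite mulrBl -hp; ring.
rewrite (le_trans (cabs_Re _)) // !cabsM cabs_real.
have c0 := cabs_ge0 c; have v0 := cabs_ge0 v; have s0 := normr_ge0 (s - t).
rewrite (_ : _ * _ = (cabs (phi (p + s%:C * v) - d) * (cabs c * cabs v)) * `|s - t|); last by ring.
rewrite ler_wpM2r // (le_trans _ (ltW hlt)) // ler_wpM2l ?cabs_ge0 //.
by rewrite /M lerDl ler01.
Qed.

(** The functional is multiplication by the inverse of f z - f p, which sends
    the increment to 1. *)
Lemma mean_value f df p z (K : R) : 0 <= K ->
  (forall w, cabs (w - p) <= cabs (z - p) -> hasd f w (df w) /\ cabs (df w) <= K) ->
  cabs (f z - f p) <= K * cabs (z - p).
Proof.
move=> K0 h; have [->|D0] := eqVneq (f z - f p) 0.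
  by rewrite cabs0 mulr_ge0 ?cabs_ge0.
pose c := (f z - f p)^-1; pose v := z - p.
have hw (t : R) : 0 <= t <= 1 -> hasd f (p + t%:C * v) (df (p + t%:C * v)) /\ cabs (df (p + t%:C * v)) <= K.
  move=> /andP[t0 t1]; apply: h; rewrite addrAC subrr add0r cabsM cabs_real ger0_norm //.
  by rewrite ler_piMl ?cabs_ge0.
have hd (t : R) : 0 <= t <= 1 -> is_derive t 1 (fun s : R => complex.Re (c * f (p + s%:C * v)))
    (complex.Re (c * (df (p + t%:C * v) * v))).
  by move=> /hw[h1 _]; exact: line_deriv.
have [] := @MVT_segment R (fun s : R => complex.Re (c * f (p + s%:C * v)))
  (fun t => complex.Re (c * (df (p + t%:C * v) * v))) 0 1 ler01.
- by move=> t; rewrite in_itv /= => /andP[t0 t1]; apply: hd; rewrite !ltW.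
- apply: derivable_within_continuous => t; rewrite in_itv /= => /hd [].
  by [].
move=> t; rewrite in_itv /= => /hw[_ hK].
rewrite subr0 mulr1 rmorph0 rmorph1 mul0r mul1r addr0 -raddfB -mulrBr.
rewrite (_ : p + v = z) /c ?mulVf // /v; [move=> h1|ring].
have h2 : 1 <= cabs ((f z - f p)^-1 * (df (p + t%:C * (z - p)) * (z - p))) by rewrite (le_trans _ (cabs_Re _)) // -h1 /= normr1.
move: h2; rewrite cabsM cabsV mulrC ler_pdivlMr ?cabs_gt0 // mul1r => /le_trans; apply.
by rewrite cabsM ler_wpM2r ?cabs_ge0.
Qed.

(** The second-order remainder of f at p has a derivative that is small
    compared to w - p, so the mean value inequality applies to it.  This is
    how a simple zero is divided out without power series. *)
Lemma hasd_quotient f df p e : (forall w, hasd f w (df w)) -> hasd df p e ->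
  hasd (fun w => if w == p then df p else (f w - f p) / (w - p)) p (e / 2).
Proof.
move=> hf he; have [phi [/ccontP phic phie hphi]] := hasd_slope he.
apply/hasdE/climP => eps eps0.
have [r r0 hr] := phic (eps / 2) (divr_gt0 eps0 (ltr0Sn R 1)).
exists r => // z zp zr; rewrite eqxx (negbTE zp).
pose g w := f w - (df p * (w - p) + e / 2 * (w - p) ^+ 2).
pose dg w := (phi w - e) * (w - p).
have hg w : hasd g w (dg w).
  have h1 := hasd_lin 1 (- p) w; have h2 := hasdM h1 h1.
  have H := hasdD (hf w) (hasdN (hasdD (hasdZ (df p) h1) (hasdZ (e / 2) h2))).
  apply: hasd_ext (hasd_eq H _) => [y|]; first by rewrite /g mul1r expr2.
  rewrite (_ : dg w = df w - df p - e * (w - p)); last by rewrite hphi /dg; ring.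
  by move: (df w) (df p) => a b; field.
have K0 : 0 <= eps / 2 * cabs (z - p) by rewrite mulr_ge0 ?cabs_ge0 // ltW // divr_gt0.
have := @mean_value g dg p z _ K0.
have -> : g z - g p = ((f z - f p) / (z - p) - df p - e / 2 * (z - p)) * (z - p).
  rewrite /g; have : z - p != 0 by rewrite subr_eq0.
  rewrite subrr; move: (z - p) (f z) (f p) (df p) => v a b c v0; field; exact: v0.
rewrite cabsM ler_pM2r ?cabs_gt0 ?subr_eq0 // => H.
have {}H : cabs ((f z - f p) / (z - p) - df p - e / 2 * (z - p)) <= eps / 2 * cabs (z - p).
  apply: H => w wz; split; first exact: hg.
  rewrite /dg cabsM ler_pM ?cabs_ge0 // -phie ltW // hr //; exact: le_lt_trans wz zr.
have v0 : z - p != 0 by rewrite subr_eq0.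
have -> : ((f z - f p) / (z - p) - df p) / (z - p) - e / 2 =
   ((f z - f p) / (z - p) - df p - e / 2 * (z - p)) / (z - p).
  by move: ((f z - f p) / (z - p)) (df p) (z - p) v0 => a b v v0; field; exact: v0.
rewrite cabsM cabsV ltr_pdivrMr ?cabs_gt0 //; apply: le_lt_trans H _.
by rewrite ltr_pM2r ?cabs_gt0 // ltr_pdivrMr // mulr_natr mulr2n ltrDl.
Qed.

End MeanValue.

Section KronPole.
Variables (R : realType) (tau : R[i]).
Local Notation C := R[i].
Hypothesis htau : 0 < complex.Im tau.
Implicit Types (x y z w u v l : C) (a b c d : bool).
Local Notation tht := (tht tau).
Local Notation th1 := (tht true true).
Local Notation dth1 := (dtht tau true true).

Lemma dth1_lattice l : lattice tau l -> dth1 l != 0.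
Proof.
move=> hl; have step (f k t d t' d' : C) : f != 0 -> t' = f * t -> d' = f * (d - k * t) ->
    t = 0 /\ d != 0 <-> t' = 0 /\ d' != 0.
  move=> f0 -> ->; split=> -[].
    by move=> -> d0; rewrite !mulr0 subr0 mulf_neq0.
  by move/eqP; rewrite mulf_eq0 (negbTE f0) => /eqP ->; rewrite mulr0 subr0 mulf_eq0 negb_or => /andP[].
have := @lattice_ind _ tau (fun z => th1 z = 0 /\ dth1 z != 0) _ _ 0 l hl.
rewrite add0r => H; apply: (proj2 (H _ _ _)) => [z|z|].
- apply: (step (-1) 0); first by rewrite oppr_eq0 oner_eq0.
    by rewrite tht_add1 /= expr1.
  by rewrite mul0r subr0 mulN1r; exact: dth1_add1.
- apply: (step (- tfac tau z) (2 * (cpi R * 'i))); first by rewrite oppr_eq0 tfac_neq0.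
    by rewrite tht_addtau //= expr1 mulN1r.
  by rewrite dth1_addtau.
by rewrite th1_0 //; split=> //; exact: dth1_neq0.
Qed.

(** The value at l is the residue of kron there. *)
Definition kres a b u l w : C :=
  if w == l then kron_num tau a b u l / dth1 l else (w - l) * kron tau a b u w.

(** At l the function is kron_num divided by the difference quotient of
    theta1, which is differentiable by hasd_quotient and nonzero since the
    zero of theta1 is simple. *)
Lemma kres_near u l : lattice tau l ->
  \forall w \near l, forall a b, differentiable (kres a b u l) w.
Proof.
move=> hl; have t0 := th1_lattice htau hl.
have [r r0 hr] := proj1 (dnearC _ _) (th1_near htau l).
apply/nearC; exists r => // w wr a b; have [->|wl] := eqVneq w l.
  have [e he] := holo_dtht htau true true l.
  have hq := hasd_quotient (hasd_tht htau true true) he.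
  have [k hk] := hasd_kron_num htau a b u l.
  have q0 : (if l == l then dth1 l else (th1 l - th1 l) / (l - l)) != 0 by rewrite eqxx dth1_lattice.
  refine (proj1 (hasd_ext _ (hasdM hk (hasdV hq q0)))) => x.
  rewrite /kres /kron t0; case: eqVneq => [->//|xl].
  by rewrite subr0 invfM invrK; ring.
have [k hk] := hasd_kron htau a b u (hr w wl wr).
have h1 := hasdM (hasd_lin 1 (- l) w) hk.
apply: (fun H => proj1 (hasd_near H h1)); apply/nearC.
exists (cabs (w - l)); first by rewrite cabs_gt0 subr_eq0.
move=> x; rewrite /kres; case: eqVneq => [->|_ _]; last by rewrite mul1r.
by rewrite cabsBC ltxx.
Qed.

End KronPole.

(** * The gauge *)

Section MatrixDiff.
Variable R : realType.
Local Notation C := R[i].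
Local Notation M2 := 'M[C]_2.

Lemma mx2E (M : M2) : M = mx2 (M 0 0) (M 0 1) (M 1 0) (M 1 1).
Proof.
by apply/matrixP => i j; rewrite mxE; case: i => -[|[|//]] ?; case: j => -[|[|//]] ? /=;
  congr (M _ _); apply/val_inj.
Qed.

Lemma mx2_00 (a b c d : C) : mx2 a b c d 0 0 = a. Proof. by rewrite mxE. Qed.
Lemma mx2_01 (a b c d : C) : mx2 a b c d 0 1 = b. Proof. by rewrite mxE. Qed.
Lemma mx2_10 (a b c d : C) : mx2 a b c d 1 0 = c. Proof. by rewrite mxE. Qed.
Lemma mx2_11 (a b c d : C) : mx2 a b c d 1 1 = d. Proof. by rewrite mxE. Qed.
Definition mx2_entries := (mx2_00, mx2_01, mx2_10, mx2_11).

Lemma mx2D (a b c d a' b' c' d' : C) :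
  mx2 a b c d + mx2 a' b' c' d' = mx2 (a + a') (b + b') (c + c') (d + d').
Proof. by rewrite [LHS]mx2E !mxE. Qed.

Lemma mulmx2 (M N : M2) : M *m N =
  mx2 (M 0 0 * N 0 0 + M 0 1 * N 1 0) (M 0 0 * N 0 1 + M 0 1 * N 1 1)
      (M 1 0 * N 0 0 + M 1 1 * N 1 0) (M 1 0 * N 0 1 + M 1 1 * N 1 1).
Proof. by rewrite {1}(mx2E M) {1}(mx2E N) mulmx_mx2. Qed.

Lemma mxtrace2 (M : M2) : \tr M = M 0 0 + M 1 1.
Proof. by rewrite /mxtrace big_ord_recl big_ord1; congr (_ + M _ _); apply/val_inj. Qed.

Lemma diff_entries (V : normedModType C) (F : V -> M2) z :
  differentiable F z <-> forall i j, differentiable (fun v => F v i j) z.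
Proof.
split=> [h i j|h].
  exact: (differentiable_comp h (differentiable_coord (F z) i j)).
have D (f g : V -> M2) := @differentiableD C V M2 f g z.
have Z i j (M : M2) := @differentiableZl C V M2 (fun v => F v i j) M z (h i j).
have H := D _ _ (D _ _ (Z 0 0 (mx2 1 0 0 0)) (Z 0 1 (mx2 0 1 0 0)))
  (D _ _ (Z 1 0 (mx2 0 0 1 0)) (Z 1 1 (mx2 0 0 0 1))).
move: H; congr (differentiable _ _); apply/funext => v.
rewrite [RHS](mx2E (F v)) /GRing.add /=.
by rewrite !scale_mx2 !mx2D !(mulr0, mulr1, addr0, add0r).
Qed.

Lemma diff_mx2 (V : normedModType C) (a b c d : V -> C) z :
  differentiable a z -> differentiable b z -> differentiable c z -> differentiable d z ->
  differentiable (fun v => mx2 (a v) (b v) (c v) (d v)) z.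
Proof.
move=> ha hb hc hd; apply/diff_entries => i j.
have -> : (fun v => mx2 (a v) (b v) (c v) (d v) i j) =
    if i == 0 then (if j == 0 then a else b) else (if j == 0 then c else d).
  by apply/funext => v; rewrite mxE; case: ifP => _; case: ifP.
by case: ifP => _; case: ifP.
Qed.

End MatrixDiff.

Section Pinv.
Lemma pinvP (T : pointedType) (U : Type) (D : set T) (f : T -> U) a :
  D a -> D (pinv D f (f a)) /\ f (pinv D f (f a)) = f a.
Proof.
move=> Da; have fa : (f @` D) (f a) by exists a.
by split; [exact: (@funS _ _ _ _ (pinv D f))|apply: pinvK; rewrite inE].
Qed.
End Pinv.

Section Gauge.
Variables (R : realType) (tau : R[i]).
Local Notation C := R[i].
Local Notation M2 := 'M[C]_2.
Implicit Types (x y z : C) (M : M2) (F : C -> M2) (p : bool * bool).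

(** The shift by tau / 2 makes the off-diagonal entries of the automorphy
    factor Phi equal after conjugation. *)
Definition gfun z : C := E z * E (tau / 2).

Lemma gfun_neq0 z : gfun z != 0.
Proof. by rewrite mulf_neq0 ?E_neq0. Qed.

Lemma gfun_add1 z : gfun (z + 1) = - gfun z.
Proof. by rewrite /gfun ED E1 mulrN1 mulNr. Qed.

Lemma gfun_addtau z : gfun (z + tau) = gfun z * E tau.
Proof. by rewrite /gfun ED mulrAC. Qed.

Lemma hasd_gfun z : exists d, hasd gfun z d.
Proof.
eexists; apply: hasd_ext (hasdZ (E (tau / 2)) (hasd_E z)) => w.
by rewrite /gfun mulrC.
Qed.

Lemma PhiE x z : Phi tau x z = E (- x) *: mx2 0 1 (gfun z ^+ 2 * E tau)^-1 0.
Proof.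
rewrite /Phi; congr (_ *: mx2 _ _ _ _); first by rewrite EE; congr cexp; ring.
by rewrite /gfun -ED -E_nat -ED -EN EE; congr cexp; field.
Qed.

(** Conjugation by diag(1, gfun z), and its inverse. *)
Definition gauge_at z M : M2 := mx2 (M 0 0) (M 0 1 / gfun z) (gfun z * M 1 0) (M 1 1).
Definition ungauge_at z M : M2 := mx2 (M 0 0) (gfun z * M 0 1) (M 1 0 / gfun z) (M 1 1).

Local Notation gauge := gauge_at.
Local Notation ungauge := ungauge_at.

Lemma gaugeK z : cancel (gauge z) (ungauge z).
Proof.
move=> M; rewrite /ungauge_at /gauge_at !mx2_entries [RHS]mx2E; have := gfun_neq0 z.
by move: (gfun z) => g g0; congr mx2; field.
Qed.

Lemma ungaugeK z : cancel (ungauge z) (gauge z).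
Proof.
move=> M; rewrite /ungauge_at /gauge_at !mx2_entries [RHS]mx2E; have := gfun_neq0 z.
by move: (gfun z) => g g0; congr mx2; field.
Qed.

Lemma ungauge_lin z : linear (ungauge z).
Proof.
move=> a M N; rewrite /ungauge_at scale_mx2 mx2D !mxE.
by move: (gfun z) (gfun z)^-1 => g h; congr mx2; ring.
Qed.

Lemma gaugeZ z a M : gauge z (a *: M) = a *: gauge z M.
Proof.
rewrite /gauge_at scale_mx2 !mxE.
by move: (gfun z) (gfun z)^-1 => g h; congr mx2; ring.
Qed.

Lemma ungaugeZ z a M : ungauge z (a *: M) = a *: ungauge z M.
Proof.
rewrite /ungauge_at scale_mx2 !mxE.
by move: (gfun z) (gfun z)^-1 => g h; congr mx2; ring.
Qed.

Lemma ungauge_mul z M N : ungauge z (M *m N) = ungauge z M *m ungauge z N.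
Proof.
rewrite /ungauge_at mulmx_mx2 (mulmx2 M N) !mx2_entries; have := gfun_neq0 z.
by move: (gfun z) => g g0; congr mx2; field.
Qed.

(** Conjugation by the gauge makes the automorphy factors constant: gfun
    changes sign under z + 1, and Phi becomes a multiple of gamma. *)
Lemma intertwines_gauge x1 x2 F : intertwines tau x1 x2 F <->
  (forall z, gauge (z + 1) (F (z + 1)) = mxh R *m gauge z (F z) *m mxh R) /\
  (forall z, gauge (z + tau) (F (z + tau)) =
     E (- (x2 - x1)) *: (mxgamma R *m gauge z (F z) *m mxgamma R)).
Proof.
have inj a b c d a' b' c' d' : mx2 a b c d = mx2 a' b' c' d' :> M2 ->
    [/\ a = a', b = b', c = c' & d = d'].
  by move=> e; split; [move/(congr1 (fun M : M2 => M 0 0)) : e|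
   move/(congr1 (fun M : M2 => M 0 1)) : e|move/(congr1 (fun M : M2 => M 1 0)) : e|
   move/(congr1 (fun M : M2 => M 1 1)) : e]; rewrite !mx2_entries.
have P1 z : F (z + 1) = F z <-> gauge (z + 1) (F (z + 1)) = mxh R *m gauge z (F z) *m mxh R.
  have -> : mxh R *m gauge z (F z) *m mxh R = gauge (z + 1) (F z).
    rewrite /mxh /gauge_at !mulmx_mx2 gfun_add1 invrN.
    by move: (gfun z) (gfun z)^-1 => g h; congr mx2; ring.
  by split=> [->//|]; exact: (can_inj (gaugeK _)).
have P2 z : F (z + tau) *m Phi tau x1 z = Phi tau x2 z *m F z <->
   gauge (z + tau) (F (z + tau)) = E (- (x2 - x1)) *: (mxgamma R *m gauge z (F z) *m mxgamma R).
  have kk : E (- x2) = E (- (x2 - x1)) * E (- x1) by rewrite -ED; congr E; ring.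
  have := gfun_neq0 z; have := E_neq0 tau; have := E_neq0 (- x1).
  rewrite !PhiE kk /gauge_at /mxgamma gfun_addtau; set k := E (- (x2 - x1)).
  rewrite [F (z + tau)]mx2E [F z]mx2E !scale_mx2 !mulmx_mx2 scale_mx2 !mx2_entries.
  move: (gfun z) (E tau) (E (- x1)) (F (z + tau) 0 0) (F (z + tau) 0 1) (F (z + tau) 1 0) (F (z + tau) 1 1) => g t e a' b' c' d'.
  move: (F z 0 0) (F z 0 1) (F z 1 0) (F z 1 1) => a b c d e0 t0 g0; split=> /inj[].
    move=> h1 h2 h3 h4; congr mx2.
    - apply: (mulfI e0); transitivity (a' * (e * 1) + b' * (e * 0)); [ring|rewrite h2; ring].
    - apply: (mulfI e0); transitivity ((a' * (e * 0) + b' * (e * (g ^+ 2 * t)^-1)) * g).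
        by field; rewrite g0 t0.
      by rewrite h1; ring.
    - apply: (mulfI e0); transitivity ((c' * (e * 1) + d' * (e * 0)) * (g * t)); [ring|rewrite h4].
      by field; rewrite g0 t0.
    apply: (mulfI e0); transitivity ((c' * (e * 0) + d' * (e * (g ^+ 2 * t)^-1)) * (g ^+ 2 * t)).
      by field; rewrite g0 t0.
    by rewrite h3; field; rewrite g0 t0.
  move=> h1 h2 h3 h4; congr mx2.
  - transitivity ((b' / (g * t)) * (e / g)); [field; rewrite g0 t0 //|rewrite h2].
    by field; rewrite g0.
  - by transitivity (a' * e); [ring|rewrite h1; ring].
  - transitivity (d' * (e * (g ^+ 2 * t)^-1)); [ring|rewrite h4; ring].
  transitivity ((g * t * c') * e / (g * t)); [field; rewrite g0 t0 //|rewrite h3].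
  by field; rewrite g0 t0.
split=> -[h1 h2]; split=> z.
- by apply/P1.
- by apply/P2.
- by apply/P1.
by apply/P2.
Qed.

End Gauge.

(** * Coordinates in the basis of the four matrices *)

Section Components.
Variable R : realType.
Local Notation C := R[i].
Local Notation M2 := 'M[C]_2.
Implicit Types (p q : bool * bool) (M N : M2).

(** The trace form, for which the four matrices are orthogonal with square
    length 2. *)
Definition pcoef p M : C := 2^-1 * \tr (pauli R p *m M).

Lemma pcoefE p M : let s := pauli R p in
  pcoef p M = 2^-1 * (s 0 0 * M 0 0 + s 0 1 * M 1 0 + (s 1 0 * M 0 1 + s 1 1 * M 1 1)).
Proof. by rewrite /pcoef mulmx2 mxtrace2 !mx2_entries. Qed.

Lemma pcoefZ p a M : pcoef p (a *: M) = a * pcoef p M.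
Proof. by rewrite /pcoef -scalemxAr mxtraceZ mulrCA. Qed.

Lemma big_pauli (V : nmodType) (f : bool * bool -> V) :
  \sum_p f p = f (true, true) + f (true, false) + (f (false, true) + f (false, false)).
Proof.
transitivity (\sum_a \sum_b f (a, b)); last by rewrite !big_bool.
by rewrite pair_bigA; apply: eq_bigr => -[].
Qed.

Lemma pauli_dec M : M = \sum_p pcoef p M *: pauli R p.
Proof.
have i2 : 'i * 'i = -1 :> C by rewrite -expr2 sqr_i.
rewrite big_pauli !pcoefE /pauli /mxh /mxsigma /mxgamma mx2_1 !mx2_entries !scale_mx2 !mx2D.
rewrite {1}(mx2E M); move: (M 0 0) (M 0 1) (M 1 0) (M 1 1) => a b c d.
have n2 : 2 != 0 :> C by rewrite pnatr_eq0.
have ii : 'i%C = 'i%R :> C by [].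
rewrite ii; congr mx2; apply: (mulfI n2).
- by field.
- by transitivity (b - 'i * 'i * b + (c + 'i * 'i * c)); [rewrite i2; ring|field].
- by transitivity (c - 'i * 'i * c + (b + 'i * 'i * b)); [rewrite i2; ring|field].
by field.
Qed.

Lemma pauli_sqr p : pauli R p *m pauli R p = 1%:M.
Proof.
have i2 : 'i * 'i = -1 :> C by rewrite -expr2 sqr_i.
case: p => [[] []]; rewrite /= /mxh /mxsigma /mxgamma ?mx2_1 mulmx_mx2;
  by rewrite ?(mulr0, mul0r, mulr1, mul1r, addr0, add0r, mulrN, mulNr, i2, opprK, oppr0).
Qed.

Lemma pauli_conjh p : mxh R *m pauli R p *m mxh R = (-1) ^+ (~~ p.1) *: pauli R p.
Proof.
case: p => [[] []]; rewrite /= /mxh /mxsigma /mxgamma ?mx2_1 !mulmx_mx2 scale_mx2 ?expr0 ?expr1;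
  by rewrite ?(mulr0, mul0r, mulr1, mul1r, addr0, add0r, mulrN, mulNr, opprK, oppr0).
Qed.

Lemma pauli_conjg p : mxgamma R *m pauli R p *m mxgamma R = (-1) ^+ (~~ p.2) *: pauli R p.
Proof.
case: p => [[] []]; rewrite /= /mxh /mxsigma /mxgamma ?mx2_1 !mulmx_mx2 scale_mx2 ?expr0 ?expr1;
  by rewrite ?(mulr0, mul0r, mulr1, mul1r, addr0, add0r, mulrN, mulNr, opprK, oppr0).
Qed.

Lemma pcoef_conj p (T M : M2) e : T *m pauli R p *m T = e *: pauli R p ->
  pcoef p (T *m M *m T) = e * pcoef p M.
Proof.
move=> h; rewrite /pcoef mulrCA; congr (_ * _).
by rewrite mulmxA mxtrace_mulC !mulmxA h -scalemxAl mxtraceZ.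
Qed.

End Components.

Section GaugedCoordinates.
Variables (R : realType) (tau : R[i]).
Local Notation C := R[i].
Local Notation M2 := 'M[C]_2.
Hypothesis htau : 0 < complex.Im tau.
Implicit Types (x y z w l : C) (M A : M2) (F G : C -> M2) (p q : bool * bool) (f g : C -> C).
Local Notation th1 := (tht tau true true).
Local Notation gauge := (gauge_at tau).
Local Notation ungauge := (ungauge_at tau).

Lemma dif_ext (f g : C -> C) z : f =1 g -> differentiable f z -> differentiable g z.
Proof. by move=> /funext ->. Qed.

Lemma difM f g z : differentiable f z -> differentiable g z -> differentiable (fun w => f w * g w) z.
Proof. by move=> /hasd_ex hf /hasd_ex hg; exact: (proj1 (hasdM hf hg)). Qed.

Lemma difD f g z : differentiable f z -> differentiable g z -> differentiable (fun w => f w + g w) z.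
Proof. by move=> /hasd_ex hf /hasd_ex hg; exact: (proj1 (hasdD hf hg)). Qed.

Lemma dif_cst (c z : C) : differentiable (fun=> c) z.
Proof. exact: (proj1 (hasd_cst c z)). Qed.

Lemma dif_gfun z : differentiable (gfun tau) z.
Proof. by have [d []] := hasd_gfun tau z. Qed.

Lemma dif_gfunV z : differentiable (fun w => (gfun tau w)^-1) z.
Proof. by have [d hd] := hasd_gfun tau z; exact: (proj1 (hasdV hd (gfun_neq0 tau z))). Qed.

Lemma dif_sum (I : finType) (f : I -> C -> C) z : (forall i, differentiable (f i) z) ->
  differentiable (fun w => \sum_i f i w) z.
Proof.
move=> h; elim: (index_enum I) => [|i s ih].
  by apply: dif_ext (dif_cst 0 z) => w; rewrite big_nil.
by apply: dif_ext (difD (h i) ih) => w; rewrite big_cons.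
Qed.

Lemma dif_ungauge_sum (f : bool * bool -> C -> C) z : (forall p, differentiable (f p) z) ->
  differentiable (fun w => ungauge w (\sum_p f p w *: pauli R p)) z.
Proof.
move=> h; have H i j : differentiable (fun w => (\sum_p f p w *: pauli R p) i j) z.
  have e w : (\sum_p f p w *: pauli R p) i j = \sum_p f p w * pauli R p i j.
    by rewrite summxE; apply: eq_bigr => p _; rewrite mxE.
  apply: (dif_ext (fun w => esym (e w))).
  by apply: dif_sum => p; apply: difM => //; exact: dif_cst.
apply: diff_mx2; [exact: H|apply: difM; [exact: dif_gfun|exact: H]
  |apply: difM; [exact: H|exact: dif_gfunV]|exact: H].
Qed.

Lemma dif_pcoef_gauge F z p : differentiable F z -> differentiable (fun w => pcoef p (gauge w (F w))) z.
Proof.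
move=> /diff_entries h; apply: dif_ext => [w|]; first by rewrite pcoefE !mx2_entries.
by apply: difM; [exact: dif_cst|do 2 apply: difD; apply: difM; try exact: dif_cst;
  [exact: h|apply: difM; [exact: dif_gfun|exact: h]|apply: difM; [exact: h|exact: dif_gfunV]|exact: h]].
Qed.

Lemma residue_eq F G y : differentiable G y -> (\forall z \near y^', F z = (z - y)^-1 *: G z) ->
  residue y F = G y.
Proof.
move=> dG hF; rewrite /residue; apply: cvg_lim => //.
have cG : G z @[z --> y^'] --> G y.
  by apply: cvg_within_filter; exact: (differentiable_continuous dG).
apply: cvg_trans cG; apply: near_eq_cvg.
have [r r0 hr] := proj1 (dnearC _ _) hF; apply/dnearC; exists r => // z zy zr.
by rewrite (hr z zy zr) scalerA mulfV ?scale1r // subr_eq0.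
Qed.

End GaugedCoordinates.

(** * Homomorphisms with a simple pole *)

Section HomPole.
Variables (R : realType) (tau : R[i]).
Local Notation C := R[i].
Local Notation M2 := 'M[C]_2.
Hypothesis htau : 0 < complex.Im tau.
Implicit Types (x y z w l : C) (M A : M2) (F G : C -> M2) (p q : bool * bool).
Local Notation th1 := (tht tau true true).
Local Notation gauge := (gauge_at tau).
Local Notation ungauge := (ungauge_at tau).

Lemma th1_off y z : ~ same_point tau y z -> th1 (z - y) != 0.
Proof. by move=> h; apply/eqP => /(th1_eq0 htau). Qed.

Lemma th1_on y z : same_point tau y z -> th1 (z - y) = 0.
Proof. exact: th1_lattice. Qed.

(** The homomorphism with a simple pole at y whose residue has the given
    coordinates in the gauged basis.  At the poles it is 0, because th1
    vanishes there and the inverse of 0 is 0. *)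
Definition hom x y (c : bool * bool -> C) z : M2 :=
  ungauge z (\sum_p (c p * kron tau p.1 p.2 x (z - y)) *: pauli R p).

Definition hom_res x y (c : bool * bool -> C) l z : M2 :=
  ungauge z (\sum_p (c p * kres tau p.1 p.2 x l (z - y)) *: pauli R p).

Lemma conj_sum (T : M2) (e : bool * bool -> C) (c : bool * bool -> C) :
  (forall p, T *m pauli R p *m T = e p *: pauli R p) ->
  T *m (\sum_p c p *: pauli R p) *m T = \sum_p (e p * c p) *: pauli R p.
Proof.
move=> h; rewrite mulmx_sumr mulmx_suml; apply: eq_bigr => p _.
by rewrite -scalemxAr -scalemxAl h scalerA mulrC.
Qed.

Lemma hom_intertwines x1 x2 y c : intertwines tau x1 x2 (hom (x2 - x1) y c).
Proof.
apply/intertwines_gauge; split=> z; rewrite !ungaugeK.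
  rewrite (conj_sum _ (pauli_conjh R)); apply: eq_bigr => p _.
  by rewrite (addrAC z) kron_add1 mulrCA.
rewrite (conj_sum _ (pauli_conjg R)) scaler_sumr; apply: eq_bigr => p _.
by rewrite (addrAC z) kron_addtau // scalerA; congr (_ *: _); ring.
Qed.

Lemma hom_diff x y c z : ~ same_point tau y z -> differentiable (hom x y c) z.
Proof.
move=> /th1_off h; apply: dif_ungauge_sum => p; apply: difM; first exact: dif_cst.
have [d hd] := hasd_kron htau p.1 p.2 x h.
exact: (proj1 (proj2 (hasd_shift _ _ _ _) hd)).
Qed.

Lemma hom_on x y c z : same_point tau y z -> hom x y c z = 0.
Proof.
move=> /th1_on h; rewrite /hom big1 => [|p _]; last first.
  by rewrite /kron h invr0 !mulr0 scale0r.
by have := ungaugeZ tau z 0 0; rewrite !scale0r.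
Qed.

Lemma hom_res_near x y c w : same_point tau y w ->
  \forall z \near w, differentiable (hom_res x y c (w - y)) z.
Proof.
move=> /(kres_near htau x) /nearC[r r0 h]; apply/nearC; exists r => // z zr.
apply: dif_ungauge_sum => q; apply: difM; first exact: dif_cst.
apply: (proj1 (proj2 (hasd_shift _ _ _ _) (hasd_ex (h (z - y) _ q.1 q.2)))).
by rewrite opprB addrA subrK.
Qed.

Lemma hom_resE x y c l z : z - y != l ->
  hom x y c z = (z - y - l)^-1 *: hom_res x y c l z.
Proof.
move=> zl; have l0 : z - y - l != 0 by rewrite subr_eq0.
rewrite /hom_res -ungaugeZ /hom scaler_sumr; congr (ungauge_at _ _ _); apply: eq_bigr => p _.
rewrite /kres (negbTE zl) scalerA; congr (_ *: _).
by move: (kron _ _ _ _ _) (z - y - l) l0 => k d d0; field.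
Qed.

Lemma hom_pole x1 x2 y c : Hom_pole tau x1 x2 y (hom (x2 - x1) y c).
Proof.
split; [exact: hom_intertwines|by move=> z; exact: hom_diff|].
move=> p hp; split; first exact: hom_on.
exists (hom_res (x2 - x1) y c (p - y)); split; first exact: hom_res_near.
apply/dnearC; exists 1 => // z zp _; rewrite (hom_resE _ _ (l := p - y)).
  by congr (_^-1 *: _); ring.
by rewrite (inj_eq (addIr _)).
Qed.

Lemma hom_residue x y c : ~ lattice tau x ->
  residue y (hom x y c) = ungauge y (\sum_p c p *: pauli R p).
Proof.
move=> hx; have yy : same_point tau y y by rewrite /same_point subrr; exists 0, 0; ring.
have -> : ungauge y (\sum_p c p *: pauli R p) = hom_res x y c 0 y.
  congr (ungauge_at _ _ _); apply: eq_bigr => p _.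
  by rewrite subrr /kres eqxx kron_num0 // mulfV ?mulr1 // dth1_neq0.
apply: residue_eq.
  by have := nbhs_singleton (hom_res_near x c yy); rewrite subrr.
apply/dnearC; exists 1 => // z zy _; rewrite (hom_resE _ _ (l := 0)) ?subr0 //.
by rewrite subr_eq0.
Qed.

(** The coordinates of the difference of two such homomorphisms satisfy the
    hypotheses of liouville: with equal residues the poles cancel. *)
Lemma hom_pole_unique x1 x2 y1 y2 F1 F2 : ~ lattice tau (x2 - x1) -> ~ same_point tau y1 y2 ->
  Hom_pole tau x1 x2 y1 F1 -> Hom_pole tau x1 x2 y1 F2 ->
  residue y1 F1 = residue y1 F2 -> F1 y2 = F2 y2.
Proof.
move=> hx hy [i1 d1 s1] [i2 d2 s2] hres.
pose g p z := pcoef p (gauge z (F1 z)) - pcoef p (gauge z (F2 z)).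
have gd p z : ~ same_point tau y1 z -> differentiable (g p) z.
  move=> hz; apply: difD; first exact: (dif_pcoef_gauge tau p (d1 z hz)).
  have := difM (dif_cst (-1) z) (dif_pcoef_gauge tau p (d2 z hz)).
  by apply: dif_ext => w; rewrite mulN1r.
have [/intertwines_gauge[a1 t1] /intertwines_gauge[a2 t2]] := (i1, i2).
have g0 p : g p y2 = 0.
  have yy : same_point tau y1 y1 by rewrite /same_point subrr; exists 0, 0; ring.
  have near_off z : \forall w \near z^', ~ same_point tau y1 w.
    have := proj1 (near_shift (fun w => th1 w != 0) z (- y1)) (th1_near htau (z - y1)).
    by apply: filterS => w /eqP h /th1_on.
  have niceg z : exists2 w, lattice tau w & nice (g p) (z + w).
    have [hz|hz] := pselect (same_point tau y1 z); last first.
      exists 0; first by exists 0, 0; ring.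
      rewrite addr0; split; last by apply: filterS (near_off z) => w; exact: gd.
      by exists (g p z); exact: (hasd_cont (hasd_ex (gd p z hz))).
    exists (y1 - z); first by rewrite -opprB; exact: latticeN.
    rewrite addrC subrK; split; last by apply: filterS (near_off y1) => w; exact: gd.
    have [_ [G1 [n1 e1]]] := s1 _ yy; have [_ [G2 [n2 e2]]] := s2 _ yy.
    have dG1 := nbhs_singleton n1; have dG2 := nbhs_singleton n2.
    move: hres; rewrite (residue_eq dG1 e1) (residue_eq dG2 e2) => hG.
    pose D w := pcoef p (gauge w (G1 w)) - pcoef p (gauge w (G2 w)).
    have D0 : D y1 = 0 by rewrite /D hG; exact: subrr.
    have [k hk] : exists k, hasd D y1 k.
      eexists; apply: hasdD; first exact: (hasd_ex (dif_pcoef_gauge tau p dG1)).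
      exact: hasdN (hasd_ex (dif_pcoef_gauge tau p dG2)).
    exists k; move/hasdE : hk; apply: clim_eq; apply: filterS2 e1 e2 => w h1 h2.
    by rewrite D0 subr0 /g h1 h2 !gaugeZ !pcoefZ -mulrBr; exact: mulrC.
  apply: (liouville htau (a := p.1) (b := p.2) hx _ _ niceg (gd p y2 hy)) => z.
    by rewrite /g a1 a2 !(pcoef_conj _ (pauli_conjh R p)) mulrBr.
  rewrite /g t1 t2 !pcoefZ !(pcoef_conj _ (pauli_conjg R p)).
  by move: (pcoef _ _) (pcoef _ _) => X Y; ring.
apply: (can_inj (gaugeK tau y2)); rewrite [LHS]pauli_dec [RHS]pauli_dec.
by apply: eq_bigr => p _; congr (_ *: _); apply/eqP; rewrite -subr_eq0; apply/eqP; exact: g0.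
Qed.

End HomPole.

(** * The geometric r-matrix *)

Section GeometricRMatrix.
Variables (R : realType) (tau : R[i]).
Local Notation C := R[i].
Local Notation M2 := 'M[C]_2.
Hypothesis htau : 0 < complex.Im tau.
Implicit Types (x y z w l : C) (M A : M2) (F G : C -> M2) (p q : bool * bool).
Local Notation gauge := (gauge_at tau).
Local Notation ungauge := (ungauge_at tau).

Lemma E_int (n : int) : E (n%:~R : C) = (-1) ^+ odd `|n|%N.
Proof.
have N (k : nat) : E (k%:R : C) = (-1) ^+ odd k.
  by rewrite -[k%:R]mulr1 E_nat E1 signr_odd.
case: n => k; first by rewrite -pmulrn N.
by rewrite NegzE rmorphN /= EN -pmulrn N ?abszN ?absz_nat /=; case: (~~ odd k); rewrite ?expr1 ?expr0 ?invrN invr1.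
Qed.

(** For x2 - x1 = m + n tau, the multipliers required in the gauge are those
    of an exponential E(- n z) times the basis matrix whose signs are the
    parities of n and m. *)
Lemma lattice_bundle_iso x1 x2 : lattice tau (x2 - x1) -> bundle_iso tau x1 x2.
Proof.
(* conjugation of pauli p by h, respectively gamma, changes the sign exactly
   when n, respectively m, is odd *)
move=> [m [n hmn]]; pose p := (~~ odd `|n|%N, ~~ odd `|m|%N).
pose e z := E (- n%:~R * z).
have e0 z : e z != 0 by exact: E_neq0.
exists (fun z => ungauge z (e z *: pauli R p)); split => [z _|z|].
- have := @dif_ungauge_sum R tau (fun q w => e w * (q == p)%:R) z.
  have -> : (fun w => ungauge w (\sum_q (e w * (q == p)%:R) *: pauli R q)) =
      (fun w => ungauge w (e w *: pauli R p)).
    apply/funext => w; congr (ungauge_at _ _ _); rewrite (bigD1 p) //= eqxx mulr1 big1 ?addr0 //.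
    by move=> q /negbTE ->; rewrite mulr0 scale0r.
  apply=> q; apply: difM; last exact: dif_cst.
  have h := hasd_comp (hasd_lin (- n%:~R) 0 z) (hasd_E (- n%:~R * z + 0)).
  by apply: dif_ext (proj1 h) => w; rewrite /e addr0.
- have : ungauge z (e z *: pauli R p) *m ungauge z ((e z)^-1 *: pauli R p) = 1%:M.
    rewrite -ungauge_mul -scalemxAl -scalemxAr scalerA pauli_sqr mulfV // scale1r.
    by rewrite mx2_1 /ungauge_at !mx2_entries mulr0 mul0r.
  by move=> h; exact: (proj1 (mulmx1_unit h)).
apply/intertwines_gauge; split=> z; rewrite !ungaugeK -scalemxAr -scalemxAl.
  rewrite pauli_conjh scalerA; congr (_ *: _).
  by rewrite /e mulrDr mulr1 ED -rmorphN E_int abszN /p /= negbK.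
rewrite pauli_conjg !scalerA; congr (_ *: _).
have -> : E (- (x2 - x1)) = (-1) ^+ odd `|m|%N * E (- n%:~R * tau).
  by rewrite hmn opprD ED -rmorphN E_int abszN mulNr.
rewrite /e mulrDr ED /p /= negbK; have := @eps_sq R (odd `|m|%N).
move: (E _) (E _) ((-1) ^+ _) => X Y s s2.
by transitivity (s ^+ 2 * (X * Y)); [rewrite s2 mul1r; exact: mulrC|ring].
Qed.

(** The residue map is diagonal in the gauged basis, with inverse given by
    Kronecker functions. *)
Lemma r_tildeE x1 x2 y1 y2 A : ~ lattice tau (x2 - x1) -> ~ same_point tau y1 y2 ->
  r_tilde tau x1 x2 y1 y2 A =
  \sum_p (pcoef p (gauge y1 A) * kron tau p.1 p.2 (x2 - x1) (y2 - y1)) *: ungauge y2 (pauli R p).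
Proof.
move=> hx hy; pose F := hom tau (x2 - x1) y1 (fun p => pcoef p (gauge y1 A)).
have hF : Hom_pole tau x1 x2 y1 F by exact: hom_pole.
have rF : residue y1 F = A by rewrite hom_residue // -pauli_dec gaugeK.
have [h1 h2] := pinvP (residue y1) hF; rewrite rF in h1 h2.
rewrite /r_tilde /eval_at (hom_pole_unique htau hx hy h1 hF) ?h2 ?rF //.
rewrite /F /hom; exact: (lin_sum (fun p => _) _ (@ungauge_lin R tau y2)).
Qed.

Lemma tcontract_insert (r : tensor2 R) A : tcontract r A = insert (fun X Y : M2 => \tr (X *m A) *: Y) r.
Proof.
by apply: eq_bigr => i _; apply: eq_bigr => j _; apply: eq_bigr => k _; apply: eq_bigr => l _; rewrite scalerA.
Qed.

Lemma tcontract_lin A : linear (fun r : tensor2 R => tcontract r A).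
Proof. by move=> a r r'; rewrite !tcontract_insert insert_lin. Qed.

Lemma tcontract_tens (X Y A : M2) : tcontract (X *t Y) A = \tr (X *m A) *: Y.
Proof.
rewrite tcontract_insert; apply: insert_tens => [B|B] a M N.
  by rewrite mulmxDl -scalemxAl mxtraceD mxtraceZ scalerDl scalerA.
by rewrite scalerDr !scalerA mulrC.
Qed.

(** The contraction with elementary matrices reads off the coefficients of a
    tensor, so a linear map has only one tensor. *)
Lemma tcontract_inj (r r' : tensor2 R) : (forall A, tcontract r A = tcontract r' A) -> r = r'.
Proof.
have H (s : tensor2 R) (i j k l : 'I_2) : tcontract s (delta_mx j i) k l = tcoef s i j k l.
  have Hi (f : 'I_2 -> M2) i0 : (forall i', i' != i0 -> f i' = 0) -> \sum_i' f i' = f i0.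
    by move=> h; rewrite (bigD1 i0) //= big1 ?addr0 // => i' /h.
  have tr0 i' j' : \tr ((delta_mx i' j' : M2) *m delta_mx j i) = ((i' == i) && (j' == j))%:R.
    have td : \tr (delta_mx i' i : M2) = (i' == i)%:R.
      rewrite /mxtrace (bigD1 i) //= mxE eqxx andbT big1 ?addr0 1?eq_sym // => k' /negbTE ki.
      by rewrite mxE ki andbF.
    by rewrite mul_delta_mx_cond raddfMn /= td; case: (i' == i); case: (j' == j).
  rewrite /tcontract (Hi _ i) => [|i' ii].
    rewrite (Hi _ j) => [|j' jj].
      rewrite summxE (bigD1 k) //= [X in _ + X]big1 ?addr0 => [|k' kk]; last first.
        by rewrite summxE big1 // => l' _; rewrite !mxE eq_sym (negbTE kk) mulr0.
      rewrite summxE (bigD1 l) //= [X in _ + X]big1 ?addr0 => [|l' ll]; last first.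
        by rewrite !mxE (eq_sym l) (negbTE ll) andbF mulr0.
      by rewrite !mxE tr0 !eqxx !mulr1.
    by rewrite big1 // => k' _; rewrite big1 // => l' _; rewrite tr0 (negbTE jj) andbF mulr0 scale0r.
  rewrite big1 // => j' _; rewrite big1 // => k' _; rewrite big1 // => l' _.
  by rewrite tr0 (negbTE ii) mulr0 scale0r.
move=> h; apply/matrixP => a b; rewrite -(mxtens_unindexK a) -(mxtens_unindexK b).
case: (mxtens_unindex a) (mxtens_unindex b) => i k [j l].
by have := H r i j k l; rewrite h H => e; exact: (esym e).
Qed.

Lemma r_geomE x1 x2 y1 y2 : ~ lattice tau (x2 - x1) -> ~ same_point tau y1 y2 ->
  r_geom tau x1 x2 y1 y2 =
  \sum_p (2^-1 * kron tau p.1 p.2 (x2 - x1) (y2 - y1)) *: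
    (ungauge y1 (pauli R p) *t ungauge y2 (pauli R p)).
Proof.
move=> hx hy; set r0 := \sum_p _.
have h0 A : tcontract r0 A = r_tilde tau x1 x2 y1 y2 A.
  rewrite r_tildeE // (lin_sum (fun p => _) _ (@tcontract_lin A)); apply: eq_bigr => p _.
  rewrite tcontract_tens scalerA; congr (_ *: _); rewrite /pcoef.
  have -> : \tr (ungauge y1 (pauli R p) *m A) = \tr (pauli R p *m gauge y1 A).
    rewrite -[A in LHS](gaugeK tau y1) -ungauge_mul; move: (_ *m _) => M.
    by rewrite !mxtrace2 /ungauge_at !mx2_entries.
  by ring.
have : [set r | forall A, tcontract r A = r_tilde tau x1 x2 y1 y2 A] (r_geom tau x1 x2 y1 y2).
  by apply: (xgetPex point); exists r0.
by move=> h; apply: tcontract_inj => A; rewrite h h0.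
Qed.

Definition gauge_mx (v : C * C) : M2 := mx2 1 0 0 (gfun tau v.2).

Lemma gauge_mxV v : gauge_mx v *m mx2 1 0 0 (gfun tau v.2)^-1 = 1%:M.
Proof.
by rewrite mulmx_mx2 mx2_1 !(mulr0, mul0r, mulr1, mul1r, addr0, add0r) mulfV ?gfun_neq0.
Qed.

Lemma gauge_mx_unit v : gauge_mx v \in unitmx.
Proof. by have /mulmx1_unit[] := gauge_mxV v. Qed.

Lemma invmx_gauge v : invmx (gauge_mx v) = mx2 1 0 0 (gfun tau v.2)^-1.
Proof. by rewrite -[RHS](mulKmx (gauge_mx_unit v)) gauge_mxV mulmx1. Qed.

Lemma gauge_mxE (v w : C * C) M : v.2 = w.2 -> gauge_mx v *m ungauge v.2 M *m invmx (gauge_mx w) = M.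
Proof.
move=> vw; rewrite invmx_gauge -vw /gauge_mx /ungauge_at !mulmx_mx2 [RHS]mx2E.
by have := gfun_neq0 tau v.2; move: (gfun tau v.2) => g g0; congr mx2; field.
Qed.

Lemma gauge_mx_diff v : differentiable gauge_mx v.
Proof.
apply: diff_mx2; [exact: differentiable_cst|exact: differentiable_cst|exact: differentiable_cst|].
have d2 : differentiable (snd : C * C -> C) v.
  by apply: (@linear_differentiable C (C * C)%type C (@snd C C)) => w; exact: cvg_snd.
exact: (differentiable_comp d2 (dif_gfun tau v.2)).
Qed.

Lemma gauge_equivalence (U V : set C) : gauge_equivalent tau U V (r_geom tau)
  (fun x1 x2 y1 y2 => r_ell tau (x2 - x1) (y2 - y1)).
Proof.
exists gauge_mx; split=> [v _|v _|x1 x2 y1 y2 _ _ _ _ hiso hy].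
- exact: gauge_mx_diff.
- exact: gauge_mx_unit.
have hx : ~ lattice tau (x2 - x1) by move/lattice_bundle_iso.
rewrite /gauge_act r_geomE // r_ellE // mulmx_sumr mulmx_suml; apply: eq_bigr => p _.
rewrite -scalemxAr -scalemxAl !tensmx_mul.
by rewrite (@gauge_mxE (x1, y1) (x2, y1)) // (@gauge_mxE (x2, y2) (x1, y2)).
Qed.

End GeometricRMatrix.

Theorem theorem8p18 (R : realType) (tau : R[i]) (htau : 0 < complex.Im tau) :
  (forall U V : set R[i], open U -> open V ->
     gauge_equivalent tau U V (r_geom tau)
       (fun x1 x2 y1 y2 => r_ell tau (x2 - x1) (y2 - y1))) /\
  AYBE (lattice tau) (r_ell tau).
Proof.
split; last exact: r_ell_AYBE.
by move=> U V _ _; exact: gauge_equivalence.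
Qed.
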